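(* Let $H$ be a complex Hilbert space with $\dim H\ge 2$ and let $A\in S(H)$. Then the following two conditions are equivalent: (1) At least one of the operators $A_+$ and $A_-$ is compact. (2) The map $\Phi_A$ is an order isomorphism from $U_A$ onto $U_{-A}$.
   Context: $S(H)$ is the set of bounded self-adjoint operators on $H$, with the operator norm topology and the usual order. $A_+:=A\chi_{(0,\infty)}(A)$ and $A_-:=-A\chi_{(-\infty,0)}(A)$ are the positive and negative parts of $A$ (Borel functional calculus). For $A\in S(H)$, $U_A$ is the connected component containing $0$ of the open set $\{X\in S(H): XA+I\text{ is invertible}\}$, and $\Phi_A:U_A\to S(H)$ is defined by $\Phi_A(X)=(XA+I)^{-1}X$; it is a bijection of $U_A$ onto $U_{-A}$. An order isomorphism is a bijection $\phi$ with $X\le Y\iff\phi(X)\le\phi(Y)$. *)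

(* Defs.v *)
From HB Require Import structures.
From mathcomp Require Import all_boot all_order all_algebra.
From mathcomp Require Import sesquilinear.
From mathcomp Require Import complex.
From mathcomp Require Import all_classical all_reals all_analysis.

Set Implicit Arguments.
Unset Strict Implicit.
Unset Printing Implicit Defensive.

Import Order.TTheory GRing.Theory Num.Theory.
Import numFieldNormedType.Exports.

Local Open Scope classical_set_scope.
Local Open Scope complex_scope.
Local Open Scope ring_scope.

Section BoundedOperators.
Context {R : realType} {H : normedModType R[i]}.
Implicit Types f g : H -> H.

Definition bounded_op_pred : {pred (H -> H)} :=
  mem [set f : H -> H | linear f /\ continuous f].

Lemma bounded_op_predP f :
  reflect (linear f /\ continuous f) (f \in bounded_op_pred).
Proof. by apply: (iffP idP) => [|?]; [move/set_mem|apply/mem_set]. Qed.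

Fact bounded_op_submod_closed : submod_closed bounded_op_pred.
Proof.
split.
  apply/bounded_op_predP; split.
    by move=> a x y; rewrite /GRing.zero /= scaler0 addr0.
  by move=> x; exact: cvg_cst.
move=> a f g /bounded_op_predP[lf cf] /bounded_op_predP[lg cg].
apply/bounded_op_predP; split.
  move=> b x y; rewrite !fctE lf lg !scalerDr !scalerA mulrC.
  by rewrite addrACA -scalerA.
by move=> x; apply: cvgD; [apply: cvgZl_tmp; exact: cf|exact: cg].
Qed.

HB.instance Definition _ :=
  GRing.isSubmodClosed.Build _ _ bounded_op_pred bounded_op_submod_closed.

End BoundedOperators.

(* The algebra B(H). *)
Record bounded_op {R : realType} (H : normedModType R[i]) := BoundedOp {
  bounded_op_fun :> H -> H ;
  bounded_op_funP : bounded_op_fun \in bounded_op_pred }.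

Section BoundedOpAlgebra.
Context {R : realType} {H : normedModType R[i]}.
Implicit Types S T : bounded_op H.

HB.instance Definition _ := [isSub for @bounded_op_fun R H].
HB.instance Definition _ := gen_eqMixin (bounded_op H).
HB.instance Definition _ := gen_choiceMixin (bounded_op H).
HB.instance Definition _ :=
  [SubChoice_isSubLmodule of bounded_op H by <:].

Lemma bounded_opP S T : (forall x, S x = T x) -> S = T.
Proof. by move=> ST; apply: val_inj; apply/funext. Qed.

Lemma bounded_op_linear T : linear T.
Proof. by have /bounded_op_predP[] := bounded_op_funP T. Qed.

HB.instance Definition _ T :=
  GRing.isLinear.Build R[i] H H *:%R T (bounded_op_linear T).

Lemma bounded_op_continuous T : continuous T.
Proof. by have /bounded_op_predP[] := bounded_op_funP T. Qed.

Fact bounded_op_id_subproof : @idfun H \in bounded_op_pred.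
Proof. by apply/bounded_op_predP; split=> // x; exact: cvg_id. Qed.

Definition bounded_op_id := BoundedOp bounded_op_id_subproof.

Fact bounded_op_comp_subproof S T : S \o T \in bounded_op_pred.
Proof.
apply/bounded_op_predP; split; first by move=> a x y /=; rewrite !linearP.
by move=> x; apply: continuous_comp; exact: bounded_op_continuous.
Qed.

Definition bounded_op_comp S T := BoundedOp (bounded_op_comp_subproof S T).

Fact bounded_op_compA : associative bounded_op_comp.
Proof. by move=> S T U; exact: bounded_opP. Qed.
Fact bounded_op_comp1o : left_id bounded_op_id bounded_op_comp.
Proof. by move=> T; exact: bounded_opP. Qed.
Fact bounded_op_compo1 : right_id bounded_op_id bounded_op_comp.
Proof. by move=> T; exact: bounded_opP. Qed.
Fact bounded_op_compDl : left_distributive bounded_op_comp +%R.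
Proof. by move=> S T U; exact: bounded_opP. Qed.
Fact bounded_op_compDr : right_distributive bounded_op_comp +%R.
Proof. by move=> S T U; apply: bounded_opP => x; exact: linearD. Qed.

HB.instance Definition _ := GRing.Zmodule_isPzRing.Build (bounded_op H)
  bounded_op_compA bounded_op_comp1o bounded_op_compo1
  bounded_op_compDl bounded_op_compDr.

End BoundedOpAlgebra.

Section OperatorNorm.
Context {R : realType} {H : normedModType R[i]}.
Implicit Types S T : bounded_op H.

(* Norms of a normed module over R[i] are elements of R[i]; they are
   nonnegative, hence real. *)
Definition opnorm T : R[i] :=
  (sup [set complex.Re `|T x| | x in [set x : H | `|x| <= 1]])%:C.

Lemma ReK_norm (x : H) : (complex.Re `|x|)%:C = `|x|.
Proof. by apply: RRe_real; exact: ger0_real. Qed.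

Lemma opnorm_has_sup T :
  has_sup [set complex.Re `|T x| | x in [set x : H | `|x| <= 1]].
Proof.
split; first by exists (complex.Re `|T 0|), 0; rewrite /= ?normr0.
have /linear_boundedP/pinfty_ex_gt0[M M0 TM] :=
  continuous_linear_bounded 0 (@bounded_op_continuous _ _ T 0).
exists (complex.Re M) => _ [x /= x1 <-].
rewrite -lecR ReK_norm RRe_real ?gtr0_real//.
by rewrite (le_trans (TM x))// ler_piMr// ltW.
Qed.

Lemma opnormP T x : `|T x| <= opnorm T * `|x|.
Proof.
have [->|x0] := eqVneq x 0; first by rewrite linear0 !normr0 mulr0.
have nx0 : 0 < `|x| by rewrite normr_gt0.
rewrite -ler_pdivrMr// mulrC -[`|x|^-1]ger0_norm ?invr_ge0//.
rewrite -normrZ -linearZ -(ReK_norm (T _)) /opnorm lecR.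
apply: ub_le_sup; first by have [] := opnorm_has_sup T.
exists (`|x|^-1 *: x) => //=.
by rewrite normrZ ger0_norm ?invr_ge0// mulVf ?gt_eqF.
Qed.

Lemma opnorm_ge0 T : 0 <= opnorm T.
Proof.
have T00 : complex.Re `|T 0| = 0 by rewrite linear0 normr0.
rewrite /opnorm lecR -T00.
apply: ub_le_sup; first by have [] := opnorm_has_sup T.
by exists 0; rewrite /= ?normr0.
Qed.

Lemma opnorm_le T (M : R[i]) : 0 <= M -> (forall x, `|T x| <= M * `|x|) ->
  opnorm T <= M.
Proof.
move=> M0 TM; rewrite -(RRe_real (ger0_real M0)) /opnorm lecR.
apply: ge_sup; first by have [] := opnorm_has_sup T.
move=> _ [x /= x1 <-]; rewrite -lecR ReK_norm RRe_real ?ger0_real//.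
by rewrite (le_trans (TM x))// ler_piMr.
Qed.

Fact ler_opnormD S T : opnorm (S + T) <= opnorm S + opnorm T.
Proof.
apply: opnorm_le => [|x]; first by rewrite addr_ge0 ?opnorm_ge0.
rewrite mulrDl (le_trans (ler_normD (S x) (T x)))//.
by rewrite lerD ?opnormP.
Qed.

Fact opnormZ (a : R[i]) T : opnorm (a *: T) = `|a| * opnorm T.
Proof.
have le b U : opnorm (b *: U) <= `|b| * opnorm U.
  apply: opnorm_le => [|x]; first by rewrite mulr_ge0 ?opnorm_ge0.
  by rewrite -mulrA [leLHS]normrZ ler_wpM2l ?opnormP.
apply/eqP; rewrite eq_le le /=; have [->|a0] := eqVneq a 0.
  by rewrite normr0 mul0r opnorm_ge0.
rewrite -ler_pdivlMl ?normr_gt0// -normfV (le_trans _ (le _ _))//.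
by rewrite scalerA mulVf// scale1r.
Qed.

Fact opnorm0_eq0 T : opnorm T = 0 -> T = 0.
Proof.
move=> T0; apply: bounded_opP => x; apply/eqP.
by rewrite -normr_le0 (le_trans (opnormP T x))// T0 mul0r.
Qed.

(* This also equips B(H) with the operator norm topology. *)
HB.instance Definition _ := Lmodule_isNormed.Build R[i] (bounded_op H)
  ler_opnormD opnormZ opnorm0_eq0.

End OperatorNorm.

Section Inverse.
Context {R : realType} {H : normedModType R[i]}.
Implicit Types S T : bounded_op H.

Definition invertible T := exists S, S * T = 1 /\ T * S = 1.

(* The inverse in B(H), with the junk value 0 if T is not invertible. *)
Definition op_inv T : bounded_op H :=
  xget 0 [set S | S * T = 1 /\ T * S = 1].

Definition compact_op T := precompact (T @` [set x : H | `|x| <= 1]).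

Definition dim_ge (n : nat) := exists v : 'I_n -> H,
  forall a : 'I_n -> R[i], \sum_i a i *: v i = 0 -> forall i, a i = 0.

End Inverse.
Arguments dim_ge {R} H n.

Section Hilbert.
Context {R : realType} {H : normedModType R[i]}.
Variable dot : {dot H for (@Num.conj R[i])}.
Implicit Types A X Y T : bounded_op H.
Implicit Types E : set R -> bounded_op H.

Local Notation "'[ u , v ]" := (dot u v).

Definition self_adjoint T := forall x y, '[T x, y] = '[x, T y].

Definition le_op X Y := forall x, '[X x, x] <= '[Y x, x].

Definition order_isomorphism (U V : set (bounded_op H))
    (phi : bounded_op H -> bounded_op H) :=
  set_bij U V phi /\
  forall X Y, U X -> U Y -> (le_op X Y <-> le_op (phi X) (phi Y)).

(* <T x, x>, which is real when T is self-adjoint. *)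
Definition quad T x : R := complex.Re '[T x, x].

(* mu is the scalar measure B |-> <E(B) x, x>. *)
Definition scalar_measure E x
    (mu : {measure set (measurableTypeR R) -> \bar R}) :=
  forall B, measurable B -> mu B = (quad (E B) x)%:E.

(* E is a projection-valued Borel measure on the real line (its values on
   non-measurable sets are irrelevant) and A is the integral of t dE(t).
   Countable additivity of E is that of its scalar measures. *)
Definition spectral_measure A E :=
  [/\ forall B, measurable B -> self_adjoint (E B) /\ E B * E B = E B,
      E setT = 1,
      forall B C, measurable B -> measurable C -> E (B `&` C) = E B * E C &
      forall x, exists mu : {measure set (measurableTypeR R) -> \bar R},
        [/\ scalar_measure E x mu,
            mu.-integrable setT (fun t : R => t%:E) &
            (\int[mu]_t (t : R)%:E)%E = (quad A x)%:E]].

(* Borel functional calculus: f(A) is the self-adjoint operator such that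
   <f(A) x, x> is the integral of f(t) d<E(t) x, x> for all x, where E is the
   spectral measure of A. Meaningful for A self-adjoint and f : R -> R bounded
   and Borel. *)
Definition borel_calculus A (f : R -> R) : bounded_op H :=
  xget 0 [set T | self_adjoint T /\ exists E, spectral_measure A E /\
    forall x mu, scalar_measure E x mu ->
      (quad T x)%:E = (\int[mu]_t (f t)%:E)%E].

Definition pos_part A : bounded_op H := A * borel_calculus A \1_`]0, +oo[.
Definition neg_part A : bounded_op H := - A * borel_calculus A \1_`]-oo, 0[.

Definition Udom A : set (bounded_op H) :=
  connected_component [set X | self_adjoint X /\ invertible (X * A + 1)] 0.

Definition Phi A X : bounded_op H := op_inv (X * A + 1) * X.

End Hilbert.

(* Main.v *)
(** If [A_-] is compact, then for every [eps > 0] the form of [A + eps] has a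
finite negative index.  Replacing [X] by [X + D] changes the form of
[S = A + A X A] at [w] by at most [c |D| |S w|^2], which does not affect its
index; so, with [A + eps] in place of [A] and [eps] small, the index is the same
for all [X] in the connected set [U_A].  If [X <= Y] and [Phi_A Y - Phi_A X] took
a negative value, then a direction could be added to a maximal negative subspace
for [A + A Y A] to obtain a larger one for [A + A X A]; hence [Phi_A] is monotone.
The case of [A_+] follows from [Phi_(-A) (- X) = - Phi_A X], and so does the
monotonicity of the inverse [Phi_(-A)].

If neither part is compact, there are orthonormal sequences [e] and [f] in
spectral subspaces on which [A >= d] and [A <= - d].  Compress [A] to the sum of
their closed spans, let [P] be its projection and [W] the inverse of
[P A P + 1 - P].  An invertible self-adjoint [B] which is the identity on
[ker P] gives the point [B - W] of the open set defining [U_A], and a path of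
such [B] a path of points.  Write [J_f] for the reflection [1 - 2 F], where [F]
is the projection on the closed span of [f].  A Hilbert hotel argument joins [W]
to [J_f], to the analogous reflection [J_e] (exchanging [f] with [e]), and then
to [J_f - 2 N], where [N] is the projection on [e_0] (exchanging [f] with
[e_1, e_2, ...]).  So [X = J_f - 2 N - W] and [Y = J_f - W] both lie in [U_A] and
[X <= Y], but the form of [Phi_A Y - Phi_A X] takes the value [-2]. *)

From HB Require Import structures.
Require Import Defs.
From mathcomp Require Import all_boot all_order all_algebra.
From mathcomp Require Import sesquilinear complex.
From mathcomp Require Import all_classical all_reals all_analysis.
From mathcomp Require Import measurable_realfun.
From mathcomp Require Import ring lra.
Import Order.TTheory GRing.Theory Num.Theory numFieldNormedType.Exports.
Set Implicit Arguments.
Unset Strict Implicit.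
Unset Printing Implicit Defensive.
Local Open Scope classical_set_scope.
Local Open Scope complex_scope.
Local Open Scope ring_scope.

(** * Bounded operators and limits *)

Section RealNorm.
Context {R : realType} {V : normedModType R[i]}.
Implicit Types (x y : V) (r : R) (c : R[i]).

(** The parts of [A] are selected by [xget], so the spectral theorem is proved first, to keep the
    selection from falling to the default [0]; after that only a projection that commutes with [A]
    and splits its form is retained. The shift by [eps] is forced: a compact [A_-] may have
    infinitely many eigenvalues accumulating at [0], and then the form of [A] has infinite index and
    comparing [n] with [n + 1] says nothing. The price is a limit [eps -> 0] at the end, so inverses
    must be bounded uniformly in [eps], and the radius within which the index is constant must be
    chosen before [eps]. In the converse the corner helps because an operator [X] supported on [P]
    satisfies [X A P = X (P A P + 1 - P)], which turns membership of [B - W] into invertibility of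
    [B]. Infinite sequences on both sides are essential: for finite ones the number of negative
    eigenvalues would separate the two reflections. *)

Definition rn x : R := complex.Re `|x|.

Lemma rnE x : `|x| = (rn x)%:C.
Proof. by rewrite /rn RRe_real// ger0_real. Qed.

Lemma rn_ge0 x : 0 <= rn x.
Proof. by rewrite -ler0c -rnE. Qed.

Lemma rn0 : rn (0 : V) = 0.
Proof. by rewrite /rn normr0. Qed.

Lemma rn_eq0 x : rn x = 0 -> x = 0.
Proof. by move=> x0; apply/eqP; rewrite -normr_eq0 rnE x0. Qed.

Lemma rn_gt0 x : (0 < rn x) = (x != 0).
Proof. by rewrite -ltcR -rnE normr_gt0. Qed.

Lemma rnN x : rn (- x) = rn x.
Proof. by rewrite /rn normrN. Qed.

Lemma rnBC x y : rn (x - y) = rn (y - x).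
Proof. by rewrite -rnN opprB. Qed.

Lemma rnD x y : rn (x + y) <= rn x + rn y.
Proof. by rewrite -lecR rmorphD/= -!rnE ler_normD. Qed.

Lemma rnB x y : rn (x - y) <= rn x + rn y.
Proof. by rewrite -(rnN y) rnD. Qed.

Lemma rn_tri z x y : rn (x - y) <= rn (x - z) + rn (z - y).
Proof. by rewrite (_ : x - y = (x - z) + (z - y)) ?rnD// addrA subrK. Qed.

Lemma rnZ c x : rn (c *: x) = complex.Re `|c| * rn x.
Proof.
by apply: complexI; rewrite -rnE normrZ rnE rmorphM.
Qed.

Lemma normcR r : `|r%:C| = (`|r|)%:C.
Proof. by rewrite normc_def/= expr0n addr0 sqrtr_sqr. Qed.

Lemma rnZr r x : rn (r%:C *: x) = `|r| * rn x.
Proof. by rewrite rnZ normcR. Qed.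

(** Convergence with real [e]: the norm takes its values in [R[i]], while all estimates below are
    made in [R]. *)
Definition cvs (u : nat -> V) (l : V) :=
  forall e : R, 0 < e -> exists N, forall n, (N <= n)%N -> rn (u n - l) < e.

Lemma le0_eps r : (forall e, 0 < e -> r <= e) -> r <= 0.
Proof.
move=> re; rewrite leNgt; apply/negP => r0.
have := re (r / 2); rewrite divr_gt0// => /(_ isT); lra.
Qed.

Lemma le_eps r s : (forall e, 0 < e -> r <= s + e) -> r <= s.
Proof.
move=> rs; rewrite -subr_le0; apply: le0_eps => e e0.
by rewrite lerBlDl rs.
Qed.

Lemma cvs_unique u l l' : cvs u l -> cvs u l' -> l = l'.
Proof.
move=> ul ul'; apply/eqP; rewrite -subr_eq0; apply/eqP/rn_eq0.
apply/eqP; rewrite eq_le rn_ge0 andbT; apply: le0_eps => e e0.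
have e20 : 0 < e / 2 by rewrite divr_gt0.
have [N hN] := ul _ e20; have [N' hN'] := ul' _ e20.
have h1 := hN _ (leq_maxl N N'); have h2 := hN' _ (leq_maxr N N').
have := rn_tri (u (maxn N N')) l l'; rewrite (rnBC l (u _)); lra.
Qed.

Lemma cvs_le (u : nat -> V) l r : cvs u l -> (forall n, rn (u n) <= r) -> rn l <= r.
Proof.
move=> ul ur; apply: le_eps => e /ul[N /(_ _ (leqnn N))].
rewrite rnBC => h; rewrite -(subrK (u N) l); apply: (le_trans (rnD _ _)).
by rewrite addrC lerD// ltW.
Qed.

Lemma cvsD u v l m : cvs u l -> cvs v m -> cvs (fun n => u n + v n) (l + m).
Proof.
move=> ul vm e e0; have e20 : 0 < e / 2 by rewrite divr_gt0.
have [N hN] := ul _ e20; have [N' hN'] := vm _ e20.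
exists (maxn N N') => n; rewrite geq_max => /andP[/hN h1 /hN' h2].
rewrite opprD addrACA; apply: (le_lt_trans (rnD _ _)); lra.
Qed.

Lemma cvsZ c u l : cvs u l -> cvs (fun n => c *: u n) (c *: l).
Proof.
move=> ul e e0; set k := complex.Re `|c|.
have k0 : 0 <= k by rewrite -ler0c RRe_real// ger0_real.
have k1 : 0 < k + 1 by rewrite ltr_wpDl.
have [|N hN] := ul (e / (k + 1)); first by rewrite divr_gt0.
exists N => n /hN; rewrite -scalerBr rnZ -/k ltr_pdivlMr// => h.
apply: (le_lt_trans _ h); rewrite mulrC ler_wpM2l ?rn_ge0//; lra.
Qed.

Lemma cvsN u l : cvs u l -> cvs (fun n => - u n) (- l).
Proof. by move=> ul e /ul[N hN]; exists N => n /hN; rewrite -opprD rnN. Qed.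

Lemma cvs_cst l : cvs (fun=> l) l.
Proof. by move=> e e0; exists 0%N => n _; rewrite subrr rn0. Qed.

Lemma cvs_shift k u l : cvs u l -> cvs (fun n => u (n + k)%N) l.
Proof.
move=> ul e /ul[N hN]; exists N => n Nn; apply: hN.
by rewrite (leq_trans Nn)// leq_addr.
Qed.

End RealNorm.

Lemma cvs_complete {R : realType} {V : completeNormedModType R[i]} (u : nat -> V) :
  (forall e : R, 0 < e -> exists N, forall n m, (N <= n)%N -> (N <= m)%N ->
    rn (u n - u m) < e) -> exists l, cvs u l.
Proof.
move=> uC.
have /cauchy_cvgP/cvg_ex[l ul] : cauchy (u @ \oo).
  apply/cauchy_ballP => e e0; rewrite !near_map2.
  have e0' : 0 < complex.Re e by rewrite -ltcR RRe_real ?gtr0_real.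
  have [N hN] := uC _ e0'.
  exists ([set n | (N <= n)%N], [set n | (N <= n)%N]).
    by split; exists N.
  case=> n m [/= Nn Nm]; rewrite -ball_normE /ball_/= rnE.
  by rewrite -(RRe_real (gtr0_real e0)) ltcR hN.
exists l => e e0; have e0' : 0 < e%:C by rewrite ltcR.
have /cvgrPdist_lt/(_ _ e0')[N _ hN] := ul.
by exists N => n /hN; rewrite distrC rnE ltcR.
Qed.

Section OpNorm.
Context {R : realType} {H : normedModType R[i]}.
Implicit Types S T : bounded_op H.

Lemma opB S T x : (S - T) x = S x - T x. Proof. by []. Qed.
Lemma opD S T x : (S + T) x = S x + T x. Proof. by []. Qed.
Lemma opN T x : (- T) x = - T x. Proof. by []. Qed.
Lemma opM S T x : (S * T) x = S (T x). Proof. by []. Qed.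
Lemma opZ c T x : (c *: T) x = c *: T x. Proof. by []. Qed.
Lemma op1 x : (1 : bounded_op H) x = x. Proof. by []. Qed.
Lemma op0 x : (0 : bounded_op H) x = 0. Proof. by []. Qed.
Definition opE := (opB, opD, opN, opM, opZ, op1, op0).

Lemma opxB T x y : T (x - y) = T x - T y. Proof. exact: linearB. Qed.
Lemma opxD T x y : T (x + y) = T x + T y. Proof. exact: linearD. Qed.
Lemma opxN T x : T (- x) = - T x. Proof. exact: linearN. Qed.
Lemma opxZ T c x : T (c *: x) = c *: T x. Proof. exact: linearZ. Qed.
Lemma opx0 T : T 0 = 0. Proof. exact: linear0. Qed.

Lemma opZl c S T : (c *: S) * T = c *: (S * T).
Proof. exact: bounded_opP. Qed.

Lemma opZr c S T : S * (c *: T) = c *: (S * T).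
Proof. by apply: bounded_opP => x; rewrite !opE linearZ. Qed.

Lemma rn_op T x : rn (T x) <= rn T * rn x.
Proof. by rewrite -lecR rmorphM/= -!rnE; exact: opnormP. Qed.

Lemma rn_op_le T (M : R) : 0 <= M -> (forall x, rn (T x) <= M * rn x) -> rn T <= M.
Proof.
move=> M0 TM; rewrite -lecR -rnE; apply: opnorm_le => [|x]; first by rewrite ler0c.
by rewrite !rnE -rmorphM/= lecR.
Qed.

Lemma rn_opM S T : rn (S * T) <= rn S * rn T.
Proof.
apply: rn_op_le => [|x]; first by rewrite mulr_ge0 ?rn_ge0.
rewrite -mulrA; apply: (le_trans (rn_op S (T x))).
by rewrite ler_wpM2l ?rn_ge0 ?rn_op.
Qed.

Lemma rn_op1 : rn (1 : bounded_op H) <= 1.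
Proof. by apply: rn_op_le => // x; rewrite mul1r. Qed.

Lemma cvs_op T u l : cvs u l -> cvs (fun n => T (u n)) (T l).
Proof.
move=> ul e e0; have k1 : 0 < rn T + 1 by rewrite ltr_wpDl ?rn_ge0.
have [|N hN] := ul (e / (rn T + 1)); first by rewrite divr_gt0.
exists N => n /hN; rewrite -linearB ltr_pdivlMr// => h.
apply: le_lt_trans h; apply: (le_trans (rn_op _ _)).
rewrite mulrC ler_wpM2l ?rn_ge0//; lra.
Qed.

Lemma cvs_opP (F : nat -> bounded_op H) T x : cvs F T -> cvs (fun n => F n x) (T x).
Proof.
move=> TT e e0; have k1 : 0 < rn x + 1 by rewrite ltr_wpDl ?rn_ge0.
have [|N hN] := TT (e / (rn x + 1)); first by rewrite divr_gt0.
exists N => n /hN; rewrite -opB ltr_pdivlMr// => h.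
apply: le_lt_trans h; apply: (le_trans (rn_op _ _)).
rewrite ler_wpM2l ?rn_ge0//; lra.
Qed.

Lemma mk_op (f : H -> H) (M : R) : linear f -> (forall x, rn (f x) <= M * rn x) ->
  exists T : bounded_op H, forall x, T x = f x.
Proof.
move=> lf fM.
pose F : {linear H -> H} := HB.pack f (GRing.isLinear.Build R[i] H H *:%R f lf).
have cf : continuous F.
  apply/linear_bounded_continuous/linear_boundedP.
  exists M%:C; split => [|r Mr x]; first by apply/complex_realP; exists M.
  rewrite -[F x]/(f x) rnE (le_trans (y := (M * rn x)%:C)) ?lecR//.
  by rewrite rmorphM/= -rnE ler_wpM2r// ltW.
have fP : f \in bounded_op_pred by apply/bounded_op_predP.
by exists (BoundedOp fP).
Qed.

End OpNorm.

Section OpLimits.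
Context {R : realType} {H : completeNormedModType R[i]}.
Implicit Types (S T : bounded_op H) (F : nat -> bounded_op H).

(** Completeness supplies the limit at each vector, and the common bound [M] passes to it. *)
Lemma strong_limit F (M : R) : 0 <= M ->
  (forall n x, rn (F n x) <= M * rn x) ->
  (forall x (e : R), 0 < e -> exists N, forall n m, (N <= n)%N -> (N <= m)%N ->
    rn (F n x - F m x) < e) ->
  exists T, forall x, cvs (fun n => F n x) (T x).
Proof.
move=> M0 TM TC.
have /choice[f fP] : forall x, exists l, cvs (fun n => F n x) l.
  by move=> x; apply: cvs_complete; exact: TC.
have lf : linear f.
  move=> a x y; apply: (@cvs_unique _ _ (fun n => F n (a *: x + y))) => //.
  have -> : (fun n => F n (a *: x + y)) = (fun n => a *: F n x + F n y).
    by apply/funext => n; rewrite linearP.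
  by apply: cvsD; [apply: cvsZ|].
have [|T TE] := @mk_op _ _ f M lf.
  by move=> x; apply: cvs_le (fP x) _ => n; exact: TM.
by exists T => x; rewrite TE.
Qed.

(** [y] is a scalar majorant: nondecreasing and bounded, hence Cauchy, and it dominates the
    increments of [F]. In the applications it is the recursion of [F] run on norms. *)
Lemma norm_limit F (y : nat -> R) (M : R) : (forall n, y n <= M) ->
  (forall n, rn (F n.+1 - F n) <= y n.+1 - y n) -> exists T, cvs F T.
Proof.
move=> yM Ty.
have Tnm n k : rn (F (n + k)%N - F n) <= y (n + k)%N - y n.
  elim: k => [|k IH]; first by rewrite addn0 !subrr rn0.
  apply: (le_trans (rn_tri (F (n + k)%N) _ _)); rewrite addnS.
  by apply: (le_trans (lerD (Ty _) IH)); rewrite addrA subrK.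
have yS n k : y n <= y (n + k)%N.
  by rewrite -subr_ge0 (le_trans _ (Tnm _ _))// rn_ge0.
have hs : has_sup (range y).
  by split; [exists (y 0%N), 0%N|exists M => _ [n _ <-]].
have yC e : 0 < e -> exists N, forall n m, (N <= n)%N -> (n <= m)%N ->
    rn (F m - F n) < e.
  move=> e0; have [_ [N _ <-] yN] := sup_adherent e0 hs.
  exists N => n m Nn nm; rewrite -(subnKC nm); apply: le_lt_trans (Tnm _ _) _.
  have := yS N (n - N)%N; rewrite !subnKC// => h.
  have : y m <= sup (range y) by apply: ub_le_sup; [case: hs|exists m].
  lra.
have yC2 e : 0 < e -> exists N, forall n m, (N <= n)%N -> (N <= m)%N ->
    rn (F n - F m) < e.
  move=> /yC[N hN]; exists N => n m Nn Nm.
  by case: (leqP n m) => nm; [rewrite rnBC hN|rewrite hN// ltnW].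
have TM n x : rn (F n x) <= (rn (F 0%N) + (`|M| + `|y 0%N|)) * rn x.
  apply: (le_trans (rn_op _ _)); rewrite ler_wpM2r ?rn_ge0//.
  rewrite -(subrK (F 0%N) (F n)) (le_trans (rnD _ _))// addrC lerD2l.
  have := Tnm 0%N n; rewrite add0n => /le_trans; apply.
  have := yM n; have := ler_norm M; have := ler_norm (- y 0%N); rewrite normrN; lra.
have [||T TT] := strong_limit _ TM.
- by rewrite !addr_ge0// rn_ge0.
- move=> x e e0; have k1 : 0 < rn x + 1 by rewrite ltr_wpDl ?rn_ge0.
  have [|N hN] := yC2 (e / (rn x + 1)); first by rewrite divr_gt0.
  exists N => n m Nn Nm; have := hN _ _ Nn Nm.
  rewrite -opB ltr_pdivlMr// => h; apply: le_lt_trans h.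
  apply: (le_trans (rn_op _ _)); rewrite ler_wpM2l ?rn_ge0//; lra.
(* The strong limit is a norm limit: bound [F n x - F m x] by the Cauchy estimate and let [m] grow
   with [x] fixed. *)
exists T => e e0; have e20 : 0 < e / 2 by rewrite divr_gt0.
have [N hN] := yC2 _ e20; exists N => n Nn.
suff : rn (F n - T) <= e / 2 by lra.
apply: rn_op_le => [|x]; first exact: ltW.
apply: (@cvs_le _ _ (fun m => F n x - F (m + N)%N x)).
  rewrite opB; apply: cvsD; first exact: cvs_cst.
  exact/cvsN/(cvs_shift N (TT x)).
move=> m; rewrite -opB; apply: (le_trans (rn_op _ _)).
by rewrite ler_wpM2r ?rn_ge0// ltW// hN// leq_addl.
Qed.

End OpLimits.

(** * The real inner product and positive operators *)

Section RealInner.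
Context {R : realType} {H : completeNormedModType R[i]}.
Variable dot : {dot H for (@Num.conj R[i])}.
Hypothesis dot_norm : forall x : H, dot x x = `|x| ^+ 2.
Implicit Types (x y z : H) (r : R) (S T : bounded_op H).

Lemma ReD (a b : R[i]) : complex.Re (a + b) = complex.Re a + complex.Re b.
Proof. by case: a b => a a' [b b']. Qed.

Lemma ReM (a b : R[i]) : complex.Re (a * b) =
  complex.Re a * complex.Re b - complex.Im a * complex.Im b.
Proof. by case: a b => a a' [b b']. Qed.

Lemma Re_conj (a : R[i]) : complex.Re (Num.conj a) = complex.Re a.
Proof. by case: a. Qed.

Definition re_dot x y : R := complex.Re (dot x y).
Local Notation rd := re_dot.

Lemma rdDl x y z : rd (x + y) z = rd x z + rd y z.
Proof. by rewrite /rd linearDl ReD. Qed.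

Lemma rdC x y : rd x y = rd y x.
Proof. by rewrite /rd (hermC dot y x) expr0 mul1r Re_conj. Qed.

Lemma rdDr x y z : rd z (x + y) = rd z x + rd z y.
Proof. by rewrite !(rdC z) rdDl. Qed.

Lemma rdZl r x y : rd (r%:C *: x) y = r * rd x y.
Proof.
by rewrite /rd linearZl_LR ReM/= mul0r subr0.
Qed.

Lemma rdZr r x y : rd x (r%:C *: y) = r * rd x y.
Proof. by rewrite !(rdC x) rdZl. Qed.

Lemma rdNl x y : rd (- x) y = - rd x y.
Proof. by rewrite /rd linearNl -mulN1r ReM/= oppr0 mul0r subr0 mulN1r. Qed.

Lemma rdNr x y : rd x (- y) = - rd x y.
Proof. by rewrite !(rdC x) rdNl. Qed.

Lemma rdBl x y z : rd (x - y) z = rd x z - rd y z.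
Proof. by rewrite rdDl rdNl. Qed.

Lemma rdBr x y z : rd z (x - y) = rd z x - rd z y.
Proof. by rewrite rdDr rdNr. Qed.

Lemma rd0l x : rd 0 x = 0.
Proof. by rewrite /rd linear0l. Qed.

Lemma rd0r x : rd x 0 = 0.
Proof. by rewrite rdC rd0l. Qed.

Definition rdE := (rdDl, rdDr, rdBl, rdBr, rdNl, rdNr, rdZl, rdZr, rd0l, rd0r).

Lemma rdxx x : rd x x = rn x ^+ 2.
Proof. by rewrite /rd dot_norm rnE -rmorphXn. Qed.

(** The imaginary part is the real part against ['i *: y], so the real inner product determines
    [dot]. *)
Lemma dotE x y : dot x y = rd x y +i* rd x ('i *: y).
Proof.
rewrite /rd linearZr_LR [(_ \; _) _ _]/= ReM/= mul0r sub0r mulN1r opprK.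
by case: (dot x y).
Qed.

Lemma dotDl x y z : dot (x + y) z = dot x z + dot y z.
Proof. exact: linearDl. Qed.

Lemma dotBl x y z : dot (x - y) z = dot x z - dot y z.
Proof. exact: linearBl. Qed.

Lemma dotZl (c : R[i]) x y : dot (c *: x) y = c * dot x y.
Proof. exact: linearZl_LR. Qed.

Lemma rd_i x y : rd ('i *: x) ('i *: y) = rd x y.
Proof.
rewrite /rd linearZl_LR linearZr_LR [(_ \; _) _ _]/= mulrA.
by rewrite -normCK normc_def/= expr0n expr1n add0r sqrtr1 expr1n mul1r.
Qed.

Lemma rd_suml (I : Type) (s : seq I) (P : pred I) (u : I -> H) y :
  rd (\sum_(i <- s | P i) u i) y = \sum_(i <- s | P i) rd (u i) y.
Proof.
by apply: (big_morph (rd^~ y)) => [a b|]; [exact: rdDl|exact: rd0l].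
Qed.

Lemma rd_ge0 x : 0 <= rd x x.
Proof. by rewrite rdxx sqr_ge0. Qed.

Lemma rd_eq0 x : rd x x = 0 -> x = 0.
Proof. by rewrite rdxx => /eqP; rewrite sqrf_eq0 => /eqP/rn_eq0. Qed.

(** A relation rather than an operation. By complex linearity the identity for real parts is the
    full adjoint relation, and [adj T T] is self-adjointness ([saP]). *)
Definition adj S T := forall x y, rd (S x) y = rd x (T y).

Lemma saP T : self_adjoint dot T <-> adj T T.
Proof.
split=> [sT x y|sT x y]; first by rewrite /rd sT.
by rewrite !dotE sT -linearZ sT.
Qed.

Lemma adjointM S S' T T' : adj S S' -> adj T T' -> adj (S * T) (T' * S').
Proof. by move=> sS sT x y; rewrite !opM sS sT. Qed.

Lemma adjointD S S' T T' : adj S S' -> adj T T' -> adj (S + T) (S' + T').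
Proof. by move=> sS sT x y; rewrite !opD !rdE sS sT. Qed.

Lemma adjointN S S' : adj S S' -> adj (- S) (- S').
Proof. by move=> sS x y; rewrite !opN !rdE sS. Qed.

Lemma adjointB S S' T T' : adj S S' -> adj T T' -> adj (S - T) (S' - T').
Proof. by move=> sS sT; apply: adjointD => //; apply: adjointN. Qed.

Lemma adjointZ r S S' : adj S S' -> adj (r%:C *: S) (r%:C *: S').
Proof. by move=> sS x y; rewrite !opZ !rdE sS. Qed.

Lemma adjoint1 : adj 1 1. Proof. by []. Qed.

Lemma adjoint0 : adj 0 0. Proof. by move=> x y; rewrite !op0 !rdE. Qed.

Lemma adjointX T n : adj T T -> adj (T ^+ n) (T ^+ n).
Proof.
move=> sT; elim: n => [|n IH]; first exact: adjoint1.
by rewrite {1}exprS exprSr; apply: adjointM.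
Qed.

Definition psd T := adj T T /\ forall x, 0 <= rd (T x) x.

Lemma psd_CS T x y : psd T -> rd (T x) y ^+ 2 <= rd (T x) x * rd (T y) y.
Proof.
move=> [sT pT]; set a := rd (T x) x; set b := rd (T x) y; set c := rd (T y) y.
have q t : 0 <= a + 2 * t * b + t ^+ 2 * c.
  have := pT (x + t%:C *: y); rewrite linearD linearZ !rdE (sT y x) (rdC y) -/a -/b -/c.
  by have -> : a + t * b + t * (b + t * c) = a + 2 * t * b + t ^+ 2 * c by ring.
have a0 : 0 <= a by exact: pT.
have c0 : 0 <= c by exact: pT.
case: (eqVneq c 0) => [c_0|cn0]; last first.
  have cp : 0 < c by rewrite lt_neqAle eq_sym cn0.
  have := q (- b / c).
  have -> : a + 2 * (- b / c) * b + (- b / c) ^+ 2 * c = a - b ^+ 2 / c by field.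
  by rewrite subr_ge0 ler_pdivrMr.
rewrite c_0 mulr0; case: (eqVneq b 0) => [->|bn0]; first by rewrite expr0n.
(* With [c = 0] the polynomial is affine with slope [2 * b], and it takes the value [-1] at this
   point. *)
have := q (- (a + 1) / (2 * b)); rewrite c_0 mulr0 addr0.
have -> : a + 2 * (- (a + 1) / (2 * b)) * b = -1 by field.
by rewrite ler0N1.
Qed.

Lemma psd1 : psd 1.
Proof. by split => // x; exact: rd_ge0. Qed.

Lemma CS x y : `|rd x y| <= rn x * rn y.
Proof.
rewrite -(@ler_pXn2r _ 2)// ?nnegrE ?mulr_ge0 ?rn_ge0//.
rewrite real_normK ?num_real// exprMn -!rdxx; exact: (psd_CS x y psd1).
Qed.

Lemma CSle x y : rd x y <= rn x * rn y.
Proof. exact: le_trans (ler_norm _) (CS x y). Qed.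

Lemma rd_op_le T x : rd (T x) x <= rn T * rn x ^+ 2.
Proof.
apply: (le_trans (CSle _ _)); rewrite expr2 mulrA ler_wpM2r ?rn_ge0//.
exact: rn_op.
Qed.

Lemma rd_op_abs T x : `|rd (T x) x| <= rn T * rn x ^+ 2.
Proof.
apply: (le_trans (CS _ _)); rewrite expr2 mulrA ler_wpM2r ?rn_ge0//.
exact: rn_op.
Qed.

(** Cauchy-Schwarz for the form of [T] at [x] and [T x]: [rn (T x) ^+ 4] is at most [rd (T x) x]
    times the form at [T x], which is at most [M * rn (T x) ^+ 2]. *)
Lemma psd_norm T M x : psd T -> (forall y, rd (T y) y <= M * rn y ^+ 2) ->
  rn (T x) ^+ 2 <= M * rd (T x) x.
Proof.
move=> pT TM; have := psd_CS x (T x) pT; rewrite rdxx.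
case: (eqVneq (rn (T x)) 0) => [Tx0|Tx0].
  rewrite Tx0 expr0n/= => _; have -> : T x = 0 by exact: rn_eq0.
  by rewrite rd0l mulr0.
have tp : 0 < rn (T x) ^+ 2 by rewrite exprn_gt0// lt_neqAle eq_sym Tx0 rn_ge0.
move=> h; rewrite -(ler_pM2r tp) -expr2; apply: (le_trans h).
have := ler_wpM2l (pT.2 x) (TM (T x)); move/le_trans; apply.
by rewrite mulrA [_ * M]mulrC.
Qed.

Lemma psd_opnorm T M : 0 <= M -> psd T -> (forall y, rd (T y) y <= M * rn y ^+ 2) ->
  rn T <= M.
Proof.
move=> M0 pT TM; apply: rn_op_le => // x.
rewrite -(@ler_pXn2r _ 2)// ?nnegrE ?mulr_ge0 ?rn_ge0//.
apply: (le_trans (psd_norm x pT TM)).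
by rewrite exprMn expr2 -mulrA ler_wpM2l.
Qed.

Lemma psd_ker T x : psd T -> rd (T x) x = 0 -> T x = 0.
Proof.
move=> pT Tx0; apply: rn_eq0; apply/eqP; rewrite -sqrf_eq0 eq_le sqr_ge0 andbT.
by rewrite (le_trans (psd_norm x pT (rd_op_le T)))// Tx0 mulr0.
Qed.

Lemma vec_eq x y : (forall z, rd x z = rd y z) -> x = y.
Proof.
move=> xy; apply/eqP; rewrite -subr_eq0; apply/eqP/rd_eq0.
by rewrite rdBl xy subrr.
Qed.

Lemma sa_eq S T : adj S S -> adj T T -> (forall x, rd (S x) x = rd (T x) x) -> S = T.
Proof.
move=> sS sT ST; apply: bounded_opP => x; apply: vec_eq => y.
have := ST (x + y); rewrite !linearD !rdE !ST (sS y x) (sT y x) (rdC y) (rdC y).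
move: (rd (S x) y) (rd (T x) y) (rd (T x) x) (rd (T y) y) => a b c d; lra.
Qed.

(** The order of [R[i]] also compares imaginary parts. These vanish for self-adjoint [A], because
    [rd (A x) ('i *: x)] equals its own opposite. *)
Lemma le_opP S T : adj S S -> adj T T ->
  le_op dot S T <-> forall x, rd (S x) x <= rd (T x) x.
Proof.
have Im0 A x : adj A A -> complex.Im (dot (A x) x) = 0.
  move=> sA; rewrite dotE/= -[LHS](mulr1) -(@divff _ 2%:R) ?pnatr_eq0//.
  rewrite mulrCA mulrA mulr_natl mulr2n.
  have {2}-> : rd (A x) ('i *: x) = - rd (A x) ('i *: x).
    rewrite [LHS]sA linearZ -[LHS]rd_i scalerA -expr2 sqr_i scaleN1r rdNr.
    by rewrite rdC.
  by rewrite subrr mul0r.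
move=> sS sT; split=> ST x; have := ST x; rewrite lecE !Im0// eqxx//.
Qed.

Lemma cvs_rd (u : nat -> H) l y c : cvs u l -> (forall n, rd (u n) y <= c) -> rd l y <= c.
Proof.
move=> ul uc; apply: le_eps => e e0.
have k1 : 0 < rn y + 1 by rewrite ltr_wpDl ?rn_ge0.
have [|N /(_ _ (leqnn N))] := ul (e / (rn y + 1)); first by rewrite divr_gt0.
rewrite ltr_pdivlMr// => h.
rewrite -(subrK (u N) l) rdDl addrC lerD//.
apply: (le_trans (CSle _ _)); rewrite rnBC; apply: le_trans (ltW h).
by rewrite ler_wpM2l ?rn_ge0// lerDl.
Qed.

Lemma cvs_rd_ge (u : nat -> H) l y c :
  cvs u l -> (forall n, c <= rd (u n) y) -> c <= rd l y.
Proof.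
move=> ul uc; rewrite -[rd l y]opprK -rdNr lerNr; apply: (cvs_rd ul) => n.
by rewrite rdNr lerN2.
Qed.

Lemma cvs_adj (F : nat -> bounded_op H) T : (forall n, adj (F n) (F n)) ->
  (forall x, cvs (fun n => F n x) (T x)) -> adj T T.
Proof.
move=> sF FT x y; apply/eqP; rewrite -subr_eq0 -normr_eq0 eq_le normr_ge0 andbT.
have h z w n : rd (F n z - T z) w <= rn (F n z - T z) * rn w by exact: CSle.
apply: le0_eps => e e0.
have k1 : 0 < rn x + rn y + 1 by rewrite ltr_wpDl ?addr_ge0 ?rn_ge0.
have d0 : 0 < e / (rn x + rn y + 1) by rewrite divr_gt0.
have [N hN] := FT x _ d0; have [N' hN'] := FT y _ d0.
set n := maxn N N'.
have h1 := hN n (leq_maxl _ _); have h2 := hN' n (leq_maxr _ _).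
have -> : rd (T x) y - rd x (T y) = rd x (F n y - T y) - rd (F n x - T x) y.
  by rewrite rdBl rdBr sF; ring.
apply: (le_trans (ler_normB _ _)).
apply: (le_trans (lerD (CS _ _) (CS _ _))).
have -> : e = rn x * (e / (rn x + rn y + 1)) + e / (rn x + rn y + 1) * rn y +
   e / (rn x + rn y + 1) by move: (rn x) (rn y) k1 => a b k1; field; rewrite gt_eqF.
rewrite -[leLHS]addr0; apply: lerD; last exact: ltW.
by apply: lerD; [rewrite ler_wpM2l ?rn_ge0// ltW|rewrite ler_wpM2r ?rn_ge0// ltW].
Qed.

End RealInner.

(** * Square roots, absolute values and spectral projections *)

Section SpectralProjection.
Context {R : realType} {H : completeNormedModType R[i]}.
Variable dot : {dot H for (@Num.conj R[i])}.
Hypothesis dot_norm : forall x : H, dot x x = `|x| ^+ 2.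
Implicit Types (x y z : H) (r : R) (B C S T W : bounded_op H).
Implicit Types F : nat -> bounded_op H.
Local Notation rd := (re_dot dot).
Local Notation adj := (adj dot).
Local Notation psd := (psd dot).

Lemma cvs_strong F T M u l : (forall n x, rn (F n x) <= M * rn x) ->
  (forall x, cvs (fun n => F n x) (T x)) -> cvs u l ->
  cvs (fun n => F n (u n)) (T l).
Proof.
move=> FM FT ul.
have -> : (fun n => F n (u n)) = (fun n => F n (u n - l) + F n l).
  by apply/funext => n; rewrite linearB subrK.
rewrite -[T l]add0r; apply: cvsD; last exact: FT.
move=> e e0; have k1 : 0 < `|M| + 1 by rewrite ltr_wpDl.
have [|N hN] := ul (e / (`|M| + 1)); first by rewrite divr_gt0.
exists N => n /hN; rewrite ltr_pdivlMr// subr0 => h; apply: le_lt_trans h.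
apply: (le_trans (FM _ _)); rewrite mulrC ler_wpM2l ?rn_ge0//.
by rewrite (le_trans (ler_norm M))// lerDl.
Qed.

(** [psd_norm] applied to [F n - F m] bounds the square of its norm at [x] by [M] times a difference
    of the numbers [rd (F n x) x], which decrease and are bounded below. *)
Lemma vigier F M : 0 <= M -> (forall n, psd (F n)) ->
  (forall n, psd (F n - F n.+1)) -> (forall x, rd (F 0%N x) x <= M * rn x ^+ 2) ->
  exists2 T, psd T & forall x, cvs (fun n => F n x) (T x).
Proof.
move=> M0 pF dF FM.
have dec n k x : rd (F (n + k)%N x) x <= rd (F n x) x.
  elim: k => [|k IH]; first by rewrite addn0.
  apply: le_trans IH; rewrite addnS -subr_ge0 -rdBl -opB; exact: (dF _).2.
have FnM n x : rd (F n x) x <= M * rn x ^+ 2.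
  by apply: (le_trans _ (FM x)); rewrite -(add0n n) dec.
have pD n k : psd (F n - F (n + k)%N).
  split; first by apply: adjointB; [exact: (pF n).1|exact: (pF _).1].
  by move=> x; rewrite opB rdBl subr_ge0.
have DM n k y : rd ((F n - F (n + k)%N) y) y <= M * rn y ^+ 2.
  rewrite opB rdBl; apply: le_trans (FnM n y).
  by rewrite gerBl; exact: (pF _).2.
have [||T FT] := strong_limit (F := F) M0.
- by move=> n x; rewrite (le_trans (rn_op _ _))// ler_wpM2r ?rn_ge0//
    (psd_opnorm dot_norm M0 (pF n) (FnM n)).
- move=> x e e0.
  pose f n := rd (F n x) x.
  have hi : has_inf (range f).
    by split; [exists (f 0%N), 0%N|exists 0 => _ [n _ <-]; exact: (pF n).2].
  have M1 : 0 < M + 1 by rewrite ltr_wpDl.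
  pose d := e ^+ 2 / (M + 1).
  have d0 : 0 < d by rewrite divr_gt0// exprn_gt0.
  have [_ [N _ <-] hN] := inf_adherent d0 hi.
  have key n m : (N <= n)%N -> (n <= m)%N -> rn (F n x - F m x) < e.
    move=> Nn nm; rewrite -(@ltr_pXn2r _ 2)// ?nnegrE ?rn_ge0 ?ltW//.
    have := psd_norm dot_norm x (pD n (m - n)%N) (DM n (m - n)%N).
    rewrite subnKC// opB => h; apply: (le_lt_trans h).
    have h1 : f n <= f N by rewrite -(subnKC Nn); exact: dec.
    have h2 : inf (range f) <= f m by apply: ge_inf; [case: hi|exists m].
    have h3 : rd (F n x - F m x) x < d.
      rewrite rdBl -/(f n) -/(f m); move: (f N) (f n) (f m) h1 h2 hN => *; lra.
    have h4 : 0 <= rd (F n x - F m x) x.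
      by have := (pD n (m - n)%N).2 x; rewrite subnKC.
    apply: le_lt_trans (_ : (M + 1) * rd (F n x - F m x) x < _).
      by rewrite ler_wpM2r// lerDl.
    by rewrite mulrC -ltr_pdivlMr.
  exists N => n m Nn Nm; case: (leqP n m) => nm; first exact: key.
  by rewrite rnBC key// ltnW.
exists T => //; split.
  by apply: (cvs_adj dot_norm (F := F)) => // n; exact: (pF n).1.
move=> x; apply: (cvs_rd_ge dot_norm (FT x)) => n; exact: (pF n).2.
Qed.

Lemma psd_sandwich S T : adj T T -> psd S -> psd (T * S * T).
Proof.
move=> sT [sS pS]; split.
  by rewrite -[X in adj _ X]mulrA; apply: adjointM => //; exact: adjointM.
by move=> x; rewrite !opM sT.
Qed.

Lemma psdD S T : psd S -> psd T -> psd (S + T).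
Proof.
move=> [sS pS] [sT pT]; split; first exact: adjointD.
by move=> x; rewrite opD rdDl addr_ge0.
Qed.

Lemma psd_sq T : adj T T -> psd (T * T).
Proof.
by move=> sT; split=> [|x]; [exact: adjointM|rewrite opM sT rd_ge0].
Qed.

(** With [k] the half of [n], the product is [T ^+ k * S * T ^+ k] for even [n] and
    [T ^+ k * (T * S) * T ^+ k] for odd [n]. *)
Lemma psd_pow_mul T S n : psd T -> psd S -> psd (T * S) -> S * T = T * S ->
  psd (T ^+ n * S).
Proof.
move=> pT pS pTS TS.
have com k : T ^+ k * S = S * T ^+ k.
  elim: k => [|k IH]; first by rewrite expr0 mul1r mulr1.
  by rewrite exprS -mulrA IH mulrA -TS -mulrA.
have sTk k : adj (T ^+ k) (T ^+ k) by apply: adjointX; exact: pT.1.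
rewrite -(odd_double_half n) -addnn addnC exprD exprD.
case: (odd n); last first.
  by rewrite expr0 mulr1 -mulrA com mulrA; exact: psd_sandwich.
rewrite expr1 -!mulrA; have -> : T ^+ n./2 * (T ^+ n./2 * (T * S)) =
   T ^+ n./2 * (T * S) * T ^+ n./2.
  rewrite -[RHS]mulrA; congr (_ * _).
  by rewrite -[RHS]mulrA -com !mulrA -exprSr exprS.
exact: psd_sandwich.
Qed.

(** The operator [T], one minus a multiple of [S * S], lies between [0] and [1] and fixes exactly
    the kernel of [S]; its powers decrease to the projection on the fixed vectors. A strong limit of
    polynomials in [S] commutes with all that commutes with [S]. *)
Lemma kernel_projection S : adj S S -> exists P,
  [/\ adj P P, P * P = P, S * P = 0, forall x, S x = 0 -> P x = x &
   forall W, W * S = S * W -> W * P = P * W].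
Proof.
move=> sS; set c := rn S + 1.
have c0 : 0 < c by rewrite ltr_wpDl ?rn_ge0.
pose U := (c^-1 ^+ 2)%:C *: (S * S).
have pU : psd U.
  rewrite /U; split=> [|x]; first by apply: adjointZ; apply: adjointM.
  by rewrite opZ rdZl mulr_ge0 ?sqr_ge0//; exact: (psd_sq sS).2.
pose T := 1 - U.
have pT : psd T.
  split=> [|x]; first by apply: adjointB => //; exact: pU.1.
  rewrite /T /U opB op1 rdBl subr_ge0 opZ rdZl opM sS !rdxx// -exprMn.
  rewrite ler_pXn2r// ?nnegrE ?mulr_ge0 ?rn_ge0 ?invr_ge0 ?(ltW c0)//.
  rewrite mulrC ler_pdivrMr// (le_trans (rn_op _ _))// mulrC.
  by rewrite ler_wpM2l ?rn_ge0// /c lerDl.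
have U1T : 1 - T = U by rewrite /T opprB addrC subrK.
have TU : U * T = T * U by rewrite /T mulrBr mulrBl mulr1 mul1r.
(* [T + U = 1] and the two commute, so the product is a sum of two sandwiches. *)
have pTU : psd (T * U).
  have -> : T * U = T * U * T + U * T * U.
    rewrite -[T * U * T]mulrA TU -[T * U * U]mulrA -mulrDr -mulrDl.
    by rewrite {3}/T subrK mul1r.
  by apply: psdD; apply: psd_sandwich => //; [exact: pT.1|exact: pU.1].
have pF n : psd (T ^+ n).
  rewrite -[T ^+ n]mulr1; apply: psd_pow_mul => //.
  - exact: psd1.
  - by rewrite mulr1 mul1r.
have dF n : psd (T ^+ n - T ^+ n.+1).
  rewrite exprSr -{1}[T ^+ n]mulr1 -mulrBr U1T; exact: psd_pow_mul.
have [|P pP FP] := vigier (F := fun n => T ^+ n) ler01 pF dF.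
  by move=> x; rewrite expr0 mul1r op1 rdxx.
have TP x : T (P x) = P x.
  apply: (@cvs_unique _ _ (fun n => (T ^+ (n + 1)%N) x)).
    by under eq_fun do rewrite addn1 exprS opM; apply: cvs_op.
  exact: cvs_shift (FP x).
have fixP x : T x = x -> P x = x.
  move=> Tx; apply: (@cvs_unique _ _ (fun n => (T ^+ n) x)) => //.
  have -> : (fun n => (T ^+ n) x) = fun=> x; last exact: cvs_cst.
  apply/funext; elim=> [|n IH]; first by rewrite expr0.
  by rewrite exprSr opM Tx.
exists P; split.
- exact: pP.1.
- by apply: bounded_opP => x; rewrite opM fixP.
- apply: bounded_opP => x; rewrite opM op0.
  have := TP x; rewrite /T opB op1 => /eqP; rewrite -subr_eq0 addrAC subrr add0r.
  rewrite oppr_eq0 opZ scaler_eq0 => /orP[|/eqP SSP].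
    by rewrite -[0]/(0%:C) (inj_eq (@complexI _)) expf_eq0 invr_eq0/= gt_eqF.
  by apply: (rd_eq0 dot_norm); rewrite sS -opM SSP rd0r.
- move=> x Sx; apply: fixP.
  by rewrite /T opB op1 opZ opM Sx linear0 scaler0 subr0.
- move=> W WS; have WT : W * T = T * W.
    rewrite /T mulrBr mulrBl mulr1 mul1r /U opZr opZl.
    by rewrite mulrA WS -mulrA WS mulrA.
  have WTn n : W * T ^+ n = T ^+ n * W.
    elim: n => [|n IH]; first by rewrite expr0 mul1r mulr1.
    by rewrite exprSr mulrA IH -[LHS]mulrA WT mulrA.
  apply: bounded_opP => x; rewrite !opM.
  apply: (@cvs_unique _ _ (fun n => W ((T ^+ n) x))); first exact: cvs_op.
  by under eq_fun do rewrite -opM WTn opM; exact: FP.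
Qed.

(** The iteration [Y -> (C + Y * Y) / 2] started at [0] converges to [1] minus a square root of
    [1 - C]. The same iteration on scalars, with [1] in place of [C], stays in [[0, 1]] and is the
    majorant. *)
Lemma psd_sqrt C : psd C -> (forall x, rd (C x) x <= rn x ^+ 2) -> exists Y,
  [/\ adj Y Y, rn Y <= 1, (1 - Y) * (1 - Y) = 1 - C &
    forall W, W * C = C * W -> W * Y = Y * W].
Proof.
move=> pC C1.
pose Y := fix Y n := if n is n.+1 then (2^-1)%:C *: (C + Y n * Y n) else 0.
pose y := fix y n := if n is n.+1 then 2^-1 * (1 + y n ^+ 2) else 0 : R.
have YS n : Y n.+1 = (2^-1)%:C *: (C + Y n * Y n) by [].
have yS n : y n.+1 = 2^-1 * (1 + y n ^+ 2) by [].
have y01 n : 0 <= y n <= 1.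
  elim: n => [|n]; first by rewrite lexx ler01.
  rewrite yS; move: (y n) => t /andP[t0 t1]; apply/andP; split; nra.
have rC : rn C <= 1 by apply: psd_opnorm pC _ => // x; rewrite mul1r.
have half0 : (0 : R) <= 2^-1 by rewrite invr_ge0.
have Yy n : rn (Y n) <= y n.
  elim: n => [|n IH]; first by rewrite /= rn0.
  rewrite YS yS rnZr ger0_norm// ler_wpM2l//.
  apply: (le_trans (rnD _ _)); rewrite lerD// (le_trans (rn_opM _ _))//.
  by rewrite expr2 ler_pM// rn_ge0.
have sY n : adj (Y n) (Y n).
  elim: n => [|n IH]; first exact: adjoint0.
  by rewrite YS; apply: adjointZ; apply: adjointD; [exact: pC.1|exact: adjointM].
have YC n W : W * C = C * W -> W * Y n = Y n * W.
  move=> WC; elim: n => [|n IH]; first by rewrite /= mulr0 mul0r.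
  by rewrite YS opZr opZl mulrDr mulrDl WC mulrA IH -mulrA IH mulrA.
have YY n m : Y n * Y m = Y m * Y n by apply: (YC m); rewrite -(YC n).
have dY n : rn (Y n.+1 - Y n) <= y n.+1 - y n.
  elim: n => [|n IH].
    rewrite YS yS /= mulr0 addr0 !subr0 expr0n addr0 mulr1 rnZr ger0_norm//.
    by rewrite -[leRHS]mulr1 ler_wpM2l.
  have -> : Y n.+2 - Y n.+1 =
     (2^-1)%:C *: ((Y n.+1 - Y n) * (Y n.+1 + Y n)).
    rewrite (YS n.+1) [X in _ - X]YS -scalerBr; congr (_ *: _).
    rewrite mulrDr !mulrBl (YY n n.+1) opprD addrACA subrr add0r.
    by rewrite addrA subrK.
  have -> : y n.+2 - y n.+1 = 2^-1 * ((y n.+1 - y n) * (y n.+1 + y n)).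
    by rewrite (yS n.+1) [X in _ - X]yS; ring.
  rewrite rnZr ger0_norm// ler_wpM2l// (le_trans (rn_opM _ _))//.
  rewrite ler_pM ?rn_ge0//; apply: (le_trans (rnD _ _)); exact: lerD.
have y1 n : y n <= 1 by have /andP[] := y01 n.
have [Z YZ] := norm_limit y1 dY.
have YZx x := cvs_opP x YZ.
have Y1 n x : rn (Y n x) <= 1 * rn x.
  by rewrite (le_trans (rn_op _ _))// ler_wpM2r ?rn_ge0// (le_trans (Yy n)).
exists Z; split.
- exact: (cvs_adj dot_norm sY).
- by apply: cvs_le YZ _ => n; exact: le_trans (Yy n) (y1 n).
- have h : Z + Z = C + Z * Z.
    apply: bounded_opP => x; rewrite !opD opM.
    apply: (@cvs_unique _ _ (fun n => Y (n + 1)%N x + Y (n + 1)%N x)).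
      by apply: cvsD; exact: (cvs_shift 1 (YZx x)).
    have -> : (fun n => Y (n + 1)%N x + Y (n + 1)%N x) =
       (fun n => C x + Y n (Y n x)).
      apply/funext => n; rewrite addn1 YS opZ -scalerDl -rmorphD/=.
      have -> : 2^-1 + 2^-1 = 1 :> R by lra.
      by rewrite scale1r.
    apply: cvsD; first exact: cvs_cst.
    exact: cvs_strong Y1 YZx (YZx x).
  rewrite mulrBr mulr1 mulrBl mul1r -[LHS]addrA -opprD [Z + (Z - _)]addrA h.
  by rewrite addrK.
- move=> W WC; apply: bounded_opP => x; rewrite !opM.
  apply: (@cvs_unique _ _ (fun n => W (Y n x))); first exact: cvs_op.
  by under eq_fun do rewrite -opM YC// opM; exact: YZx.
Qed.

(** Dividing [B * B] by the square of [c] brings it below [1], and [psd_sqrt] at [1 - U] then yields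
    the square root of [U]. *)
Lemma abs_exists B : adj B B -> exists S,
  [/\ psd S, S * S = B * B & forall W, W * B = B * W -> W * S = S * W].
Proof.
move=> sB; set c := rn B + 1.
have c0 : 0 < c by rewrite ltr_wpDl ?rn_ge0.
pose U := (c^-1 ^+ 2)%:C *: (B * B).
have sU : adj U U by rewrite /U; apply: adjointZ; apply: adjointM.
have U0 x : 0 <= rd (U x) x.
  by rewrite /U opZ rdZl mulr_ge0 ?sqr_ge0//; exact: (psd_sq sB).2.
have U1 x : rd (U x) x <= rn x ^+ 2.
  rewrite /U opZ rdZl opM sB !rdxx// -exprMn.
  rewrite ler_pXn2r// ?nnegrE ?mulr_ge0 ?rn_ge0 ?invr_ge0 ?(ltW c0)//.
  rewrite mulrC ler_pdivrMr// (le_trans (rn_op _ _))// mulrC.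
  by rewrite ler_wpM2l ?rn_ge0// /c lerDl.
have [||Y [sY Y1 YY YW]] := @psd_sqrt (1 - U).
- split=> [|x]; first exact: adjointB.
  by rewrite opB op1 rdBl rdxx// subr_ge0.
- by move=> x; rewrite opB op1 rdBl rdxx// gerBl.
exists (c%:C *: (1 - Y)); split.
- split=> [|x]; first by apply: adjointZ; apply: adjointB.
  rewrite opZ rdZl opB op1 rdBl rdxx// mulr_ge0 ?(ltW c0)// subr_ge0.
  by apply: (le_trans (rd_op_le dot_norm _ _)); rewrite ler_piMl// sqr_ge0.
- rewrite opZl opZr scalerA -rmorphM/= YY subKr /U scalerA -rmorphM/=.
  by rewrite -expr2 -exprMn divff ?gt_eqF// expr1n scale1r.
- move=> W WB; rewrite opZr opZl mulrBr mulrBl mulr1 mul1r YW//.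
  rewrite mulrBr mulrBl mulr1 mul1r /U opZr opZl.
  by rewrite mulrA WB -mulrA WB mulrA.
Qed.

(** [P] projects on the kernel of [|B| + B], where [B = - |B|]. That kernel contains the kernel of
    [B], on which the right continuity of the spectral family will rest. *)
Lemma spectral_projection B : adj B B -> exists P,
  [/\ adj P P, P * P = P, forall W, W * B = B * W -> W * P = P * W &
   [/\ forall x, rd (B (P x)) (P x) <= 0,
      forall x, P x = 0 -> 0 <= rd (B x) x &
      forall x, B x = 0 -> P x = x]].
Proof.
move=> sB; have [S [pS SS SW]] := abs_exists sB.
have BS : B * S = S * B by exact: SW.
have [|P [sP PP SBP kP PW]] := @kernel_projection (S + B).
  by apply: adjointD => //; exact: pS.1.
exists P; split => //.
  by move=> W WB; apply: PW; rewrite mulrDr mulrDl WB SW.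
have BP : B * P = P * B by apply: PW; rewrite mulrDr mulrDl BS.
have SP : S * P = P * S by apply: PW; rewrite mulrDr mulrDl BS.
split.
- move=> x; have : B (P x) = - S (P x).
    by apply/eqP; rewrite -addr_eq0 addrC -opD -opM SBP op0.
  by move=> ->; rewrite rdNl oppr_le0; exact: pS.2.
- move=> x Px; suff -> : B x = S x by exact: pS.2.
  (* [(S + B) * (S - B) = 0], since [S] and [B] commute and have equal squares; so [P] fixes the
     range of [S - B]. *)
  have h : P ((S - B) x) = (S - B) x.
    apply: kP; rewrite -opM mulrBr !mulrDl SS BS [X in _ - X]addrC subrr.
    exact: op0.
  move: h; rewrite -opM mulrBr -SP -BP -mulrBl opM Px linear0 opB => /eqP.
  by rewrite eq_sym subr_eq0 => /eqP ->.
- move=> x Bx; apply: kP; rewrite opD Bx addr0.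
  apply: (rd_eq0 dot_norm); rewrite pS.1 -opM SS opM Bx linear0.
  by rewrite rd0r.
Qed.

End SpectralProjection.

(** * The spectral theorem *)

Section Stieltjes.
Context {R : realType}.
Implicit Types (f g h F : R -> R) (a b : R).

Lemma archi_small (C e : R) : 0 < e -> exists n : nat, C / n.+1%:R < e.
Proof.
move=> e0; exists (Num.bound `|C / e|); rewrite ltr_pdivrMr// mulrC -ltr_pdivrMr//.
apply: (le_lt_trans (ler_norm _)); apply: (lt_le_trans (archi_boundP _)) => //.
by rewrite ler_nat.
Qed.

(* [g] is Lipschitz with respect to [F] with a constant that tends to 0 under
   subdivision. *)
Lemma const_of_small_increments g F a0 b : a0 <= b ->
  (forall a c, a0 <= a -> a <= c -> `|g c - g a| <= (c - a) * (F c - F a)) ->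
  g b = g a0.
Proof.
move=> ab gF; apply/eqP; rewrite -subr_eq0 -normr_eq0 eq_le normr_ge0 andbT.
have key n : `|g b - g a0| <= (b - a0) * (F b - F a0) / n.+1%:R.
  pose d := (b - a0) / n.+1%:R.
  have d0 : 0 <= d by rewrite divr_ge0// subr_ge0.
  pose t k := a0 + k%:R * d.
  have tS k : t k.+1 = t k + d by rewrite /t -natr1; ring.
  have ta k : a0 <= t k by rewrite /t lerDl mulr_ge0.
  have h k : `|g (t k) - g a0| <= d * (F (t k) - F a0).
    elim: k => [|k IH]; first by rewrite /t mul0r addr0 !subrr normr0 mulr0.
    apply: (le_trans (ler_distD (g (t k)) _ _)).
    have := gF (t k) (t k.+1) (ta k); rewrite tS lerDl d0 => /(_ isT).
    rewrite (_ : t k + d - t k = d); last by rewrite addrAC subrr add0r.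
    move=> h1; apply: (le_trans (lerD h1 IH)).
    by rewrite -mulrDr addrA subrK.
  have := h n.+1; have -> : t n.+1 = b.
    by rewrite /t /d mulrC divfK ?pnatr_eq0// addrC subrK.
  by rewrite /d mulrAC.
apply: le0_eps => e /(archi_small ((b - a0) * (F b - F a0)))[n /ltW].
exact: le_trans (key n).
Qed.

Lemma stieltjes_measure f a0 b0 c : a0 <= b0 -> {homo f : x y / x <= y} ->
  (forall x e, 0 < e -> exists2 d, 0 < d & f (x + d) <= f x + e) ->
  (forall x, x <= a0 -> f x = 0) -> (forall x, b0 <= x -> f x = c) ->
  exists mu : {measure set (measurableTypeR R) -> \bar R},
    (forall a b, a <= b -> mu `]a, b]%classic = (f b - f a)%:E) /\ mu setT = c%:E.
Proof.
move=> ab0 fnd frc fa fb.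
have frc' : right_continuous f.
  move=> x; apply/cvgrPdist_le => e /(frc x)[d d0 fd].
  have xd : x < x + d by rewrite ltrDl.
  near=> y.
  have xy : x <= y by apply: ltW; near: y; exact: nbhs_right_gt.
  have yd : y <= x + d by near: y; exact: nbhs_right_ltW.
  rewrite distrC ger0_norm ?subr_ge0 ?fnd// lerBlDl.
  exact: le_trans (fnd _ _ yd) fd.
pose C : cumulative R R := HB.pack f (isCumulative.Build R _ R f fnd frc').
pose mu : {measure set (measurableTypeR R) -> \bar R} := lebesgue_stieltjes_measure C.
have muE a b : a <= b -> mu `]a, b]%classic = (f b - f a)%:E.
  move=> ab; rewrite /mu /= /lebesgue_stieltjes_measure /measure_extension.
  rewrite measurable_mu_extE/=; last exact: is_ocitv.
  by rewrite wlength_itv_bnd.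
exists mu; split => //.
(* The total mass is the limit over these intervals, each of which already has mass [c]. *)
pose D (n : nat) : set (measurableTypeR R) := `]a0 - n%:R, b0 + n%:R]%classic.
have DT : \bigcup_n D n = setT.
  rewrite -subTset => x _ /=.
  pose m := `|x - a0| + `|x - b0| + 1.
  have m0 : 0 <= m by rewrite !addr_ge0.
  exists (Num.bound m) => //.
  rewrite /D /= in_itv/=; move: (archi_boundP m0); rewrite /m.
  move: (_%:R) => t.
  have := ler_norm (x - b0); have := ler_norm (a0 - x); rewrite distrC.
  have := normr_ge0 (x - a0); have := normr_ge0 (x - b0).
  move: `|x - a0| `|x - b0| => u v *.
  apply/andP; split; lra.
have mD n : measurable (D n).
  by apply: sub_sigma_algebra; exact: is_ocitv.
have h : mu \o D @ \oo --> mu (\bigcup_n D n).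
  apply: nondecreasing_cvg_mu => //; first by rewrite DT.
  move=> n m nm; apply/subsetPset => x; rewrite /D /= !in_itv/= => /andP[h1 h2].
  have nm' : n%:R <= m%:R :> R by rewrite ler_nat.
  by apply/andP; split; lra.
have muD : mu \o D = cst c%:E.
  apply/funext => n /=; rewrite /D muE; last first.
    by have := ler0n R n; lra.
  by rewrite (fa (a0 - n%:R)) ?(fb (b0 + n%:R)) ?subr0 ?gerBl ?lerDl.
rewrite -DT; apply: (cvg_unique _ h); first exact: ereal_hausdorff.
by rewrite muD; exact: cvg_cst.
Unshelve. all: by end_near. Qed.

(** [h] and the indefinite integral [G] of the identity obey the same bounds on increments, so
    [G - h] moves by at most [(b - a) * (f b - f a)] and is constant. *)
Lemma stieltjes_integral (mu : {measure set (measurableTypeR R) -> \bar R})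
    f h a0 b0 c : a0 <= b0 -> f a0 = 0 -> f b0 = c ->
  (forall a b, a <= b -> mu `]a, b]%classic = (f b - f a)%:E) -> mu setT = c%:E ->
  (forall a b, a0 <= a -> a <= b ->
    a * (f b - f a) <= h b - h a <= b * (f b - f a)) ->
  mu.-integrable setT (fun t : R => t%:E) /\
  (\int[mu]_t (t : R)%:E)%E = (h b0 - h a0)%:E.
Proof.
move=> ab0 fa fb muE muT hf.
pose J a b : set (measurableTypeR R) := `]a, b]%classic.
have mJ a b : measurable (J a b) by apply: sub_sigma_algebra; exact: is_ocitv.
have muJ a b : a <= b -> mu (J a b) = (f b - f a)%:E by exact: muE.
pose N := ~` J a0 b0.
have mN : measurable N by exact: measurableC.
have muN : mu N = 0%E.
  have : mu setT = (mu N + mu (J a0 b0))%E.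
    by have := measureDI mu (@measurableT _ _) (mJ a0 b0); rewrite setTI setTD.
  rewrite muJ// muT fa fb subr0 => /esym.
  case: (mu N) => [r| |] //= /eqP; rewrite -EFinD eqe => /eqP rc.
  by congr (_%:E); lra.
have mid (D : set (measurableTypeR R)) : 
    measurable_fun D ((fun t => t) : measurableTypeR R -> R).
  by move=> mD B mB; apply: measurableI.
have midE (D : set (measurableTypeR R)) : measurable_fun D (fun t : R => t%:E).
  by apply/measurable_EFinP; exact: mid.
have idJ a b : a <= b -> mu.-integrable (J a b) (EFin \o (fun t : R => t)).
  move=> ab; apply: measurable_bounded_integrable => //.
    by rewrite muJ// ltry.
  exists (`|a| + `|b|); split; first by rewrite num_real.
  move=> M Mab x; rewrite /J /= in_itv/= => /andP[ax xb].
  apply: (le_trans _ (ltW Mab)); rewrite ler_norml.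
  have := ler_norm b; have := ler_norm (- a); rewrite normrN.
  have := normr_ge0 a; have := normr_ge0 b.
  by move: `|a| `|b| => u v *; apply/andP; split; lra.
pose G b := Rintegral mu (J a0 b) (fun t : R => t).
have Ginc a b : a0 <= a -> a <= b -> G b - G a = Rintegral mu (J a b) (fun t => t).
  move=> a0a ab; have a0b := le_trans a0a ab.
  have JU : J a0 b = J a0 a `|` J a b.
    apply/seteqP; split => x; rewrite /J /= !in_itv/=.
      move=> /andP[h1 h2]; case: (leP x a) => xa; [left|right]; exact/andP.
    by case=> /andP[h1 h2]; apply/andP; split; lra.
  rewrite /G JU Rintegral_setU//.
  - by rewrite addrAC subrr add0r.
  - by rewrite -JU; exact: idJ.
  apply/disj_setPS => x [] /=; rewrite /J /= !in_itv/= => /andP[_ xa] /andP[ax _].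
  by move: ax; rewrite ltNge xa.
have Gb a b : a0 <= a -> a <= b ->
    a * (f b - f a) <= G b - G a <= b * (f b - f a).
  move=> a0a ab; rewrite Ginc//.
  have cJ (r : R) : mu.-integrable (J a b) (EFin \o (fun=> r)).
    apply: measurable_bounded_integrable => //.
    - by rewrite muJ// ltry.
    - by exists `|r|; split; [rewrite num_real|move=> M /ltW rM y _].
  have cE r : r * (f b - f a) = Rintegral mu (J a b) (fun=> r).
    by rewrite Rintegral_cst// muJ.
  rewrite !cE; apply/andP; split; apply: le_Rintegral => //; try exact: idJ.
  - by move=> x; rewrite /J /= in_itv/= => /andP[/ltW].
  - by move=> x; rewrite /J /= in_itv/= => /andP[].
have GE : G b0 - h b0 = G a0 - h a0.
  apply: (@const_of_small_increments (fun b => G b - h b) f) => // a b a0a ab.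
  have /andP[h1 h2] := Gb _ _ a0a ab; have /andP[h3 h4] := hf _ _ a0a ab.
  rewrite ler_norml mulrBl.
  move: (G a) (G b) (h a) (h b) (a * _) (b * _) h1 h2 h3 h4 => *.
  by apply/andP; split; lra.
have Ga : G a0 = 0.
  by rewrite /G (_ : J a0 a0 = set0) ?Rintegral_set0// /J set_itvoc0.
have NC : setT `\` N = J a0 b0 by rewrite setTD setCK.
have iT : mu.-integrable setT (fun t : R => t%:E).
  apply/(negligible_integrable mN) => //; rewrite NC; exact: idJ.
split => //; rewrite (negligible_integral mN)// NC.
have iJ := idJ _ _ ab0.
rewrite -[LHS]fineK.
  by congr (_%:E); rewrite -[LHS]/(G b0); lra.
exact: integrable_fin_num.
Qed.

End Stieltjes.

Section SpectralTheorem.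
Context {R : realType} {H : completeNormedModType R[i]}.
Variable dot : {dot H for (@Num.conj R[i])}.
Hypothesis dot_norm : forall x : H, dot x x = `|x| ^+ 2.
Implicit Types (x y z : H) (P Q S T W A : bounded_op H) (l m : R).
Local Notation rd := (re_dot dot).
Local Notation adj := (adj dot).
Local Notation psd := (psd dot).

Definition scal (r : R) : bounded_op H := r%:C *: (1 : bounded_op H).

Lemma scalE r x : scal r x = r%:C *: x. Proof. by []. Qed.

Lemma scalC W r : W * scal r = scal r * W.
Proof. by rewrite /scal opZr opZl mulr1 mul1r. Qed.

Lemma adj_scal r : adj (scal r) (scal r).
Proof. exact/adjointZ. Qed.

Definition isproj P := adj P P /\ P * P = P.

Lemma proj_rd P x : isproj P -> rd (P x) x = rn (P x) ^+ 2.
Proof. by move=> [sP PP]; rewrite -(rdxx dot_norm) [RHS]sP -opM PP sP. Qed.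

Lemma proj_psd P : isproj P -> psd P.
Proof. by move=> pP; split=> [|x]; [exact: pP.1|rewrite proj_rd// sqr_ge0]. Qed.

Lemma proj_compl P : isproj P -> isproj (1 - P).
Proof.
move=> [sP PP]; split; first exact: adjointB.
by rewrite mulrBr mulr1 mulrBl mul1r PP subrr subr0.
Qed.

(** At [Q x] the inequality leaves no room for [rn (P (Q x)) ^+ 2]. *)
Lemma proj_orth P Q : isproj P -> isproj Q ->
  (forall x, rd (P x) x + rd (Q x) x <= rn x ^+ 2) -> P * Q = 0.
Proof.
move=> pP pQ PQ; apply: bounded_opP => x; rewrite opM op0; apply: rn_eq0.
have := PQ (Q x); rewrite (proj_rd _ pP) (proj_rd _ pQ) -[Q (Q x)]opM pQ.2.
rewrite gerDr => h; apply/eqP; rewrite -sqrf_eq0 eq_le sqr_ge0 andbT.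
exact: h.
Qed.

Lemma proj_orth_sym P Q : adj P P -> adj Q Q -> P * Q = 0 -> Q * P = 0.
Proof.
move=> sP sQ PQ; apply: bounded_opP => x; apply: (vec_eq dot_norm) => y.
by rewrite opM sQ sP -opM PQ !op0 rd0l rd0r.
Qed.

Lemma projD P Q : isproj P -> isproj Q -> P * Q = 0 -> isproj (P + Q).
Proof.
move=> pP pQ PQ; split; first by apply: adjointD; [exact: pP.1|exact: pQ.1].
rewrite mulrDr !mulrDl PQ (proj_orth_sym pP.1 pQ.1 PQ) addr0 add0r.
by rewrite pP.2 pQ.2.
Qed.

Lemma projB P Q : isproj P -> isproj Q -> P * Q = Q -> isproj (P - Q).
Proof.
move=> pP pQ PQ.
have QP : Q * P = Q.
  apply: bounded_opP => x; apply: (vec_eq dot_norm) => y.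
  by rewrite opM pQ.1 pP.1 -opM PQ pQ.1.
split; first by apply: adjointB; [exact: pP.1|exact: pQ.1].
by rewrite mulrBr !mulrBl PQ QP pP.2 pQ.2 subrr subr0.
Qed.

Lemma cvs_rd_cvg (u : nat -> H) z y : cvs u z ->
  (fun n => rd (u n) y) @ \oo --> rd z y.
Proof.
move=> uz; apply/cvgrPdist_lt => e e0.
have k1 : 0 < rn y + 1 by rewrite ltr_wpDl ?rn_ge0.
have [|N hN] := uz (e / (rn y + 1)); first by rewrite divr_gt0.
exists N => // n /hN; rewrite ltr_pdivlMr// => h /=.
rewrite -rdBl; apply: le_lt_trans (CS dot_norm _ _) _; rewrite rnBC.
by apply: le_lt_trans h; rewrite ler_wpM2l ?rn_ge0// lerDl.
Qed.

(** [E l] stands for the spectral projection of []-oo, l]]. Right continuity is asked of the scalar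
    functions, which are the ones that generate Stieltjes measures. *)
Definition spectral_family A (E : R -> bounded_op H) :=
  [/\ forall l, isproj (E l), forall l, A * E l = E l * A,
    forall l m, l <= m -> E m * E l = E l,
    forall l x, rd (A (E l x)) (E l x) <= l * rn (E l x) ^+ 2 &
    (forall l x, E l x = 0 -> l * rn x ^+ 2 <= rd (A x) x) /\
    (forall l x e, 0 < e -> exists2 d, 0 < d &
       rd (E (l + d) x) x <= rd (E l x) x + e)].

Lemma spectral_family_exists A : adj A A -> exists E, spectral_family A E.
Proof.
move=> sA.
have /choice[E EP] l : exists P, [/\ isproj P,
    forall W, W * A = A * W -> W * P = P * W,
    forall x, rd (A (P x)) (P x) <= l * rn (P x) ^+ 2,
    forall x, P x = 0 -> l * rn x ^+ 2 <= rd (A x) x &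
    forall x, A x = l%:C *: x -> P x = x].
  have [|P [sP PP PW [P1 P2 P3]]] := @spectral_projection _ _ dot dot_norm (A - scal l).
    by apply: adjointB => //; apply: adj_scal.
  exists P; split => //.
  - move=> W WA; apply: PW.
    by rewrite mulrBr mulrBl WA scalC.
  - move=> x; have := P1 x; rewrite opB scalE rdBl rdZl rdxx//.
    by rewrite subr_le0.
  - move=> x Px; have := P2 x Px; rewrite opB scalE rdBl rdZl rdxx//.
    by rewrite subr_ge0.
  - by move=> x Ax; apply: P3; rewrite opB scalE Ax subrr.
have pE l : isproj (E l) by have [] := EP l.
have AE l : A * E l = E l * A by have [_ h _ _ _] := EP l; rewrite h.
have EE l m : E l * E m = E m * E l.
  by have [_ h _ _ _] := EP m; rewrite h// AE.
have Elt l x : rd (A (E l x)) (E l x) <= l * rn (E l x) ^+ 2.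
  by have [] := EP l.
have Egt l x : E l x = 0 -> l * rn x ^+ 2 <= rd (A x) x.
  by have [_ _ _ h _] := EP l; exact: h.
have Ekey l m x : l < m -> E l x = x -> E m x = 0 -> x = 0.
  move=> lm Elx Emx; have := Elt l x; rewrite Elx => /(le_trans (Egt _ _ Emx)).
  rewrite -subr_le0 -mulrBl pmulr_rle0 ?subr_gt0// => h; apply: rn_eq0.
  by apply/eqP; rewrite -sqrf_eq0 eq_le sqr_ge0 andbT.
have Emono l m : l <= m -> E m * E l = E l.
  rewrite le_eqVlt => /predU1P[->|lm]; first exact: (pE m).2.
  apply: bounded_opP => x; apply/eqP; rewrite eq_sym -subr_eq0; apply/eqP.
  apply: (Ekey _ _ _ lm); rewrite opxB.
    rewrite -[E l (E l x)]opM (pE l).2 -[E l ((E m * E l) x)]opM mulrA EE -mulrA.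
    by rewrite (pE l).2.
  by rewrite -[E m (E l x)]opM -[E m ((E m * E l) x)]opM mulrA (pE m).2 subrr.
exists E; split => //; split => // l x e e0.
(* The projections [E (u n)] decrease strongly to some [T]. A difference [z = T y - E l (T y)] is
   killed by [E l] and has form exactly [l * rn z ^+ 2]; it is then an eigenvector for [l], which
   [E l] fixes, so [z = 0]. *)
pose u n := l + n.+1%:R^-1.
have u_gt n : l < u n by rewrite ltrDl invr_gt0.
have uS n : u n.+1 <= u n by rewrite lerD2l lef_pV2 ?posrE// ler_nat.
have [||||T pT FT] := @vigier _ _ dot dot_norm (fun n => E (u n)) 1.
- exact: ler01.
- by move=> n; exact: proj_psd.
- by move=> n; apply/proj_psd/projB => //; exact: Emono.
- move=> y; rewrite mul1r proj_rd//.
  have := (proj_psd (proj_compl (pE (u 0%N)))).2 y.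
  by rewrite opB op1 rdBl rdxx// subr_ge0 proj_rd.
have usmall m : l < m -> exists n, u n <= m.
  move=> lm; have [|n hn] := @archi_small R 1 (m - l).
    by rewrite subr_gt0.
  by exists n; rewrite /u -lerBrDl -div1r ltW.
have ET m y : l < m -> E m (T y) = T y.
  move=> /usmall[k uk].
  apply: (@cvs_unique _ _ (fun n => E m (E (u (n + k)%N) y))).
    exact/cvs_op/(cvs_shift k (FT y)).
  have um n : u (n + k)%N <= m.
    by apply: le_trans uk; rewrite lerD2l lef_pV2 ?posrE// ler_nat ltnS leq_addl.
  by under eq_fun do rewrite -opM Emono//; exact: (cvs_shift k (FT y)).
have lT y : E l (T y) = T y.
  apply/eqP; rewrite eq_sym -subr_eq0; apply/eqP; set z := T y - _.
  have Elz : E l z = 0 by rewrite opxB -opM (pE l).2 subrr.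
  have Emz m : l < m -> E m z = z.
    move=> lm; rewrite opxB ET// -opM EE opM ET//.
  have Az : rd (A z) z <= l * rn z ^+ 2.
    apply: le_eps => d d0; have k1 : 0 < rn z ^+ 2 + 1.
      by rewrite ltr_wpDl ?sqr_ge0.
    have lm : l < l + d / (rn z ^+ 2 + 1) by rewrite ltrDl divr_gt0.
    have := Elt (l + d / (rn z ^+ 2 + 1)) z; rewrite Emz// => /le_trans; apply.
    rewrite mulrDl lerD2l mulrAC ler_pdivrMr// ler_wpM2l ?ltW//.
    by rewrite ltrDl.
  have Az' : rd (A z) z = l * rn z ^+ 2.
    by apply/eqP; rewrite eq_le Az Egt.
  (* [A - l] is known to be positive on the kernel of [E l]; the factor [1 - E l] makes it positive
     everywhere, so that a zero of its form is a zero of the operator. *)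
  pose B := (A - scal l) * (1 - E l).
  have commB : (A - scal l) * (1 - E l) = (1 - E l) * (A - scal l).
    by rewrite !mulrBr !mulrBl !mulr1 !mul1r AE scalC !opprD !opprK addrACA.
  have pB : psd B.
    have s1 : adj (1 - E l) (1 - E l) by apply: adjointB => //; exact: (pE l).1.
    have s2 : adj (A - scal l) (A - scal l).
      by apply: adjointB => //; apply: adj_scal.
    split=> [|w]; first by rewrite {2}/B commB; apply: adjointM.
    rewrite /B commB -[1 - E l](proj_compl (pE l)).2 -mulrA -commB opM s1 opM.
    rewrite opB scalE rdBl rdZl rdxx// subr_ge0; apply: Egt.
    by rewrite -opM mulrBr mulr1 (pE l).2 subrr op0.
  have Bz : B z = A z - l%:C *: z.
    rewrite /B opM (_ : (1 - E l) z = z) ?opB ?scalE//.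
    by rewrite op1 Elz subr0.
  have : B z = 0.
    by apply: (psd_ker dot_norm pB); rewrite Bz rdBl rdZl rdxx// Az' subrr.
  rewrite Bz => /eqP; rewrite subr_eq0 => /eqP Azl.
  have [_ _ _ _ /(_ _ Azl)] := EP l; rewrite Elz => <-//.
have Tl y : T y = E l y.
  rewrite -[LHS]lT; apply: (@cvs_unique _ _ (fun n => E l (E (u n) y))).
    exact/cvs_op/FT.
  under eq_fun do rewrite -opM EE Emono ?ltW//; exact: cvs_cst.
have k1 : 0 < rn x + 1 by rewrite ltr_wpDl ?rn_ge0.
have [|N /(_ _ (leqnn N))] := FT x (e / (rn x + 1)); first by rewrite divr_gt0.
rewrite ltr_pdivlMr// => h; exists (N.+1%:R^-1); first by rewrite invr_gt0.
rewrite -lerBlDl -rdBl -Tl; apply: (le_trans (CSle dot_norm _ _)).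
by apply: le_trans (ltW h); rewrite ler_wpM2l ?rn_ge0// lerDl.
Qed.

End SpectralTheorem.

(** * From a spectral family to a spectral measure *)

Section SpectralMeasure.
Context {R : realType} {H : completeNormedModType R[i]}.
Variable dot : {dot H for (@Num.conj R[i])}.
Hypothesis dot_norm : forall x : H, dot x x = `|x| ^+ 2.
Implicit Types (x y z : H) (P Q S T W A : bounded_op H) (l m : R).
Local Notation rd := (re_dot dot).
Local Notation adj := (adj dot).
Local Notation psd := (psd dot).
Local Notation isproj := (isproj dot).
Local Notation mT := (measurableTypeR R).

Lemma family_stieltjes A E x : adj A A -> spectral_family dot A E ->
  exists mu : {measure set mT -> \bar R},
  [/\ forall a b : R, a <= b -> mu `]a, b]%classic = (rd ((E b - E a) x) x)%:E,
      mu setT = (rn x ^+ 2)%:E,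
      mu.-integrable setT (fun t : R => t%:E) &
      (\int[mu]_t (t : R)%:E)%E = (rd (A x) x)%:E].
Proof.
move=> sA [pE AE Emono Elt [Egt Erc]].
(* One more than the norm, so that [E] vanishes up to [a0] and is the identity from [b0] on. *)
pose b0 := rn A + 1; pose a0 := - b0; pose f l := rd (E l x) x.
have b00 : 0 < b0 by rewrite ltr_wpDl ?rn_ge0.
have ab : a0 <= b0 by rewrite /a0; lra.
have Aabs y : `|rd (A y) y| <= rn A * rn y ^+ 2 by exact: rd_op_abs.
have E0 l : l <= a0 -> E l x = 0.
  move=> la; apply: rn_eq0; apply/eqP; rewrite -sqrf_eq0; set s := rn _ ^+ 2.
  have s0 : 0 <= s by exact: sqr_ge0.
  have := Elt l x; have := Aabs (E l x); rewrite ler_norml => /andP[+ _].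
  rewrite /a0 /b0 in la; rewrite -/s.
  move: (rd _ _) (rn A) la => u v la h1 h2.
  rewrite eq_le s0 andbT; have := ler_wpM2r s0 la.
  by clearbody s; nra.
have E1 l : b0 <= l -> E l x = x.
  move=> bl; apply/eqP; rewrite eq_sym -subr_eq0 -normr_eq0 rnE.
  set y := x - E l x.
  have Ely : E l y = 0 by rewrite opxB -opM (pE l).2 subrr.
  have := Egt l y Ely; have := Aabs y; rewrite ler_norml => /andP[_ +].
  rewrite /b0 in bl; move: (rd _ _) (rn A) bl => u v bl h1 h2.
  have s0 : 0 <= rn y ^+ 2 by exact: sqr_ge0.
  suff : rn y ^+ 2 = 0 by move/eqP; rewrite sqrf_eq0 => /eqP ->.
  apply/eqP; rewrite eq_le s0 andbT; have := ler_wpM2r s0 bl.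
  by move: (rn y ^+ 2) h1 h2 => s; nra.
have psdB l m : l <= m -> isproj (E m - E l) by move=> lm; apply: projB => //; exact: Emono.
have fE l m : f m - f l = rd ((E m - E l) x) x by rewrite opB rdBl.
have fnd : {homo f : l m / l <= m}.
  move=> l m lm; rewrite -subr_ge0 fE.
  exact: (proj_psd dot_norm (psdB _ _ lm)).2.
have f0 l : l <= a0 -> f l = 0 by move=> /E0; rewrite /f => ->; rewrite rd0l.
have f1 l : b0 <= l -> f l = rn x ^+ 2.
  by move=> /E1; rewrite /f => ->; rewrite rdxx.
have [mu [muE muT]] := stieltjes_measure ab fnd (fun l e => Erc l x e) f0 f1.
exists mu.
pose h l := rd (A (E l x)) x.
have hf a b : a0 <= a -> a <= b ->
    a * (f b - f a) <= h b - h a <= b * (f b - f a).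
  move=> _ ab'; have pD := psdB _ _ ab'; set D := E b - E a in pD *.
  have AD : A * D = D * A by rewrite mulrBr mulrBl !AE.
  have hE : h b - h a = rd (A (D x)) (D x).
    by rewrite -[in RHS]pD.1 -!opM -AD -mulrA pD.2 mulrBr opB rdBl.
  have EbD : E b (D x) = D x.
    by rewrite -opM mulrBr (pE b).2 Emono.
  have EaD : E a (D x) = 0.
    have EE : E a * E b = E a.
      apply: bounded_opP => y; apply: (vec_eq dot_norm) => z.
      by rewrite opM (pE a).1 (pE b).1 -opM Emono// -(pE a).1.
    by rewrite -opM mulrBr (pE a).2 EE subrr.
  rewrite fE hE (proj_rd dot_norm _ pD); apply/andP; split; first exact: Egt.
  by have := Elt b (D x); rewrite EbD.
have [iT intT] := stieltjes_integral ab (f0 _ (lexx _)) (f1 _ (lexx _)) muE muT hf.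
split => //; first by move=> a b ab'; rewrite muE// fE.
by rewrite intT /h (E0 a0)// (E1 b0)// linear0 rd0l subr0.
Qed.

(** The sets [B] with this property form a Dynkin system containing the half-open intervals.
    Disjoint sets give orthogonal projections, as their forms add up to at most the total mass
    [rn x ^+ 2]; so a countable disjoint union becomes an increasing limit of projections. *)
Lemma family_projections A E (mu : H -> {measure set mT -> \bar R}) :
  spectral_family dot A E ->
  (forall x (a b : R), a <= b -> mu x `]a, b]%classic = (rd ((E b - E a) x) x)%:E) ->
  (forall x, mu x setT = (rn x ^+ 2)%:E) ->
  forall B : set mT, measurable B ->
  exists P, isproj P /\ forall x, mu x B = (rd (P x) x)%:E.
Proof.
move=> [pE AE Emono _ _] muE muT.
have orth (B C : set mT) P Q : measurable B -> measurable C -> B `&` C = set0 ->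
    isproj P -> isproj Q -> (forall x, mu x B = (rd (P x) x)%:E) ->
    (forall x, mu x C = (rd (Q x) x)%:E) -> P * Q = 0.
  move=> mB mC BC pP pQ PB QC; apply: (proj_orth dot_norm) => // x.
  rewrite -lee_fin EFinD -PB -QC -measureU// -muT le_measure ?inE//.
  exact: measurableU.
apply: (@dynkin_induction _ mT (@ocitv R)) => //.
- exact: ocitvI.
- exists 1; split=> [|x]; first by split; [|rewrite mulr1].
  by rewrite muT op1 rdxx.
- move=> B /ocitvP[->|[[a b] /= /ltW ab ->]].
    exists 0; split=> [|x]; last by rewrite measure0 op0 rd0l.
    by split; [exact: adjoint0|rewrite mulr0].
  exists (E b - E a); split=> [|x]; last by rewrite muE.
  by apply: projB => //; exact: Emono.
- move=> B mB [P [pP PB]]; exists (1 - P); split=> [|x]; first exact: proj_compl.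
  have -> : (mu x (~` B) = mu x setT - mu x B)%E.
    rewrite -setTD measureD// ?setTI//.
    exact: (eq_ind_r (fun t => (t < +oo)%E) (ltry _) (muT x)).
  by rewrite muT PB -EFinB opB op1 rdBl rdxx.
move=> F mF tF /choice[P PF].
have pP n : isproj (P n) by have [] := PF n.
have PFE n x : mu x (F n) = (rd (P n x) x)%:E by have [_] := PF n.
have PP (n m : nat) : n != m -> P n * P m = 0.
  move=> nm; apply: (orth _ _ _ _ (mF n) (mF m)) => //.
  by move/trivIsetP : tF; apply.
pose S n := \sum_(i < n) P i.
have SS n : S n.+1 = S n + P n by rewrite /S big_ord_recr.
have SP (n m : nat) : (n <= m)%N -> S n * P m = 0.
  elim: n => [|n IH] nm; first by rewrite /S big_ord0 mul0r.
  by rewrite SS mulrDl IH 1?ltnW// PP ?addr0// neq_ltn nm.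
have pS n : isproj (S n).
  elim: n => [|n IH].
    by rewrite /S big_ord0; split; [exact: adjoint0|rewrite mulr0].
  by rewrite SS; apply: (projD dot_norm) => //; exact: SP.
have S1 n x : rd (S n x) x <= rn x ^+ 2.
  have := (proj_psd dot_norm (proj_compl (pS n))).2 x.
  by rewrite opB op1 rdBl rdxx// subr_ge0.
have [||||T pT FT] := @vigier _ _ dot dot_norm (fun n => 1 - S n) 1.
- exact: ler01.
- by move=> n; apply/(proj_psd dot_norm)/proj_compl.
- move=> n; rewrite SS (_ : _ - _ = P n); first exact: (proj_psd dot_norm).
  by rewrite opprB addrC -addrA [- 1 + _]addrA addNr add0r addrAC subrr add0r.
- move=> x; rewrite /S big_ord0 subr0 mul1r op1 rdxx//.
have ST x : cvs (fun n => S n x) ((1 - T) x).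
  have -> : (fun n => S n x) = (fun n => x - (1 - S n) x).
    by apply/funext => n; rewrite opB op1 subKr.
  by rewrite opB op1; apply: cvsD; [exact: cvs_cst|exact/cvsN/FT].
have SSn n k : S (n + k)%N * S n = S n.
  elim: k => [|k IH]; first by rewrite addn0 (pS n).2.
  rewrite addnS SS mulrDl IH -[X in _ + X](_ : 0 = _) ?addr0//.
  apply/esym/(proj_orth_sym dot_norm (pS n).1 (pP _).1).
  by rewrite SP// leq_addr.
have sT : adj (1 - T) (1 - T) by apply: adjointB => //; exact: pT.1.
exists (1 - T); split.
  split => //; apply: bounded_opP => x; rewrite opM.
  apply: (@cvs_unique _ _ (fun n => (1 - T) (S n x))); first exact: cvs_op.
  have -> : (fun n => (1 - T) (S n x)) = fun n => S n x; last exact: ST.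
  apply/funext => n; apply: (@cvs_unique _ _ (fun k => S (k + n)%N (S n x))).
    exact: (cvs_shift n (ST (S n x))).
  under eq_fun do rewrite -opM addnC SSn; exact: cvs_cst.
move=> x; have mUF : measurable (\bigcup_n F n) by exact: bigcupT_measurable.
have := @measure_semi_sigma_additive _ _ _ (mu x) F mF tF mUF.
have -> : (fun n => \sum_(0 <= i < n) mu x (F i))%E = (fun n => (rd (S n x) x)%:E).
  apply/funext => n; rewrite big_mkord.
  elim: n => [|n IH]; first by rewrite !big_ord0 /S big_ord0 op0 rd0l.
  by rewrite big_ord_recr/= IH SS opD rdDl EFinD PFE.
move=> h; apply: (cvg_unique _ h); first exact: ereal_hausdorff.
apply/fine_cvgP; split; first exact: nearW.
exact: (cvs_rd_cvg dot_norm (ST x)).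
Qed.

Theorem spectral_measure_exists A : adj A A -> exists E, spectral_measure dot A E.
Proof.
move=> sA; have [F hF] := spectral_family_exists dot_norm sA.
have /choice[mu muP] := fun x => family_stieltjes x sA hF.
have mu1 x a b : a <= b -> mu x `]a, b]%classic = (rd ((F b - F a) x) x)%:E.
  by have [h _ _ _] := muP x; exact: h.
have muT x : mu x setT = (rn x ^+ 2)%:E by have [] := muP x.
have EX := family_projections hF mu1 muT.
pose E B := xget 0 [set P | isproj P /\ forall x, mu x B = (rd (P x) x)%:E].
have EP B : measurable B -> isproj (E B) /\ forall x, mu x B = (rd (E B x) x)%:E.
  by move=> mB; exact: (xgetPex 0 (EX B mB)).
have muE B x : measurable B -> mu x B = (rd (E B x) x)%:E by case/EP.
have orth (B C : set mT) : measurable B -> measurable C -> B `&` C = set0 ->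
    E B * E C = 0.
  move=> mB mC BC; apply: (proj_orth dot_norm) => [||x]; [exact: (EP _ _).1..|].
  rewrite -lee_fin EFinD -!muE// -measureU// -muT le_measure ?inE//.
  exact: measurableU.
have EU (B C : set mT) : measurable B -> measurable C -> B `&` C = set0 ->
    E (B `|` C) = E B + E C.
  move=> mB mC BC; have mBC := measurableU _ _ mB mC.
  apply: (sa_eq dot_norm).
  - exact: (EP _ mBC).1.1.
  - by apply: adjointD; [exact: (EP _ mB).1.1|exact: (EP _ mC).1.1].
  move=> x; apply: EFin_inj; rewrite opD rdDl EFinD -!muE//.
  exact: measureU.
have ED (B C : set mT) : measurable B -> measurable C ->
    E B = E (B `&` C) + E (B `\` C).
  move=> mB mC; rewrite -EU ?setUIDK//.
  - exact: measurableI.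
  - exact: measurableD.
  by apply/seteqP; split => // z [[] ? ? [] ? ?].
exists E; split.
- by move=> B mB; split; [exact/(saP dot)/(EP _ mB).1.1|exact: (EP _ mB).1.2].
- apply: (sa_eq dot_norm); first exact: (EP _ measurableT).1.1.
    exact: adjoint1.
  by move=> x; apply: EFin_inj; rewrite -muE// muT op1 rdxx.
(* Split [B] and [C] along their intersection; the products of disjoint pieces vanish. *)
- move=> B C mB mC; rewrite (ED B C)// (ED C B)// [C `&` B]setIC.
  have mI : measurable (B `&` C) by exact: measurableI.
  have mD1 : measurable (B `\` C) by exact: measurableD.
  have mD2 : measurable (C `\` B) by exact: measurableD.
  rewrite mulrDr !mulrDl (EP _ mI).1.2 !orth ?addr0//.
  + by apply/seteqP; split => // z [[] ? ? [] ? ?].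
  + by apply/seteqP; split => // z [[] ? ? [] ? ?].
  + by apply/seteqP; split => // z [[] ? ? [] ? ?].
- move=> x; exists (mu x); have [_ _ h1 h2] := muP x; split => //.
  by move=> B mB; exact: muE.
Qed.

End SpectralMeasure.

(** * Positive and negative parts through spectral measures *)

Section SpectralParts.
Context {R : realType} {H : completeNormedModType R[i]}.
Variable dot : {dot H for (@Num.conj R[i])}.
Hypothesis dot_norm : forall x : H, dot x x = `|x| ^+ 2.
Implicit Types (x y z u v : H) (P Q S T W A : bounded_op H) (l m : R).
Local Notation rd := (re_dot dot).
Local Notation adj := (adj dot).
Local Notation isproj := (isproj dot).
Local Notation mT := (measurableTypeR R).

Lemma spectral_measure_isproj A E (B : set mT) :
  spectral_measure dot A E -> measurable B -> isproj (E B).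
Proof. by case=> EP _ _ _ /EP[sB BB]; split=> //; exact/saP. Qed.

Lemma spectral_measure_compl A E (B : set mT) x :
  spectral_measure dot A E -> measurable B -> E B x = x -> E (~` B) x = 0.
Proof.
move=> hE mB EBx; have [_ ET EI Emu] := hE.
have mC := measurableC mB.
have E0 y : E set0 y = 0.
  have [mu [muE _ _]] := Emu y; apply: (rn_eq0); apply/eqP.
  rewrite -sqrf_eq0 -(proj_rd dot_norm); last first.
    exact: (spectral_measure_isproj hE measurable0).
  by rewrite -eqe -[X in X == _](muE _ measurable0) measure0.
by rewrite -EBx -opM -EI// setICl E0.
Qed.

Lemma spectral_measure_bounds A E (B : set mT) x (a : R) :
  spectral_measure dot A E -> measurable B -> E B x = x ->
  ((forall t, B t -> a <= t) -> a * rn x ^+ 2 <= rd (A x) x) /\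
  ((forall t, B t -> t <= a) -> rd (A x) x <= a * rn x ^+ 2).
Proof.
move=> hE mB EBx; have [EP ET EI Emu] := hE.
have mC := measurableC mB.
have [mu [muE muI muA]] := Emu x.
have muT : mu setT = (rn x ^+ 2)%:E.
  by rewrite muE// ET; congr (_%:E); exact: (rdxx dot_norm).
have muC : mu (~` B) = 0%E.
  rewrite muE// /quad (spectral_measure_compl hE mB EBx).
  by congr (_%:E); exact: rd0l.
have BT : setT `\` (~` B) = B by rewrite setTD setCK.
have muB : mu B = (rn x ^+ 2)%:E.
  have : mu setT = (mu B + mu (~` B))%E.
    have := measureDI mu (@measurableT _ _) mC.
    by rewrite BT setTI.
  by rewrite muC adde0 muT => <-.
have iB : mu.-integrable B (fun t : R => t%:E).
  exact: (integrableS measurableT mB).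
have ca : mu.-integrable B (fun=> a%:E).
  apply: measurable_bounded_integrable => //.
    by rewrite muB ltry.
  by exists `|a|; split; [rewrite num_real|move=> M /ltW aM y _].
have AE : ((rd (A x) x)%:E = \int[mu]_(t in B) (t : R)%:E)%E.
  by rewrite -[LHS]muA (negligible_integral mC)// BT.
have aE : (a * rn x ^+ 2)%:E = (\int[mu]_(t in B) a%:E)%E.
  by rewrite integral_cst// muB.
by split=> Ba; rewrite -lee_fin AE aE; apply: le_integral => // t;
  rewrite inE => /Ba; rewrite lee_fin.
Qed.

Lemma spectral_measure_ge A E (B : set mT) x (a : R) :
  spectral_measure dot A E -> measurable B -> E B x = x ->
  (forall t, B t -> a <= t) -> a * rn x ^+ 2 <= rd (A x) x.
Proof. by move=> hE mB EBx; have [] := spectral_measure_bounds a hE mB EBx. Qed.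

Lemma spectral_measure_le A E (B : set mT) x (a : R) :
  spectral_measure dot A E -> measurable B -> E B x = x ->
  (forall t, B t -> t <= a) -> rd (A x) x <= a * rn x ^+ 2.
Proof. by move=> hE mB EBx; have [] := spectral_measure_bounds a hE mB EBx. Qed.

(** For [u] in the range and [v] in the kernel of [E B], the scalar measure of [u + v] is the sum of
    those of [u] and [v]; integrating the identity leaves [rd (A u) v = 0]. So [A] preserves the
    range of [E B] and, being self-adjoint, commutes with it. *)
Lemma spectral_measure_comm A E (B : set mT) : adj A A ->
  spectral_measure dot A E -> measurable B -> A * E B = E B * A.
Proof.
move=> sA hE mB; have [EP ET EI Emu] := hE.
have pB := spectral_measure_isproj hE mB.
have ort u v : E B u = u -> E B v = 0 -> rd (A u) v = 0.
  move=> Bu Bv; have [mu [muE muI muA]] := Emu u.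
  have [nu [nuE nuI nuA]] := Emu v; have [la [laE laI laA]] := Emu (u + v).
  have cross (C : set mT) : measurable C -> rd (E C u) v = 0.
    move=> mC; rewrite -Bu -opM -EI// setIC EI// opM pB.1 Bv.
    exact: rd0r.
  have laD (C : set mT) : measurable C -> la C = measure_add mu nu C.
    move=> mC; rewrite measure_addE laE// muE// nuE// -EFinD; congr (_%:E).
    have pC := spectral_measure_isproj hE mC.
    have := cross C mC; rewrite /quad -!/(rd _ _) opxD !rdE => c.
    by rewrite c (rdC dot (E C v)) -pC.1 c addr0 add0r.
  have mid : measurable_fun [set: mT] (fun t : R => t%:E).
    exact: measurable_int muI.
  have : (\int[la]_t (t : R)%:E = \int[mu]_t (t : R)%:E + \int[nu]_t (t : R)%:E)%E.
    rewrite -integral_measure_add//.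
    by apply: eq_measure_integral => C mC _; exact: laD.
  rewrite laA muA nuA -EFinD /quad -!/(rd _ _) => -[].
  rewrite opxD !rdE (sA v u) (rdC dot v).
  move: (rd (A u) u) (rd (A u) v) (rd (A v) v) => a b c; lra.
have AP : E B * A * E B = A * E B.
  apply: bounded_opP => x; apply: (vec_eq dot_norm) => y.
  apply/eqP; rewrite eq_sym -subr_eq0 -rdBl; apply/eqP.
  rewrite !opM -[X in X - _]op1 -opB (proj_compl pB).1; apply: ort.
    by rewrite -opM pB.2.
  by rewrite -opM mulrBr mulr1 pB.2 subrr op0.
rewrite -AP; apply: bounded_opP => x; apply: (vec_eq dot_norm) => y.
rewrite [in RHS]opM pB.1 sA -[A (E B y)]opM -AP.
by rewrite !opM pB.1 sA pB.1.
Qed.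

(** The operator selected by [xget] comes with a spectral measure of its own and has the same
    quadratic form as its value at [B]. The existence theorem guarantees that the selection is not
    made from an empty set. *)
Lemma borel_calculus_indic A (B : set mT) : adj A A -> measurable B ->
  exists E, spectral_measure dot A E /\ borel_calculus dot A \1_B = E B.
Proof.
move=> sA mB; rewrite /borel_calculus; set X := (X in xget 0 X).
have indE E x (mu : {measure set mT -> \bar R}) : scalar_measure dot E x mu ->
    (\int[mu]_t (\1_B t)%:E)%E = (quad dot (E B) x)%:E.
  by move=> muE; rewrite integral_indic// setIT muE.
have [E hE] := spectral_measure_exists dot_norm sA.
have XE : X (E B).
  split; first by have [h _ _ _] := hE; exact: (h _ mB).1.
  by exists E; split => // x mu muE; rewrite (indE _ _ _ muE).
have [sT [F [hF TF]]] := xgetPex 0 (ex_intro _ _ XE).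
exists F; split => //; apply: (sa_eq dot_norm).
- exact/(saP dot).
- exact: (spectral_measure_isproj hF mB).1.
move=> x; have [_ _ _ /(_ x)[mu [muF _ _]]] := hF.
by apply: EFin_inj; rewrite [LHS](TF _ _ muF) (indE _ _ _ muF).
Qed.

(** What is kept of the functional calculus. The inequalities are weak on both sides, so the kernel
    of [A] may lie on either side of the split. *)
Definition nonpos_split A P :=
  [/\ isproj P, A * P = P * A, forall x, P x = x -> rd (A x) x <= 0 &
    forall x, P x = 0 -> 0 <= rd (A x) x].

Lemma measurable_itvR (i : interval R) : measurable ([set` i] : set mT).
Proof. exact: measurable_itv. Qed.

Lemma spectral_measure_kernel A E (B : set mT) x :
  spectral_measure dot A E -> measurable B -> E B x = 0 -> E (~` B) x = x.
Proof.
move=> hE mB EBx; have mC := measurableC mB; have [_ ET EI Emu] := hE.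
suff U : E setT = E B + E (~` B) by rewrite -[RHS]op1 -ET U opD EBx add0r.
apply: (sa_eq dot_norm).
- exact: (spectral_measure_isproj hE measurableT).1.
- by apply: adjointD; [exact: (spectral_measure_isproj hE mB).1|
    exact: (spectral_measure_isproj hE mC).1].
move=> y; have [nu [nuE _ _]] := Emu y; apply: EFin_inj.
have : nu setT = (nu B + nu (~` B))%E by rewrite -measureU// ?setICr ?setUv.
by rewrite !nuE// -EFinD opD rdDl.
Qed.

Lemma neg_partE A : adj A A -> exists P,
  nonpos_split A P /\ neg_part dot A = - (A * P).
Proof.
move=> sA; have mB := measurable_itvR `]-oo, 0[.
have [E [hE EE]] := borel_calculus_indic sA mB.
exists (E `]-oo, 0[%classic); split; last by rewrite /neg_part EE mulNr.
split.
- exact: spectral_measure_isproj hE mB.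
- exact: spectral_measure_comm hE mB.
- move=> x Px; rewrite -[leRHS](mul0r (rn x ^+ 2)).
  by apply: (spectral_measure_le hE mB Px) => t; rewrite /= in_itv/= => /ltW.
- move=> x Px; rewrite -[leLHS](mul0r (rn x ^+ 2)).
  have Cx := spectral_measure_kernel hE mB Px.
  apply: (spectral_measure_ge hE (measurableC mB) Cx) => t /=.
  by rewrite in_itv/= => /negP; rewrite -leNgt.
Qed.

Lemma pos_partE A : adj A A -> exists P,
  nonpos_split (- A) P /\ pos_part dot A = A * P.
Proof.
move=> sA; have mB := measurable_itvR `]0, +oo[.
have [E [hE EE]] := borel_calculus_indic sA mB.
exists (E `]0, +oo[%classic); split; last by rewrite /pos_part EE.
split.
- exact: spectral_measure_isproj hE mB.
- by rewrite mulNr mulrN (spectral_measure_comm sA hE mB).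
- move=> x Px; rewrite opN rdNl oppr_le0 -[leLHS](mul0r (rn x ^+ 2)).
  apply: (spectral_measure_ge hE mB Px) => t; rewrite /= in_itv/= andbT.
  exact: ltW.
- move=> x Px; rewrite opN rdNl oppr_ge0 -[leRHS](mul0r (rn x ^+ 2)).
  have Cx := spectral_measure_kernel hE mB Px.
  apply: (spectral_measure_le hE (measurableC mB) Cx) => t /=.
  by rewrite in_itv/= andbT => /negP; rewrite -leNgt.
Qed.

End SpectralParts.

(** * Compactness and finite rank *)

Section Compactness.
Context {R : realType} {H : completeNormedModType R[i]}.
Variable dot : {dot H for (@Num.conj R[i])}.
Hypothesis dot_norm : forall x : H, dot x x = `|x| ^+ 2.
Implicit Types (x y z u v : H) (P Q S T W A : bounded_op H) (s : seq H).
Local Notation rd := (re_dot dot).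
Local Notation adj := (adj dot).
Local Notation isproj := (isproj dot).

Fixpoint orthonormal_seq s := if s is e :: s' then
  [/\ rn e = 1, forall f, f \in s' -> dot f e = 0 & orthonormal_seq s'] else True.

Definition finite_rank Q := exists2 s, orthonormal_seq s &
  forall x, Q x = \sum_(e <- s) dot x e *: e.

Lemma dot0C x y : dot x y = 0 -> dot y x = 0.
Proof. by move=> xy; apply/eqP; rewrite herm_eq0C; apply/eqP. Qed.

Lemma dot1 x : rn x = 1 -> dot x x = 1.
Proof. by move=> x1; rewrite dot_norm rnE x1 expr1n. Qed.

Lemma orthonormal_coef s e x : orthonormal_seq s -> e \in s ->
  dot (\sum_(f <- s) dot x f *: f) e = dot x e.
Proof.
have lin s' y : dot (\sum_(f <- s') dot x f *: f) y = \sum_(f <- s') dot x f * dot f y.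
  elim: s' => [|g s' IH]; first by rewrite !big_nil linear0l.
  by rewrite !big_cons dotDl dotZl IH.
rewrite lin; elim: s => [//|g s IH] [g1 og os]; rewrite inE big_cons.
case/predU1P => [->|es]; last first.
  by rewrite IH// (dot0C (og _ es)) mulr0 add0r.
rewrite dot1// mulr1 big1_seq ?addr0// => f /andP[_ /og ->].
by rewrite mulr0.
Qed.

(** Gram-Schmidt with choice: no finite orthonormal list in the range represents [Q], so some [Q x]
    differs from its expansion, and the normalised difference extends the list. *)
Lemma infinite_rank_seq Q : isproj Q -> ~ finite_rank Q ->
  exists e : nat -> H, [/\ forall n, Q (e n) = e n, forall n, rn (e n) = 1 &
    forall i j, i != j -> dot (e i) (e j) = 0].
Proof.
move=> pQ nQ.
have /choice[next nextP] s : exists y, orthonormal_seq s ->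
    (forall e, e \in s -> Q e = e) ->
    [/\ Q y = y, rn y = 1 & forall e, e \in s -> dot e y = 0].
  have [os|nos] := pselect (orthonormal_seq s); last by exists 0.
  have [Qs|nQs] := pselect (forall e, e \in s -> Q e = e); last by exists 0.
  have [x Qx] : exists x, Q x != \sum_(e <- s) dot x e *: e.
    apply: contrapT => nx; apply: nQ; exists s => // x.
    by apply/eqP; apply: contrapT => /negP Qx; apply: nx; exists x.
  pose y := Q x - \sum_(e <- s) dot x e *: e.
  have y0 : 0 < rn y by rewrite rn_gt0 subr_eq0.
  have Qy : Q y = y.
    rewrite /y opxB -opM pQ.2; congr (_ - _).
    rewrite (big_morph Q (opxD Q) (opx0 Q)) !big_seq.
    by apply: eq_bigr => e es; rewrite opxZ Qs.
  have sy e : e \in s -> dot e y = 0.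
    move=> es; apply: dot0C; rewrite /y dotBl orthonormal_coef//.
    by rewrite (saP dot Q).2 ?Qs ?subrr//; exact: pQ.1.
  exists ((rn y)^-1%:C *: y) => _ _; split.
  - by rewrite opxZ Qy.
  - by rewrite rnZr ger0_norm ?invr_ge0 ?ltW// mulVf ?gt_eqF.
  - by move=> e es; apply: dot0C; rewrite dotZl (dot0C (sy _ es)) mulr0.
pose L n := iter n (fun s => next s :: s) [::].
have LP n : orthonormal_seq (L n) /\ (forall e, e \in L n -> Q e = e).
  elim: n => [//|n [oL QL]]; have [Qn n1 on] := nextP _ oL QL.
  by split=> [|e] //=; rewrite inE => /predU1P[->|/QL].
have Li i j : (i < j)%N -> next (L i) \in L j.
  elim: j => [//|j IH]; rewrite ltnS leq_eqVlt => /predU1P[->|/IH Lj] /=.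
    by rewrite mem_head.
  by rewrite in_cons Lj orbT.
exists (fun n => next (L n)); split.
- by move=> n; have [oL QL] := LP n; have [] := nextP _ oL QL.
- by move=> n; have [oL QL] := LP n; have [] := nextP _ oL QL.
move=> i j; rewrite neq_ltn => /orP[] ij.
  by have [oL QL] := LP j; have [_ _ h] := nextP _ oL QL; exact/h/Li.
apply: dot0C; have [oL QL] := LP i; have [_ _ h] := nextP _ oL QL.
exact/h/Li.
Qed.

(** Total boundedness of the image of the unit ball, for plain functions so that it applies to each
    term of an expansion. *)
Definition finite_nets (f : H -> H) := forall d : R, 0 < d -> exists s,
  forall x, rn x <= 1 -> exists2 c, c \in s & rn (f x - c) < d.

Lemma finite_netsD f g : finite_nets f -> finite_nets g ->
  finite_nets (fun x => f x + g x).
Proof.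
move=> tf tg d d0; have d20 : 0 < d / 2 by rewrite divr_gt0.
have [s sf] := tf _ d20; have [t tg'] := tg _ d20.
exists [seq a + b | a <- s, b <- t] => x x1.
have [a sa fa] := sf _ x1; have [b tb gb] := tg' _ x1.
exists (a + b); first exact: allpairs_f.
rewrite opprD addrACA; apply: (le_lt_trans (rnD _ _)).
by rewrite [ltRHS]splitr ltrD.
Qed.

Lemma interval_net (d : R) : 0 < d -> exists s : seq R,
  forall r, `|r| <= 1 -> exists2 c, c \in s & `|r - c| < d.
Proof.
move=> d0; have [n hn] := archi_small 1 d0; set m := n.+1 in hn.
have m0 : 0 < m%:R :> R by rewrite ltr0n.
exists [seq k%:R / m%:R - 1 | k <- iota 0 (2 * m).+1] => r.
rewrite ler_norml => /andP[r1 r2].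
have q0 : 0 <= (r + 1) * m%:R by rewrite mulr_ge0// -lerBlDr sub0r.
have /andP[k1 k2] := truncn_itv q0; set k := Num.truncn _ in k1 k2.
exists (k%:R / m%:R - 1).
  apply/mapP; exists k => //; rewrite mem_iota leq0n add0n ltnS /= -(ler_nat R).
  by apply: (le_trans k1); rewrite natrM ler_wpM2r//; lra.
apply: le_lt_trans hn; rewrite div1r.
have -> : r - (k%:R / m%:R - 1) = ((r + 1) * m%:R - k%:R) / m%:R.
  by field; rewrite gt_eqF.
rewrite normrM normfV [`|m%:R|]ger0_norm ?(ltW m0)// -[leRHS]mul1r.
rewrite ler_wpM2r ?invr_ge0 ?(ltW m0)// ger0_norm ?subr_ge0//.
by rewrite lerBlDl natr1 ltW.
Qed.

Lemma finite_nets_rank1 e g : rn e = 1 -> finite_nets (fun x => dot x e *: g).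
Proof.
move=> e1 d d0; have g1 : 0 < 2 * rn g + 1 by rewrite ltr_wpDl ?mulr_ge0 ?rn_ge0.
(* The real and imaginary parts of the coefficient are approximated separately, hence the factor
   [2]. *)
have [|s hs] := @interval_net (d / (2 * rn g + 1)); first by rewrite divr_gt0.
exists [seq (a +i* b) *: g | a <- s, b <- s] => x x1.
have c1 y : rn y = 1 -> `|rd x y| <= 1.
  by move=> y1; apply: (le_trans (CS dot_norm _ _)); rewrite y1 mulr1.
have ie1 : rn ('i *: e) = 1.
  by apply/eqP; rewrite -(@eqrXn2 _ 2)// ?rn_ge0// -(rdxx dot_norm) rd_i (rdxx dot_norm) e1.
have [a sa ra] := hs _ (c1 _ e1); have [b sb rb] := hs _ (c1 _ ie1).
exists ((a +i* b) *: g); first exact: (allpairs_f (fun a b => (a +i* b) *: g)).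
rewrite -scalerBl rnZ; set z := dot x e - _.
have zE : z = (rd x e - a)%:C + (rd x ('i *: e) - b)%:C * 'i.
  rewrite /z dotE; apply/eqP; rewrite eq_complex/=.
  by rewrite !(mulr0, mul0r, mulr1, subr0, addr0, add0r) !eqxx.
have zn : complex.Re `|z| <= `|rd x e - a| + `|rd x ('i *: e) - b|.
  rewrite -lecR RRe_real ?ger0_real// zE (le_trans (ler_normD _ _))//.
  rewrite normrM !normcR [`|'i|]normc_def/= expr0n expr1n add0r sqrtr1 mulr1.
  by rewrite -rmorphD.
have zn2 : complex.Re `|z| <= 2 * (d / (2 * rn g + 1)).
  by apply: (le_trans zn); rewrite mulr_natl mulr2n lerD// ltW.
apply: (le_lt_trans (ler_wpM2r (rn_ge0 g) zn2)).
have -> : 2 * (d / (2 * rn g + 1)) * rn g = d * ((2 * rn g) / (2 * rn g + 1)).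
  by move: (rn g) g1 => t t1; field; rewrite gt_eqF.
by rewrite gtr_pMr// ltr_pdivrMr// mul1r ltrDl.
Qed.

(** An ultrafilter on the closure contains one of the finitely many balls around a net, for every
    radius, and is therefore Cauchy. *)
Lemma finite_nets_compact T : finite_nets T -> compact_op T.
Proof.
move=> tT; rewrite /compact_op precompactE; set K := closure _.
rewrite compact_ultra => F UF FK.
have cF : cauchy F.
  apply: cauchy_exP => e e0.
  have e0' : 0 < complex.Re e by rewrite -ltcR RRe_real ?gtr0_real.
  have e20 : 0 < complex.Re e / 2 by rewrite divr_gt0.
  have [s hs] := tT _ e20.
  have : F [set y | exists2 c, c \in s & rn (y - c) < complex.Re e].
    apply: filterS FK => y Ky.
    have : nbhs y (ball y (complex.Re e / 2)%:C).
      by apply: nbhsx_ballx; rewrite ltcR.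
    move=> /Ky[z [[x /= x1 <-]]]; rewrite -ball_normE /ball_/= rnE ltcR => yz.
    have [|c sc Tc] := hs x; first by rewrite -lecR -rnE.
    exists c => //; apply: (le_lt_trans (rn_tri (T x) _ _)).
    by rewrite [ltRHS]splitr ltrD.
  elim: s {hs} => [|c s IH].
    move=> h; suff : F set0 by move/filter_ex => [].
    by apply: filterS h => y [].
  move=> h; have [hc|hc] := in_ultra_setVsetC [set y | rn (y - c) < complex.Re e] UF.
    exists c; apply: filterS hc => y /= yc.
    by rewrite -ball_normE /ball_/= distrC rnE -(RRe_real (gtr0_real e0)) ltcR.
  apply: IH; apply: filterS (filterI h hc) => y [[c']]; rewrite inE.
  by case/predU1P => [-> /= ?|sc' c'y] //; exists c'.
have /cvg_ex[l Fl] : cvg F by exact/cauchy_cvgP.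
exists l; split; last exact: Fl.
have cK : closed K by exact: closed_closure.
by apply: cK => B /Fl FB; exact: filter_ex (filterI FK FB).
Qed.

Lemma compact_no_separated_seq T (e : nat -> H) (d : R) : compact_op T -> 0 < d ->
  (forall n, rn (e n) <= 1) ->
  ~ (forall i j, i != j -> d <= rn (T (e i) - T (e j))).
Proof.
move=> [U TU [cU _]] d0 e1 sep.
have FU : (fmap (fun n => T (e n)) \oo) U.
  by exists 0%N => // n _; apply: TU; exists (e n) => //=; rewrite rnE lecR.
have [p [_ cp]] := cU _ _ FU.
have Bp : nbhs p (ball p (d / 2)%:C).
  by apply: nbhsx_ballx; rewrite ltcR divr_gt0.
have get N : exists2 n, (N <= n)%N & rn (p - T (e n)) < d / 2.
  have [|y [[n /= Nn <-]]] := cp [set T (e n) | n in [set n | (N <= n)%N]] _ _ Bp.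
    by exists N => // n Nn; exists n.
  by rewrite -ball_normE /ball_/= rnE ltcR => h; exists n.
have [n _ hn] := get 0%N; have [m nm hm] := get n.+1.
have := sep n m; rewrite neq_ltn nm => /(_ isT); apply/negP; rewrite -ltNge.
apply: (le_lt_trans (rn_tri p _ _)); rewrite (rnBC _ p).
by rewrite [ltRHS]splitr ltrD.
Qed.

(** The spectral projection of [A] for []-oo, - eps]]. Commuting with the whole commutant of [A], it
    commutes with every other projection that commutes with [A]. *)
Definition below A (eps : R) Q :=
  [/\ isproj Q, forall W, W * A = A * W -> W * Q = Q * W,
    forall x, Q x = x -> rd (A x) x <= - eps * rn x ^+ 2 &
    forall x, Q x = 0 -> - eps * rn x ^+ 2 <= rd (A x) x].

Lemma below_exists A eps : adj A A -> exists Q, below A eps Q.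
Proof.
move=> sA.
have [|Q [sQ QQ QW [Q1 Q2 _]]] := @spectral_projection _ _ _ dot_norm (A + scal eps).
  by apply: adjointD => //; exact: adj_scal.
exists Q; split => //.
- by move=> W WA; apply: QW; rewrite mulrDr mulrDl WA scalC.
- move=> x Qx; have := Q1 x; rewrite Qx opD scalE rdDl rdZl (rdxx dot_norm).
  by rewrite mulNr -lerBrDr sub0r.
- move=> x Qx; have := Q2 x Qx; rewrite opD scalE rdDl rdZl (rdxx dot_norm).
  by rewrite mulNr -lerBlDr sub0r.
Qed.

(** An orthonormal sequence in the range of [Q] would have images under [T] at mutual distance at
    least [eps]: at a difference [x] of two terms the form of [A * P] is at most that of [A], hence
    at most [- eps * rn x ^+ 2]. *)
Lemma compact_finite_rank A P T (eps : R) Q : adj A A -> nonpos_split dot A P ->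
  (T = A * P \/ T = - (A * P)) -> compact_op T -> 0 < eps -> below A eps Q ->
  finite_rank Q.
Proof.
move=> sA [pP AP P1 P2] TE cT eps0 [pQ _ Q1 _]; apply: contrapT => nQ.
have [e [Qe e1 oe]] := infinite_rank_seq pQ nQ.
apply: (compact_no_separated_seq cT eps0 (e := e)) => [n|i j ij].
  by rewrite e1.
set x := e i - e j.
have -> : rn (T (e i) - T (e j)) = rn (A (P x)).
  by rewrite -opxB -/x; case: TE => ->; rewrite ?opN ?rnN opM.
have x2 : rn x ^+ 2 = 2.
  rewrite -(rdxx dot_norm) /x !rdE !(rdxx dot_norm) !e1 expr1n.
  by rewrite /re_dot (oe _ _ ij) (oe j i) 1?eq_sym//=; lra.
have Qx : Q x = x by rewrite opxB !Qe.
clearbody x; have PPx : P (P x) = P x by rewrite -opM pP.2.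
have h : rd (A x) x = rd (A (P x)) x + rd (A (x - P x)) (x - P x).
  have -> : rd (A (x - P x)) (x - P x) = rd (A (x - P x)) x.
    have -> : rd (A (x - P x)) (x - P x) =
        rd (A (x - P x)) x - rd (A (x - P x)) (P x) by rewrite rdBr.
    by rewrite -pP.1 -[P (A _)]opM -AP opM (opxB P) PPx subrr opx0 rd0l subr0.
  by rewrite -rdDl opxB addrCA subrr addr0.
have h1 : rd (A (P x)) x <= - eps * rn x ^+ 2.
  apply: le_trans (Q1 _ Qx); rewrite h lerDl; apply: P2.
  by rewrite opxB PPx subrr.
have h2 : eps * rn x ^+ 2 <= rn (A (P x)) * rn x.
  have := CSle dot_norm (- A (P x)) x; rewrite rnN rdNl => h2.
  by apply: le_trans h2; rewrite lerNr -mulNr.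
have x0 : 0 < rn x by rewrite lt_neqAle rn_ge0 andbT eq_sym -sqrf_eq0 x2.
have x1 : 1 <= rn x.
  by rewrite -(@ler_pXn2r _ 2)// ?nnegrE ?rn_ge0// x2 expr1n; lra.
move: h2; rewrite expr2 mulrA ler_pM2r//; apply: le_trans.
by rewrite ler_peMr// ltW.
Qed.

(** [T * Q] has finite rank, and [T * (1 - Q)] has norm at most [d / 2]: up to sign it is positive,
    and at vectors [y] in the range of [P] and the kernel of [Q] the form of [A] lies between
    [- (d / 2) * rn y ^+ 2] and [0]. *)
Lemma finite_rank_compact A P T : adj A A -> nonpos_split dot A P ->
  (T = A * P \/ T = - (A * P)) ->
  (forall eps, 0 < eps -> exists2 Q, below A eps Q & finite_rank Q) -> compact_op T.
Proof.
move=> sA [pP AP P1 P2] TE fr; apply: finite_nets_compact => d d0.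
have d20 : 0 < d / 2 by rewrite divr_gt0.
have [Q [pQ QW _ Q2] [s os Qs]] := fr _ d20.
have AQ : A * Q = Q * A by apply: QW.
have PQ : P * Q = Q * P by apply: QW; rewrite AP.
have small x : rn x <= 1 -> rn (T (x - Q x)) <= d / 2.
  move=> x1; have -> : rn (T (x - Q x)) = rn ((A * P * (1 - Q)) x).
    by case: TE => ->; rewrite ?opN ?rnN.
  pose S := - (A * P * (1 - Q)).
  have pQ' := proj_compl pQ.
  have c1 : (1 - Q) * P = P * (1 - Q) by rewrite mulrBr mulrBl mulr1 mul1r PQ.
  have c2 : (1 - Q) * A = A * (1 - Q) by rewrite mulrBr mulrBl mulr1 mul1r AQ.
  have SE : (1 - Q) * P * A * P * (1 - Q) = A * P * (1 - Q).
    rewrite c1 -[P * (1 - Q) * A]mulrA c2 mulrA -AP -[A * P * (1 - Q) * P]mulrA c1.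
    by rewrite mulrA -[A * P * P]mulrA pP.2 -[LHS]mulrA pQ'.2.
  have Sy y : rd (S y) y = - rd (A (P ((1 - Q) y))) (P ((1 - Q) y)).
    by rewrite /S opN rdNl -SE !opM pQ'.1 pP.1.
  have Pn y : P (P ((1 - Q) y)) = P ((1 - Q) y) by rewrite -opM pP.2.
  have Qn y : Q (P ((1 - Q) y)) = 0.
    rewrite -!opM -PQ -mulrA mulrBr mulr1 pQ.2 subrr mulr0.
    exact: op0.
  have cn P' y : isproj P' -> rn (P' y) <= rn y.
    move=> pP'; rewrite -(@ler_pXn2r _ 2)// ?nnegrE ?rn_ge0//.
    rewrite -(proj_rd dot_norm _ pP') -subr_ge0 -(rdxx dot_norm) -rdBl.
    exact: (proj_psd dot_norm (proj_compl pP')).2.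
  have pS : psd dot S.
    split; last by move=> y; rewrite Sy oppr_ge0; exact: P1.
    apply: adjointN; have sAP : adj (A * P) (A * P).
      by rewrite {2}AP; apply: adjointM => //; exact: pP.1.
    have c3 : A * P * (1 - Q) = (1 - Q) * (A * P).
      by rewrite -mulrA -c1 mulrA -c2 mulrA.
    by rewrite {2}c3; apply: adjointM => //; exact: pQ'.1.
  have SM y : rd (S y) y <= d / 2 * rn y ^+ 2.
    rewrite Sy lerNl -mulNr; apply: le_trans (Q2 _ (Qn y)).
    rewrite !mulNr lerN2 ler_wpM2l ?(ltW d20)// ler_pXn2r// ?nnegrE ?rn_ge0//.
    by apply: (le_trans (cn _ _ pP)); exact: cn.
  rewrite -rnN -opN; apply: (le_trans (rn_op _ _)).
  apply: (le_trans (ler_wpM2r (rn_ge0 x) (psd_opnorm dot_norm (ltW d20) pS SM))).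
  by rewrite ler_piMr// ltW.
have net : finite_nets (fun x => \sum_(e <- s) dot x e *: T e).
  elim: s os {Qs} => [_|e s IH [e1 _ os]] c c0.
    by exists [:: 0] => x _; exists 0; rewrite ?mem_head// big_nil subrr rn0.
  have [t ht] := finite_netsD (finite_nets_rank1 (T e) e1) (IH os) c0.
  by exists t => x /ht; rewrite big_cons.
have [t ht] := net _ d20; exists t => x x1.
have [c tc hc] := ht x x1; exists c => //.
have TQ : T (Q x) = \sum_(e <- s) dot x e *: T e.
  rewrite Qs (big_morph T (opxD T) (opx0 T)).
  by apply: eq_bigr => e _; rewrite opxZ.
apply: (le_lt_trans (rn_tri (T (Q x)) _ _)).
by rewrite [ltRHS]splitr ler_ltD//; [rewrite -opxB small|rewrite TQ].
Qed.

End Compactness.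

(** * Invertibility and negative index *)

Section Invertibility.
Context {R : realType} {H : completeNormedModType R[i]}.
Variable dot : {dot H for (@Num.conj R[i])}.
Hypothesis dot_norm : forall x : H, dot x x = `|x| ^+ 2.
Implicit Types (x y z u v w : H) (S T A X Y G K : bounded_op H).
Local Notation rd := (re_dot dot).
Local Notation adj := (adj dot).

Lemma op_invP T : invertible T -> op_inv T * T = 1 /\ T * op_inv T = 1.
Proof. by move=> iT; exact: (xgetPex 0 iT). Qed.

Lemma neumann K : rn K < 1 -> exists S,
  [/\ S * (1 - K) = 1, (1 - K) * S = 1 & rn S <= (1 - rn K)^-1].
Proof.
move=> K1; set q := rn K in K1 *; have q0 : 0 <= q by exact: rn_ge0.
have d0 : 0 < 1 - q by rewrite subr_gt0.
pose F := fix F n := if n is n.+1 then 1 + K * F n else 0 : bounded_op H.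
pose y := fix y n := if n is n.+1 then 1 + q * y n else 0 : R.
have FS n : F n.+1 = 1 + K * F n by [].
have yS n : y n.+1 = 1 + q * y n by [].
have yb n : y n <= (1 - q)^-1.
  elim: n => [|n IH]; first by rewrite /= invr_ge0 ltW.
  rewrite yS; have := ler_wpM2l q0 IH => h; apply: le_trans (lerD (lexx 1) h) _.
  suff -> : 1 + q * (1 - q)^-1 = (1 - q)^-1 by [].
  by field; rewrite gt_eqF.
have dF n : rn (F n.+1 - F n) <= y n.+1 - y n.
  elim: n => [|n IH].
    by rewrite FS yS /= !mulr0 !addr0 !subr0 rn_op1.
  have -> : F n.+2 - F n.+1 = K * (F n.+1 - F n).
    by rewrite (FS n.+1) [X in _ - X]FS opprD addrACA subrr add0r mulrBr.
  have -> : y n.+2 - y n.+1 = q * (y n.+1 - y n).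
    by rewrite (yS n.+1) [X in _ - X]yS; ring.
  by apply: (le_trans (rn_opM _ _)); rewrite ler_wpM2l.
have FK n : F n * K = K * F n.
  elim: n => [|n IH]; first by rewrite /= mul0r mulr0.
  by rewrite FS mulrDl mulrDr mul1r mulr1 -mulrA IH.
have [S FT] := norm_limit yb dF; have FTx x := cvs_opP x FT.
have SE : S = 1 + K * S.
  apply: bounded_opP => x.
  apply: (@cvs_unique _ _ (fun n => F (n + 1)%N x)).
    exact: (cvs_shift 1 (FTx x)).
  under eq_fun do rewrite addn1 FS opD opM op1.
  rewrite opD opM op1; apply: cvsD; [exact: cvs_cst|exact: cvs_op].
have SK : S * K = K * S.
  apply: bounded_opP => x; rewrite !opM.
  apply: (@cvs_unique _ _ (fun n => F n (K x))); first exact: FTx.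
  by under eq_fun do rewrite -opM FK opM; exact: cvs_op.
exists S; split.
- by rewrite mulrBr mulr1 SK {1}SE addrK.
- by rewrite mulrBl mul1r {1}SE addrK.
apply: cvs_le FT _ => n; apply: le_trans (yb n).
elim: n => [|n IH]; first by rewrite /= rn0.
rewrite -(subrK (F n) (F n.+1)); apply: (le_trans (rnD _ _)).
by apply: (le_trans (lerD (dF n) IH)); rewrite subrK.
Qed.

Lemma invertible_perturb G G' T : G' * G = 1 -> G * G' = 1 ->
  rn (G - T) * rn G' <= 2^-1 -> exists T',
  [/\ T' * T = 1, T * T' = 1 & rn T' <= 2 * rn G'].
Proof.
move=> G'G GG' h; set K := G' * (G - T).
have K2 : rn K <= 2^-1 by apply: (le_trans (rn_opM _ _)); rewrite mulrC.
have K1 : rn K < 1 by move: (rn K) K2 => k; lra.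
have TE : T = G * (1 - K).
  by rewrite mulrBr mulr1 /K mulrA GG' mul1r subKr.
have [S [S1 S2 S3]] := neumann K1.
exists (S * G'); split.
- by rewrite TE mulrA -[S * G' * G]mulrA G'G mulr1 S1.
- by rewrite TE mulrA -[G * _ * S]mulrA S2 mulr1 GG'.
apply: (le_trans (rn_opM _ _)); rewrite ler_wpM2r ?rn_ge0//.
apply: (le_trans S3); rewrite -[2]invrK lef_pV2 ?posrE ?invr_gt0//.
  by move: (rn K) K2 => k; lra.
by rewrite subr_gt0.
Qed.

(** The form of [U], a multiple of the square of [S], lies between [q > 0] and [1] times the squared
    norm, so [U] is within [1 - q] of the identity and a Neumann series inverts it. *)
Lemma coercive_invertible S (c : R) : adj S S -> 0 < c ->
  (forall x, c * rn x <= rn (S x)) -> invertible S.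
Proof.
move=> sS c0 Sc; set M := rn S + c.
have M0 : 0 < M by rewrite ltr_wpDl ?rn_ge0.
pose U := scal ((M ^+ 2)^-1) * (S * S).
have sSS : adj (S * S) (S * S) by exact: adjointM.
have UE x : rd (U x) x = (rn (S x) / M) ^+ 2.
  by rewrite /U opM scalE rdZl opM sS (rdxx dot_norm) mulrC -exprVn exprMn.
have U1 x : rd (U x) x <= rn x ^+ 2.
  rewrite UE ler_pXn2r ?nnegrE ?divr_ge0 ?rn_ge0 ?(ltW M0)// ler_pdivrMr//.
  apply: (le_trans (rn_op _ _)); rewrite mulrC ler_wpM2l ?rn_ge0//.
  by rewrite /M lerDl ltW.
have cM0 : 0 <= c / M by rewrite divr_ge0// ltW.
have Uc x : (c / M) ^+ 2 * rn x ^+ 2 <= rd (U x) x.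
  rewrite UE -exprMn; apply: lerXn2r; rewrite ?nnegrE.
  - exact: mulr_ge0 cM0 (rn_ge0 _).
  - by rewrite divr_ge0 ?rn_ge0 ?(ltW M0).
  - by rewrite mulrAC ler_wpM2r// invr_ge0 ltW.
pose q := (c / M) ^+ 2.
have q0 : 0 < q by rewrite exprn_gt0// divr_gt0.
have q1 : q <= 1.
  rewrite -[leRHS](expr1n _ 2) ler_pXn2r ?nnegrE ?divr_ge0 ?(ltW c0) ?(ltW M0)//.
  by rewrite ler_pdivrMr// mul1r /M lerDr rn_ge0.
have sU : adj U U.
  by rewrite /U -[X in adj _ X]scalC; apply: adjointM => //; exact: adj_scal.
have : rn (1 - U) <= 1 - q.
  have pU : psd dot (1 - U).
    split=> [|x]; first exact: adjointB.
    by rewrite opB op1 rdBl (rdxx dot_norm) subr_ge0.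
  apply: (psd_opnorm dot_norm _ pU); first by rewrite subr_ge0.
  move=> x; rewrite opB op1 rdBl (rdxx dot_norm) mulrBl mul1r lerD2l lerN2.
  exact: Uc.
move=> h; have [|V [V1 V2 _]] := @neumann (1 - U).
  by apply: le_lt_trans h _; rewrite gtrBl.
rewrite subKr in V1 V2.
pose a := scal ((M ^+ 2)^-1) : bounded_op H.
have Ul : U = (S * a) * S by rewrite /U /a scalC mulrA.
have Ur : U = S * (a * S) by rewrite Ul mulrA.
have SL : V * (S * a) * S = 1 by rewrite -mulrA -Ul.
have SR : S * (a * S * V) = 1 by rewrite mulrA -Ur.
exists (V * (S * a)); split => //.
(* The left inverse [V * (S * a)] is also a right inverse, because [S] has the right inverse
   [a * S * V]. *)
have -> : S * (V * (S * a)) = S * (V * (S * a)) * (S * (a * S * V)).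
  by rewrite SR mulr1.
by rewrite mulrA -[S * (V * (S * a)) * S]mulrA SL mulr1 SR.
Qed.

End Invertibility.

(** * Negative index and the form of [A + A X A] *)

Section NegativeIndex.
Context {R : realType} {H : completeNormedModType R[i]}.
Variable dot : {dot H for (@Num.conj R[i])}.
Hypothesis dot_norm : forall x : H, dot x x = `|x| ^+ 2.
Implicit Types (x y z u v w : H) (P Q S T A D X Y G L : bounded_op H).
Local Notation rd := (re_dot dot).
Local Notation adj := (adj dot).
Local Notation psd := (psd dot).

(* Real linear combinations suffice: the index is only compared, never
   computed. *)
Definition neg_index_ge S (n : nat) := exists v : 'I_n -> H,
  forall a : 'I_n -> R, (exists i, a i != 0) ->
    rd (S (\sum_i (a i)%:C *: v i)) (\sum_i (a i)%:C *: v i) < 0.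

(** For invertible [A] this is [A * (A^-1 + X) * A], and [Phi A X] is [A^-1] minus its inverse;
    monotonicity of [Phi A] then says that inversion reverses the order of these operators. *)
Definition twist A X : bounded_op H := A + A * X * A.

Lemma adj_twist A X : adj A A -> adj X X -> adj (twist A X) (twist A X).
Proof.
move=> sA sX; apply: adjointD => //.
by rewrite -[X in adj _ X]mulrA; apply: adjointM => //; exact: adjointM.
Qed.

Lemma twistE A X w : twist A X w = A ((X * A + 1) w).
Proof. by rewrite /twist !opD op1 !opM opxD addrC. Qed.

Lemma twist_form A X w : adj A A ->
  rd (twist A X w) w = rd (A w) w + rd (X (A w)) (A w).
Proof. by move=> sA; rewrite /twist opD rdDl !opM (sA (X (A w))). Qed.

Lemma inverse_swap A X G : G * (X * A + 1) = 1 -> (X * A + 1) * G = 1 ->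
  (1 - A * G * X) * (A * X + 1) = 1 /\ (A * X + 1) * (1 - A * G * X) = 1.
Proof.
move=> h1 h2; have c : (A * X + 1) * A = A * (X * A + 1).
  by rewrite mulrDl mulrDr mul1r mulr1 mulrA.
have c' : X * (A * X + 1) = (X * A + 1) * X.
  by rewrite mulrDl mulrDr mul1r mulr1 mulrA.
split.
  rewrite mulrBl mul1r -[A * G * X * _]mulrA c' mulrA -[A * G * _]mulrA h1 mulr1.
  by rewrite addrAC subrr add0r.
rewrite mulrBr mulr1 !mulrA c -[A * _ * G]mulrA h2 mulr1.
by rewrite addrAC subrr add0r.
Qed.

Lemma Phi_swap A X G L : G * (X * A + 1) = 1 -> (A * X + 1) * L = 1 -> G * X = X * L.
Proof.
move=> h1 h2; rewrite -[LHS]mulr1 -h2 -mulrA [X * _]mulrA.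
have -> : X * (A * X + 1) = (X * A + 1) * X.
  by rewrite mulrDl mulrDr mul1r mulr1 mulrA.
by rewrite !mulrA h1 mul1r.
Qed.

(** An analogue of the resolvent identity, behind both the monotonicity and the Lipschitz
    estimate. *)
Lemma Phi_sub A X Y GX GY LY : GX * (X * A + 1) = 1 -> GY * (Y * A + 1) = 1 ->
  (A * Y + 1) * LY = 1 -> GY * Y - GX * X = GX * (Y - X) * LY.
Proof.
move=> hX hY hL; rewrite (Phi_swap hY hL).
have <- : (X * A + 1) * Y - X * (A * Y + 1) = Y - X.
  rewrite mulrDl mulrDr mul1r mulr1 mulrA opprD addrACA subrr add0r.
  by [].
rewrite mulrBr mulrBl !mulrA hX mul1r; congr (_ - _).
by rewrite -[RHS]mulrA hL mulr1.
Qed.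

Lemma psd_AMGM D (t : R) x y : psd D ->
  2 * t * rd (D x) y <= t ^+ 2 * rd (D x) x + rd (D y) y.
Proof.
move=> [sD pD]; have := pD (t%:C *: x - y); rewrite opxB opxZ !rdE.
rewrite (sD y x) (rdC dot y).
move: (rd (D x) x) (rd (D x) y) (rd (D y) y) => a b c h; nra.
Qed.

Lemma form_line S (t : R) x y : adj S S ->
  rd (S (t%:C *: x + y)) (t%:C *: x + y) =
  t ^+ 2 * rd (S x) x + 2 * t * rd (S x) y + rd (S y) y.
Proof. by move=> sS; rewrite opxD opxZ !rdE (sS y x) (rdC dot y); ring. Qed.

(** Let the form be negative at [w] and put [p = LY w], [v = GX (D p)]. The negative value is the
    form of [twist A X] at [v] plus [rd (D p) p]. For [f] in a negative span of [twist A Y] the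
    cross term of [v] and [f] is [rd (D p) (A f)]; the inequality of means splits it into
    [rd (D p) p], absorbed at [v], and [rd (D (A f)) (A f)], the difference of the two forms at [f].
    So [v] enlarges the span. *)
Lemma Phi_monotone_of_index A X Y GX LY GY n : adj A A -> adj X X -> adj Y Y ->
  psd (Y - X) -> GX * (X * A + 1) = 1 -> (X * A + 1) * GX = 1 ->
  GY * (Y * A + 1) = 1 -> (A * Y + 1) * LY = 1 ->
  neg_index_ge (twist A Y) n -> ~ neg_index_ge (twist A X) n.+1 ->
  forall w, 0 <= rd ((GY * Y - GX * X) w) w.
Proof.
move=> sA sX sY pD hX hX' hY hL [e he] nX w; rewrite (Phi_sub hX hY hL).
set D := Y - X in pD *; rewrite leNgt; apply/negP => neg; apply: nX.
pose p := LY w; pose v := GX (D p).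
have Gv : (X * A + 1) v = D p by rewrite /v -opM hX'.
have wE : w = (A * X + 1) p + A (D p).
  have E : A * Y + 1 = A * X + 1 + A * D.
    by rewrite /D mulrBr [RHS]addrC addrA subrK.
  have -> : w = (A * Y + 1) p by rewrite /p -opM hL op1.
  by rewrite E opD opM.
have s_v : rd (twist A X v) v = rd (A v) (D p).
  by rewrite twistE Gv [LHS]sA (rdC dot (D p)).
have {neg}neg : rd (twist A X v) v + rd (D p) p < 0.
  move: neg; rewrite !opM -/p -/v wE rdDr.
  rewrite -[rd v (A (D p))]sA -s_v addrC.
  have -> : rd v ((A * X + 1) p) = rd (D p) p; last by [].
  rewrite -Gv !opD !op1 !opM rdDl rdDr; congr (_ + _).
  by rewrite sX sA.
pose e' (i : 'I_n.+1) := if unlift ord0 i is Some j then e j else v.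
exists e' => a [i0 ai0]; rewrite big_ord_recl.
have -> : e' ord0 = v by rewrite /e' unlift_none.
under eq_bigr => i _ do rewrite /e' liftK.
set b := fun i => a (lift ord0 i); set f := \sum_i _.
set t := a ord0.
have cross : rd (twist A X v) f = rd (D p) (A f) by rewrite twistE Gv sA.
have sYX : rd (twist A Y f) f = rd (twist A X f) f + rd (D (A f)) (A f).
  rewrite !twist_form// /D opB rdBl; ring.
have pos := psd_AMGM t p (A f) pD.
have main : rd (twist A X (t%:C *: v + f)) (t%:C *: v + f) <=
    t ^+ 2 * (rd (twist A X v) v + rd (D p) p) + rd (twist A Y f) f.
  rewrite (form_line _ _ _ (adj_twist sA sX)) cross sYX.
  move: (rd (twist A X v) v) (rd (D p) p) (rd (D p) (A f)) (rd (twist A X f) f)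
    (rd (D (A f)) (A f)) pos => q1 q2 q3 q4 q5 pos.
  by rewrite mulrDr; move: (t ^+ 2 * q2) pos => z pos; nra.
have fle : rd (twist A Y f) f <= 0.
  have [[i bi]|nb] := pselect (exists i, b i != 0).
    by apply/ltW/(he b); exists i.
  rewrite (_ : f = 0) ?opx0 ?rd0l// /f big1// => i _.
  have -> : a (lift ord0 i) = 0; last by rewrite scale0r.
  by apply/eqP; apply: contrapT => /negP bi; apply: nb; exists i.
apply: (le_lt_trans main).
(* If the coefficient of [v] is nonzero, its term is strictly negative; otherwise the combination
   lies in the span of the [e i], where negativity is given. *)
have [t0|tn0] := eqVneq t 0; last first.
  apply: (lt_le_trans _ fle); rewrite gtrDr pmulr_rlt0//.
  by rewrite exprn_even_gt0.
rewrite t0 expr0n mul0r add0r; apply: (he b).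
move: ai0; case: (unliftP ord0 i0) => [j ->|->]; first by exists j.
by rewrite -/t t0 eqxx.
Qed.

(** Since [A w = L (S w)], the two forms differ at [w] by at most [c * rn (S w) ^+ 2]. On either
    spectral half of [S] this square is at most [rn S] times the absolute value of the form, so
    [c * rn S < 1] controls the sign. Projecting a negative span of one form to the nonpositive half
    gives one for the other. *)
Lemma neg_index_stable A X X' L n : adj A A -> adj X X -> adj X' X' ->
  L * (A * X + 1) = 1 -> rn (X' - X) * rn L ^+ 2 * rn (twist A X) < 1 ->
  neg_index_ge (twist A X) n <-> neg_index_ge (twist A X') n.
Proof.
move=> sA sX sX' hL small; set S := twist A X in small *.
set S' := twist A X'; set c := rn (X' - X) * rn L ^+ 2 in small.
have c0 : 0 <= c by rewrite mulr_ge0 ?sqr_ge0 ?rn_ge0.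
have sS : adj S S by exact: adj_twist.
have sS' : adj S' S' by exact: adj_twist.
have LS w : A w = L (S w).
  rewrite -opM /S /twist -{2}[A]mul1r -mulrDl addrC mulrA hL.
  by rewrite mul1r.
have dS w : `|rd (S' w) w - rd (S w) w| <= c * rn (S w) ^+ 2.
  have -> : rd (S' w) w - rd (S w) w = rd ((X' - X) (A w)) (A w).
    by rewrite !twist_form// opB rdBl; ring.
  apply: (le_trans (rd_op_abs dot_norm _ _)).
  rewrite /c -mulrA ler_wpM2l ?rn_ge0// -exprMn LS.
  by apply: lerXn2r; rewrite ?nnegrE ?mulr_ge0 ?rn_ge0 ?rn_op.
have [P [sP PP PW [P1 P2 _]]] := spectral_projection dot_norm sS.
have SP : S * P = P * S by exact: PW.
have PPx w : P (P w) = P w by rewrite -opM PP.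
have SPx w : S (P w) = P (S w) by rewrite -opM SP.
have Pn w : rn (P w) <= rn w.
  apply: (le_trans (_ : _ <= 1 * rn w)); last by rewrite mul1r.
  have pP : isproj dot P by [].
  rewrite mul1r -(@ler_pXn2r _ 2)// ?nnegrE ?rn_ge0//.
  rewrite -(proj_rd dot_norm _ pP) -subr_ge0 -(rdxx dot_norm) -rdBl.
  exact: (proj_psd dot_norm (proj_compl pP)).2.
have qP w : rd (S (P w)) w = rd (S (P w)) (P w).
  by rewrite -{1}PPx SPx sP.
have pN : psd (- (S * P)).
  split; first by apply: adjointN; rewrite {2}SP; exact: adjointM.
  by move=> w; rewrite opN opM rdNl qP oppr_ge0.
have qC w : rd (S (w - P w)) w = rd (S (w - P w)) (w - P w).
  have h : rd (S (w - P w)) (P w) = 0.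
    by rewrite -sP -SPx opxB PPx subrr opx0 rd0l.
  by rewrite [RHS]rdBr h subr0.
have pC : psd (S - S * P).
  split; first by apply: adjointB => //; rewrite {2}SP; exact: adjointM.
  by move=> w; rewrite opB opM -opxB qC; apply: P2; rewrite opxB PPx subrr.
have bN w : rn (S (P w)) ^+ 2 <= rn S * - rd (S (P w)) (P w).
  have := @psd_norm _ _ _ dot_norm _ (rn S) w pN.
  rewrite opN opM rnN rdNl qP; apply => y.
  rewrite opN opM rdNl qP -rdNl -opN.
  apply: (le_trans (rd_op_le dot_norm _ _)); rewrite rnN ler_wpM2l ?rn_ge0//.
  by apply: lerXn2r; rewrite ?nnegrE ?rn_ge0.
have bC w : rn (S (w - P w)) ^+ 2 <= rn S * rd (S (w - P w)) (w - P w).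
  have := @psd_norm _ _ _ dot_norm _ (rn S) w pC.
  rewrite opB opM -opxB qC; apply => y.
  rewrite opB opM -opxB qC; apply: (le_trans (rd_op_le dot_norm _ _)).
  rewrite ler_wpM2l ?rn_ge0//; apply: lerXn2r; rewrite ?nnegrE ?rn_ge0//.
  have pP : isproj dot P by [].
  rewrite -(@ler_pXn2r _ 2)// ?nnegrE ?rn_ge0//.
  have := proj_rd dot_norm y (proj_compl pP).
  rewrite opB op1 => <-; rewrite rdBl (rdxx dot_norm) gerBl.
  exact: (proj_psd dot_norm pP).2.
have neg_proj w : rd (S (P w)) (P w) < 0 -> rd (S' (P w)) (P w) < 0.
  move=> h; have := dS (P w); have := ler_wpM2l c0 (bN w).
  rewrite ler_norml => h1 /andP[_ h2].
  move: (rd (S (P w)) _) (rd (S' (P w)) _) h h1 h2 => q q' h h1 h2.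
  have h3 : (1 - c * rn S) * q < 0 by rewrite pmulr_rlt0// subr_gt0.
  by move: (rn S) (rn _ ^+ 2) h1 h2 h3 => a b h1 h2 h3; nra.
have posC w : 0 <= rd (S' (w - P w)) (w - P w).
  have q0 : 0 <= rd (S (w - P w)) (w - P w).
    by apply: P2; rewrite opxB PPx subrr.
  have := dS (w - P w); have := ler_wpM2l c0 (bC w).
  rewrite ler_norml => h1 /andP[h2 _].
  move: (rd (S (w - P w)) _) (rd (S' (w - P w)) _) q0 h1 h2 => q q' q0 h1 h2.
  have h3 : 0 <= (1 - c * rn S) * q by rewrite mulr_ge0// subr_ge0 ltW.
  by move: (rn S) (rn _ ^+ 2) h1 h2 h3 => a b h1 h2 h3; nra.
have Psum (v : 'I_n -> H) (a : 'I_n -> R) :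
    \sum_i (a i)%:C *: P (v i) = P (\sum_i (a i)%:C *: v i).
  rewrite (big_morph P (opxD P) (opx0 P)).
  by apply: eq_bigr => i _; rewrite opxZ.
split=> -[v hv]; exists (fun i => P (v i)) => a a0; rewrite Psum;
  move: (hv a a0); set f := \sum_i _ => hf.
  apply: neg_proj; apply: le_lt_trans hf.
  have -> : rd (S f) f = rd (S (P f)) (P f) + rd (S (f - P f)) (f - P f).
    by rewrite -qP -qC -rdDl -opxD addrC subrK.
  by rewrite lerDl; apply: P2; rewrite opxB PPx subrr.
(* The nonpositive half contains the kernel of [S], so the value [0] has to be excluded: it forces
   [S (P f) = 0], then [S' (P f) = 0], and the form of [S'] at [f] becomes nonnegative. *)
rewrite lt_neqAle P1 andbT; apply/eqP => Pf0.
have SPf : S (P f) = 0.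
  have : (- (S * P)) f = 0.
    by apply: (psd_ker dot_norm pN); rewrite opN opM rdNl qP Pf0 oppr0.
  by rewrite opN opM => /eqP; rewrite oppr_eq0 => /eqP.
have S'Pf : S' (P f) = 0 by rewrite /S' /twist opD !opM LS SPf !opx0 addr0.
move: hf; apply/negP; rewrite -leNgt.
have -> : rd (S' f) f = rd (S' (f - P f)) (f - P f); last exact: posC.
by rewrite opxB S'Pf subr0 rdBr [rd (S' f) (P f)]sS' S'Pf rd0r subr0.
Qed.

Lemma finite_rank_neg_index A (eps : R) Q : adj A A -> below dot A eps Q ->
  finite_rank dot Q -> exists n, ~ neg_index_ge (A + scal eps) n.
Proof.
move=> sA [_ _ _ Q2] [s os Qs].
(* Over real coefficients each condition [dot w e = 0] counts as two, against [e] and ['i *: e]. One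
   vector more than conditions gives a nontrivial combination [w] killed by [Q]. *)
pose t := s ++ [seq 'i *: e | e <- s]; exists (size t).+1 => -[v hv].
pose M := \matrix_(i < (size t).+1, j < size t) rd (v i) (nth 0 t j).
have : kermx M != 0.
  rewrite kermx_eq0 /row_free neq_ltn; apply/orP; left.
  by rewrite ltnS rank_leq_col.
case/rowV0Pn => a /sub_kermxP aM a0.
have [i ai] : exists i, a 0 i != 0.
  apply: contrapT => na; move/eqP: a0; apply; apply/rowP => i; rewrite mxE.
  by apply/eqP; apply: contrapT => /negP ai; apply: na; exists i.
pose w := \sum_i (a 0 i)%:C *: v i.
have wt e : e \in t -> rd w e = 0.
  move=> et; have je : (index e t < size t)%N by rewrite index_mem.
  have := congr1 (fun N : 'rV_(size t) => N 0 (Ordinal je)) aM.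
  rewrite !mxE => h; rewrite -[RHS]h /w rd_suml; apply: eq_bigr => j _.
  by rewrite mxE rdZl nth_index.
have Qw : Q w = 0.
  rewrite Qs big1_seq// => e /andP[_ es].
  have -> : dot w e = 0; last exact: scale0r.
  by rewrite dotE (wt e) ?(wt ('i *: e))// mem_cat ?es// map_f ?orbT.
have := hv (fun i => a 0 i) (ex_intro _ i ai); rewrite -/w opD scalE rdDl rdZl.
rewrite (rdxx dot_norm); apply/negP; rewrite -leNgt -lerBlDr sub0r -mulNr.
exact: Q2.
Qed.

End NegativeIndex.

(** * The components of the domain *)

Section Components.
Context {R : realType} {H : completeNormedModType R[i]}.
Variable dot : {dot H for (@Num.conj R[i])}.
Hypothesis dot_norm : forall x : H, dot x x = `|x| ^+ 2.
Implicit Types (x y z u v w : H) (S T A X Y Z G L : bounded_op H).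
Local Notation rd := (re_dot dot).
Local Notation adj := (adj dot).
Local Notation psd := (psd dot).

Definition Vdom A : set (bounded_op H) :=
  [set X | self_adjoint dot X /\ invertible (X * A + 1)].

Lemma nbhs_rn X (d : R) : 0 < d -> nbhs X [set Y | rn (Y - X) < d].
Proof.
move=> d0; have : nbhs X (ball X d%:C) by apply: nbhsx_ballx; rewrite ltcR.
by apply: filterS => Y; rewrite -ball_normE /ball_/= distrC rnE ltcR.
Qed.

Lemma open_rn (O : set (bounded_op H)) :
  (forall X, O X -> exists2 r : R, 0 < r & forall Y, rn (Y - X) < r -> O Y) -> open O.
Proof.
move=> h; rewrite openE => X /h[r r0 rO]; rewrite /interior.
by apply: filterS (nbhs_rn X r0) => Y; exact: rO.
Qed.

Lemma component_locally_constant (V : set (bounded_op H))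
    (P : bounded_op H -> Prop) X0 X :
  (forall X, V X -> exists2 r : R, 0 < r &
     forall Y, V Y -> rn (Y - X) < r -> (P X <-> P Y)) ->
  P X0 -> connected_component V X0 X -> P X.
Proof.
move=> loc P0 [C [C0 CV cC] CX].
(* A union of balls around points of [C] where [P] has truth value [b]. On [C] it consists of
   exactly those points, so they form a relatively clopen set. *)
pose O (b : bool) := [set Z | exists Y (r : R), [/\ C Y, P Y <-> b, 0 < r,
   rn (Z - Y) < r & forall Z', V Z' -> rn (Z' - Y) < r -> (P Y <-> P Z')]].
have oO b : open (O b).
  apply: open_rn => Z [Y [r [CY PY r0 ZY hr]]].
  exists (r - rn (Z - Y)) => [|Z' Z'Z]; first by rewrite subr_gt0.
  exists Y, r; split; [exact: CY|exact: PY|exact: r0| |exact: hr].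
  apply: (le_lt_trans (rn_tri Z _ _)).
  by rewrite -ltrBrDr.
have inO Y (b : bool) : C Y -> (P Y <-> b) -> O b Y.
  move=> CY PY; have [r r0 hr] := loc _ (CV _ CY).
  by exists Y, r; split; [exact: CY|exact: PY|exact: r0|rewrite subrr rn0|exact: hr].
have OP Y (b : bool) : C Y -> O b Y -> (P Y <-> b).
  move=> CY [Z [r [CZ PZ r0 YZ hr]]].
  by rewrite -PZ; apply: iff_sym; apply: hr => //; exact: CV.
have CE : C `&` O true = C.
  apply: cC.
  - by exists X0; split => //; exact: inO.
  - by exists (O true).
  exists (~` O false); first exact: open_closedC.
  apply/seteqP; split => Y [CY OY]; split => //.
    by move=> /(OP _ _ CY)[h _]; have /h := (OP _ _ CY OY).2 isT.
  apply: (inO Y true CY); split => // _; apply: contrapT => nP.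
  by apply: OY; apply: (inO Y false CY); split.
by move: CX; rewrite -CE => -[CX /(OP _ _ CX)[_]]; apply.
Qed.

Lemma connected_image_component (V W : set (bounded_op H))
    (f : bounded_op H -> bounded_op H) X :
  (forall X, V X -> exists r C : R, [/\ 0 < r, 0 <= C &
     forall Y, V Y -> rn (Y - X) < r -> rn (f X - f Y) <= C * rn (Y - X)]) ->
  f 0 = 0 -> (forall X, V X -> W (f X)) -> connected_component V 0 X ->
  connected_component W 0 (f X).
Proof.
move=> lip f0 fVW [C [C0 CV cC] CX]; exists (f @` C); last by exists X.
split; [by exists 0|by move=> _ [Y CY <-]; exact/fVW/CV|].
apply: connected_continuous_connected => //.
apply/subspace_continuousP => Y CY; apply/cvgrPdist_lt => e e0.
have e0' : 0 < complex.Re e by rewrite -ltcR RRe_real ?gtr0_real.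
have [r [K [r0 K0 hr]]] := lip _ (CV _ CY).
have K1 : 0 < K + 1 by rewrite ltr_wpDl.
have d0 : 0 < Num.min r (complex.Re e / (K + 1)) by rewrite lt_min r0 divr_gt0.
rewrite near_withinE; apply: filterS (nbhs_rn Y d0) => Z /=.
rewrite lt_min => /andP[Zr Ze] CZ; rewrite rnE -(RRe_real (gtr0_real e0)) ltcR.
apply: (le_lt_trans (hr _ (CV _ CZ) Zr)).
move: Ze; rewrite ltr_pdivlMr//; apply: le_lt_trans.
by rewrite mulrC ler_wpM2l ?rn_ge0// lerDl.
Qed.

Lemma op_inv_eq T S : S * T = 1 -> T * S = 1 -> op_inv T = S.
Proof.
move=> ST TS; have [h1 h2] := op_invP (ex_intro _ S (conj ST TS)).
by rewrite -[LHS]mulr1 -TS mulrA h1 mul1r.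
Qed.

Lemma Vdom_inv A X : Vdom A X -> exists G, [/\ adj X X, G * (X * A + 1) = 1,
  (X * A + 1) * G = 1 & Phi A X = G * X].
Proof.
move=> [/saP sX iX]; exists (op_inv (X * A + 1)).
by have [? ?] := op_invP iX; split.
Qed.

(** [G * (X * A + 1) = 1] reads [1 - G * X * A = G], so the operator to be inverted for [- A] is [G]
    itself. [G * X] is self-adjoint because the adjoint of [G] is [L] and [G * X = X * L]. *)
Lemma Phi_Vdom A X : adj A A -> Vdom A X ->
  Vdom (- A) (Phi A X) /\ Phi (- A) (Phi A X) = X.
Proof.
move=> sA VX; have [G [sX h1 h2 PE]] := Vdom_inv VX.
have [l1 l2] := inverse_swap h1 h2; set L := 1 - A * G * X in l1 l2.
have GX : G * X = X * L by exact: Phi_swap h1 l2.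
have GE : G * X * - A + 1 = G.
  rewrite mulrN -mulrA -{1}h1 addrC -mulrBr addrAC subrr add0r mulr1.
  by [].
have sG : adj (G * X) (G * X).
  have aG : adj G L.
    have aXA : adj (X * A + 1) (A * X + 1).
      by apply: adjointD => //; exact: adjointM.
    move=> x y; have xE : (X * A + 1) (G x) = x by rewrite -opM h2.
    have yE : y = (A * X + 1) (L y) by rewrite -opM l2.
    by rewrite {1}yE -aXA xE.
  by rewrite {2}GX; apply: adjointM.
rewrite PE; split; first split.
- exact/(saP dot).
- by rewrite GE; exists (X * A + 1).
rewrite /Phi GE (op_inv_eq h2 h1) mulrA h2 mul1r.
by [].
Qed.

Lemma Phi_lipschitz A X : Vdom A X -> exists r C : R, [/\ 0 < r, 0 <= C &
  forall Y, Vdom A Y -> rn (Y - X) < r ->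
    rn (Phi A X - Phi A Y) <= C * rn (Y - X)].
Proof.
move=> VX; have [G [sX h1 h2 PE]] := Vdom_inv VX.
have [l1 l2] := inverse_swap h1 h2; set L := 1 - A * G * X in l1 l2.
(* Within distance [k^-1] of [X] the hypothesis of [invertible_perturb] holds, so inverses have norm
   at most [2 * rn G]. *)
pose k := 2 * (rn A * rn G) + 1.
have k0 : 0 < k by rewrite ltr_wpDl ?mulr_ge0 ?rn_ge0.
exists k^-1, (2 * rn G * rn L); split; first by rewrite invr_gt0.
  by rewrite !mulr_ge0 ?rn_ge0.
move=> Y VY YX; have [G1 [sY g1 g2 PY]] := Vdom_inv VY.
have [|T [t1 t2 tn]] := invertible_perturb h1 h2 (T := Y * A + 1).
  have -> : X * A + 1 - (Y * A + 1) = (X - Y) * A.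
    by rewrite opprD addrACA subrr addr0 mulrBl.
  apply: (le_trans (ler_wpM2r (rn_ge0 _) (rn_opM _ _))); rewrite rnBC -mulrA.
  have AG : 0 <= rn A * rn G by rewrite mulr_ge0 ?rn_ge0.
  apply: (le_trans (ler_wpM2r AG (ltW YX))); rewrite /k.
  rewrite mulrC ler_pdivrMr//.
  by move: (rn A * rn G) AG => t t0; lra.
have TG : T = G1 by rewrite -[LHS]mulr1 -g2 mulrA t1 mul1r.
rewrite PE PY (Phi_sub g1 h1 l2) -TG.
apply: (le_trans (rn_opM _ _)); rewrite mulrAC ler_wpM2r ?rn_ge0//.
apply: (le_trans (rn_opM _ _)); rewrite rnBC ler_wpM2r ?rn_ge0//.
Qed.

Lemma Udom_Vdom A X : Udom dot A X -> Vdom A X.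
Proof. by move=> [C [_ CV _] CX]; exact: CV. Qed.

Lemma Phi_Udom A X : adj A A -> Udom dot A X -> Udom dot (- A) (Phi A X).
Proof.
move=> sA; apply: connected_image_component => [Y VY||Y VY].
- exact: Phi_lipschitz.
- by rewrite /Phi mulr0.
- exact: (Phi_Vdom sA VY).1.
Qed.

Lemma Phi_bij A : adj A A -> set_bij (Udom dot A) (Udom dot (- A)) (Phi A).
Proof.
move=> sA; have sN : adj (- A) (- A) by exact: adjointN.
split.
- by move=> X UX; exact: Phi_Udom.
- move=> X Y; rewrite !inE => /Udom_Vdom VX /Udom_Vdom VY XY.
  by rewrite -(Phi_Vdom sA VX).2 XY (Phi_Vdom sA VY).2.
move=> Z UZ; exists (Phi (- A) Z).
  by have := Phi_Udom sN UZ; rewrite opprK.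
by have := (Phi_Vdom sN (Udom_Vdom UZ)).2; rewrite opprK.
Qed.

Lemma Udom_opp A X : Udom dot A X -> Udom dot (- A) (- X).
Proof.
apply: (connected_image_component (f := -%R)) => [Y VY||Y [sY iY]].
- exists 1, 1; split => // Z _ _.
  by rewrite mul1r opprK addrC rnBC -rnN opprB -rnBC.
- by rewrite oppr0.
split; last by rewrite mulrNN.
by apply/saP/adjointN/saP.
Qed.

Definition Phi_monotone A := forall X Y, Udom dot A X -> Udom dot A Y ->
  le_op dot X Y -> le_op dot (Phi A X) (Phi A Y).

Lemma Phi_opp A X : Phi (- A) (- X) = - Phi A X.
Proof. by rewrite /Phi mulrNN mulrN. Qed.

Lemma Udom_sa A X : Udom dot A X -> adj X X.
Proof. by move=> /Udom_Vdom[/saP]. Qed.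

Lemma Phi_sa A X : adj A A -> Udom dot A X -> adj (Phi A X) (Phi A X).
Proof. by move=> sA UX; exact: Udom_sa (Phi_Udom sA UX). Qed.

Lemma Phi_monotone_opp A : adj A A -> Phi_monotone A -> Phi_monotone (- A).
Proof.
move=> sA mA X Y UX UY; have sN : adj (- A) (- A) by exact: adjointN.
have PE Z : Phi (- A) Z = - Phi A (- Z) by rewrite -[in LHS](opprK Z) Phi_opp.
have UNX := Udom_opp UX; have UNY := Udom_opp UY; rewrite opprK in UNX UNY.
have sX := Udom_sa UNX; have sY := Udom_sa UNY.
have pX := Phi_sa sA UNX; have pY := Phi_sa sA UNY.
move=> /(le_opP (Udom_sa UX) (Udom_sa UY)) XY; rewrite !PE.
apply/(le_opP (adjointN pX) (adjointN pY)) => x.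
rewrite !opN !rdNl lerN2; apply: (le_opP pY pX).1.
apply: mA => //; apply/(le_opP sY sX) => y.
by rewrite !opN !rdNl lerN2.
Qed.

Lemma order_isomorphism_of_monotone A : adj A A -> Phi_monotone A ->
  order_isomorphism dot (Udom dot A) (Udom dot (- A)) (Phi A).
Proof.
move=> sA mA; have mN := Phi_monotone_opp sA mA.
split; first exact: Phi_bij.
move=> X Y UX UY; split; first exact: mA.
have := mN _ _ (Phi_Udom sA UX) (Phi_Udom sA UY).
by rewrite !(Phi_Vdom sA (Udom_Vdom _)).2.
Qed.

End Components.

(** * Monotonicity from finite index of the shifted operators *)

Section FiniteIndex.
Context {R : realType} {H : completeNormedModType R[i]}.
Variable dot : {dot H for (@Num.conj R[i])}.
Hypothesis dot_norm : forall x : H, dot x x = `|x| ^+ 2.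
Implicit Types (x y z u v w : H) (S T A X Y Z G L : bounded_op H) (eps : R).
Local Notation rd := (re_dot dot).
Local Notation adj := (adj dot).
Local Notation psd := (psd dot).
Local Notation neg_index_ge := (neg_index_ge dot).

Definition finite_index A := forall eps, 0 < eps ->
  exists n, ~ neg_index_ge (A + scal eps) n.

Lemma rn_scal eps : 0 <= eps -> rn (scal eps : bounded_op H) <= eps.
Proof.
by move=> e0; apply: rn_op_le => // x; rewrite scalE rnZr ger0_norm.
Qed.

(** The bound [2 * rn G], uniform in [eps], serves the stability of the index; the linear rate
    serves the final limit [eps -> 0]. *)
Lemma shift_inverse A X G : G * (X * A + 1) = 1 -> (X * A + 1) * G = 1 ->
  exists e C : R, [/\ 0 < e, 0 <= C & forall eps, 0 < eps -> eps < e ->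
    exists T, [/\ T * (X * (A + scal eps) + 1) = 1,
      (X * (A + scal eps) + 1) * T = 1, rn T <= 2 * rn G &
      rn (T * X - G * X) <= C * eps]].
Proof.
move=> h1 h2; pose k := 2 * (rn X * rn G) + 1.
have XG : 0 <= rn X * rn G by rewrite mulr_ge0 ?rn_ge0.
have k0 : 0 < k by rewrite ltr_wpDl// mulr_ge0.
exists k^-1, (2 * rn G * rn X * (rn G * rn X)); split.
- by rewrite invr_gt0.
- by rewrite !mulr_ge0 ?rn_ge0.
move=> eps e0 ek.
have dG : X * A + 1 - (X * (A + scal eps) + 1) = - (X * scal eps).
  by rewrite opprD addrACA subrr addr0 mulrDr opprD addrA subrr add0r.
have nX : rn (X * scal eps) <= rn X * eps.
  by apply: (le_trans (rn_opM _ _)); rewrite ler_wpM2l ?rn_ge0// rn_scal// ltW.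
have [|T [t1 t2 tn]] := invertible_perturb h1 h2 (T := X * (A + scal eps) + 1).
  rewrite dG rnN; apply: (le_trans (ler_wpM2r (rn_ge0 _) nX)).
  rewrite mulrAC; apply: (le_trans (ler_wpM2l XG (ltW ek))).
  rewrite ler_pdivrMr// /k; move: (rn X * rn G) XG => t t0; lra.
exists T; split => //.
have -> : T * X - G * X = T * (X * A + 1 - (X * (A + scal eps) + 1)) * (G * X).
  by rewrite mulrBr t1 mulrBl mul1r mulrA -[T * _ * G]mulrA h2 mulr1.
rewrite dG mulrN mulNr rnN.
apply: (le_trans (rn_opM _ _)).
have n1 : rn (T * (X * scal eps)) <= 2 * rn G * rn X * eps.
  apply: (le_trans (rn_opM _ _)); rewrite -mulrA.
  by apply: ler_pM; rewrite ?rn_ge0.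
apply: (le_trans (ler_pM (rn_ge0 _) (rn_ge0 _) n1 (rn_opM _ _))).
by rewrite mulrAC.
Qed.

(** [M] and [N] bound the inverse and the twisted operator for all small [eps] at once, so the
    smallness condition of [neg_index_stable] gives one radius [r] for all shifts. *)
Lemma twist_index_stable A X : adj A A -> Vdom dot A X -> exists r e : R,
  [/\ 0 < r, 0 < e & forall Y eps n, adj Y Y -> rn (Y - X) < r ->
     0 < eps -> eps < e ->
     (neg_index_ge (twist (A + scal eps) X) n <->
      neg_index_ge (twist (A + scal eps) Y) n)].
Proof.
move=> sA VX; have [G [sX h1 h2 _]] := Vdom_inv VX.
have [e [C [e0 C0 he]]] := shift_inverse h1 h2.
pose a := rn A + 1; pose M := 1 + a * (2 * rn G) * rn X.
pose N := a + a * rn X * a; pose r := (M ^+ 2 * N + 1)^-1.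
have a0 : 0 <= a by rewrite addr_ge0 ?rn_ge0.
have M0 : 0 <= M by rewrite addr_ge0 ?mulr_ge0 ?rn_ge0.
have N0 : 0 <= N by rewrite addr_ge0 ?mulr_ge0 ?rn_ge0.
have MN : 0 < M ^+ 2 * N + 1 by rewrite ltr_wpDl ?mulr_ge0 ?sqr_ge0.
exists r, (Num.min e 1); split; rewrite ?invr_gt0 ?lt_min ?e0 ?ltr01//.
move=> Y eps n sY YX eps0; rewrite lt_min => /andP[epse eps1].
have [T [t1 t2 tn _]] := he _ eps0 epse.
set B := A + scal eps.
have sB : adj B B by apply: adjointD => //; exact: adj_scal.
have Ba : rn B <= a.
  apply: (le_trans (rnD _ _)); rewrite lerD2l.
  by apply: (le_trans (rn_scal (ltW eps0))); exact: ltW.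
have [l1 l2] := inverse_swap t1 t2.
apply: (neg_index_stable dot_norm _ sB sX sY l1).
have LM : rn (1 - B * T * X) <= M.
  apply: (le_trans (rnB _ _)); apply: lerD; first exact: rn_op1.
  apply: (le_trans (rn_opM _ _)); rewrite ler_wpM2r ?rn_ge0//.
  by apply: (le_trans (rn_opM _ _)); apply: ler_pM; rewrite ?rn_ge0.
have SN : rn (twist B X) <= N.
  apply: (le_trans (rnD _ _)); apply: lerD => //.
  apply: (le_trans (rn_opM _ _)); apply: ler_pM; rewrite ?rn_ge0//.
  by apply: (le_trans (rn_opM _ _)); rewrite ler_wpM2r ?rn_ge0.
have LM2 : rn (1 - B * T * X) ^+ 2 <= M ^+ 2.
  by apply: lerXn2r; rewrite ?nnegrE ?rn_ge0.
have LS : rn (1 - B * T * X) ^+ 2 * rn (twist B X) <= M ^+ 2 * N.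
  by apply: ler_pM; rewrite ?sqr_ge0 ?rn_ge0.
rewrite -mulrA; apply: (le_lt_trans (ler_wpM2l (rn_ge0 _) LS)).
have MN' : 0 <= M ^+ 2 * N by rewrite mulr_ge0 ?sqr_ge0.
apply: (le_lt_trans (ler_wpM2r MN' (ltW YX))).
by rewrite mulrC ltr_pdivrMr// mul1r ltrDl.
Qed.

Lemma neg_index_ge0 S : neg_index_ge S 0.
Proof. by exists (fun=> 0) => a [[]]. Qed.

(** The threshold for [eps] may shrink from point to point, so the locally constant property is that
    some threshold exists. At [X = 0] the two operators coincide. *)
Lemma twist_index_Udom A X : adj A A -> Udom dot A X -> exists2 e : R, 0 < e &
  forall eps n, 0 < eps -> eps < e ->
    (neg_index_ge (A + scal eps) n <-> neg_index_ge (twist (A + scal eps) X) n).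
Proof.
move=> sA; pose P Y := exists2 e : R, 0 < e & forall eps n, 0 < eps -> eps < e ->
  (neg_index_ge (A + scal eps) n <-> neg_index_ge (twist (A + scal eps) Y) n).
apply: (@component_locally_constant _ _ _ P) => [Y VY|]; last first.
  by exists 1 => // eps n _ _; rewrite /twist mulr0 mul0r addr0.
have [r [e [r0 e0 he]]] := twist_index_stable sA VY.
exists r; first exact: r0.
move=> Z [/(saP dot) sZ _] ZY; split=> -[d d0 hd];
  exists (Num.min d e); rewrite ?lt_min ?d0 ?e0// => eps n eps0;
  rewrite lt_min => /andP[epsd epse].
- by rewrite (hd _ _ eps0 epsd); exact: he.
- by rewrite (hd _ _ eps0 epsd); apply: iff_sym; exact: he.
Qed.

Lemma Phi_monotone_of_finite_index A : adj A A -> finite_index A ->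
  Phi_monotone dot A.
Proof.
move=> sA fA X Y UX UY.
have sX := Udom_sa UX; have sY := Udom_sa UY.
move=> /(le_opP sX sY) XY.
apply/(le_opP (Phi_sa sA UX) (Phi_sa sA UY)) => w.
have pD : psd (Y - X).
  by split=> [|z]; [exact: adjointB|rewrite opB rdBl subr_ge0].
have [GX [_ x1 x2 ->]] := Vdom_inv (Udom_Vdom UX).
have [GY [_ y1 y2 ->]] := Vdom_inv (Udom_Vdom UY).
have [ex [CX [ex0 CX0 hx]]] := shift_inverse x1 x2.
have [ey [CY [ey0 CY0 hy]]] := shift_inverse y1 y2.
have [ix ix0 hix] := twist_index_Udom sA UX.
have [iy iy0 hiy] := twist_index_Udom sA UY.
rewrite -subr_ge0 -rdBl -opB -oppr_le0.
pose e1 := Num.min (Num.min ex ey) (Num.min ix iy).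
have e10 : 0 < e1 by rewrite !lt_min ex0 ey0 ix0 iy0.
(* The shift changes the form at [w] by at most [(CX + CY) * eps * rn w ^+ 2], which [eps <= d / K]
   keeps below [d]. *)
pose K := (CX + CY) * rn w ^+ 2 + 1.
have K0 : 0 < K by exact: ltr_wpDl (mulr_ge0 (addr_ge0 CX0 CY0) (sqr_ge0 _)) _.
apply: le0_eps => d d0.
pose eps := Num.min (e1 / 2) (d / K).
have eps0 : 0 < eps by rewrite lt_min !divr_gt0.
have : eps < e1.
  by apply: (le_lt_trans (_ : _ <= e1 / 2)); [rewrite ge_min lexx|lra].
rewrite !lt_min => /andP[/andP[epsx epsy] /andP[epsix epsiy]].
have [TX [tx1 tx2 _ nX]] := hx _ eps0 epsx.
have [TY [ty1 ty2 _ nY]] := hy _ eps0 epsy.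
have [_ ly] := inverse_swap ty1 ty2.
set B := A + scal eps in tx1 tx2 ty1 ty2 ly.
have sB : adj B B by apply: adjointD => //; exact: adj_scal.
(* Descending from a failing [m], the first success is the index of [B]; [0] always succeeds. *)
have [n [bn bSn]] : exists n, neg_index_ge B n /\ ~ neg_index_ge B n.+1.
  have [m] := fA _ eps0; elim: m => [|m IH] hm.
    by case: hm; exact: neg_index_ge0.
  by have [bm|/IH //] := pselect (neg_index_ge B m); exists m.
have Yn : neg_index_ge (twist B Y) n by apply/hiy.
have Xn : ~ neg_index_ge (twist B X) n.+1 by move/(hix _ _ eps0 epsix).
have := Phi_monotone_of_index sB sX sY pD tx1 tx2 ty1 ly Yn Xn w.
set Z := GY * Y - GX * X; set Z' := TY * Y - TX * X => pos.
have nZ : rn (Z' - Z) <= (CX + CY) * eps.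
  have -> : Z' - Z = (TY * Y - GY * Y) - (TX * X - GX * X).
    by rewrite /Z /Z' !opprD !opprK addrACA.
  apply: (le_trans (rnB _ _)); rewrite mulrDl addrC.
  exact: lerD.
clearbody Z Z'; have -> : - rd (Z w) w = rd ((Z' - Z) w) w - rd (Z' w) w.
  by rewrite opB rdBl addrAC subrr add0r.
rewrite lerBlDr; apply: (le_trans (rd_op_le dot_norm _ _)).
apply: (le_trans (ler_wpM2r (sqr_ge0 _) nZ)); rewrite mulrAC.
have epsd : eps <= d / K by rewrite ge_min lexx orbT.
have KK : (CX + CY) * rn w ^+ 2 <= K by rewrite lerDl.
have : eps * K <= d by rewrite -ler_pdivlMr.
have := ler_wpM2r (ltW eps0) KK; move: (rd (Z' w) w) pos => q q0.
rewrite [K * eps]mulrC => h1 h2; apply: (le_trans h1); apply: (le_trans h2).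
by rewrite lerDl.
Qed.

End FiniteIndex.

(** * Partial isometries between orthonormal sequences *)

Section Transfer.
Context {R : realType} {H : completeNormedModType R[i]}.
Variable dot : {dot H for (@Num.conj R[i])}.
Hypothesis dot_norm : forall x : H, dot x x = `|x| ^+ 2.
Implicit Types (x y z : H) (a b c d : nat -> H) (T : bounded_op H).
Local Notation rd := (re_dot dot).
Local Notation adj := (adj dot).

Definition onseq a := (forall n, rn (a n) = 1) /\
  forall i j, i != j -> dot (a i) (a j) = 0.

Definition psum a b x n := \sum_(k < n) dot x (a k) *: b k.

Lemma psumS a b x n : psum a b x n.+1 = psum a b x n + dot x (a n) *: b n.
Proof. by rewrite /psum big_ord_recr. Qed.

Lemma dot_psum a b x n y :
  dot (psum a b x n) y = \sum_(k < n) dot x (a k) * dot (b k) y.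
Proof.
elim: n => [|n IH]; first by rewrite /psum !big_ord0 linear0l.
by rewrite psumS big_ord_recr dotDl dotZl IH.
Qed.

Lemma dot_psum_ge a b x n k : onseq b -> (n <= k)%N -> dot (psum a b x n) (b k) = 0.
Proof.
move=> [_ ob] nk; rewrite dot_psum big1// => i _.
by rewrite ob ?mulr0// neq_ltn (leq_trans (ltn_ord i) nk).
Qed.

Lemma rd_orth x y (z : R[i]) : dot x y = 0 -> rd x (z *: y) = 0.
Proof. by move=> xy; rewrite rdC /re_dot dotZl (dot0C xy) mulr0. Qed.

Lemma rn_coef x y : rn y = 1 -> rd x (dot x y *: y) = rn (dot x y *: y) ^+ 2.
Proof.
move=> y1; rewrite -(rdxx dot_norm) -[LHS]subr0 -[in X in _ - X](subrr (rd x (dot x y *: y))).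
set z := dot x y; have : dot (x - z *: y) y = 0.
  by rewrite dotBl dotZl (dot1 dot_norm y1) mulr1 subrr.
move=> /(@rd_orth _ _ z); rewrite rdBl => /eqP; rewrite subr_eq0 => /eqP ->.
by rewrite subrr subr0.
Qed.

Lemma rn_coef_indep x y z z' : rn z = 1 -> rn z' = 1 ->
  rn (dot x y *: z) = rn (dot x y *: z').
Proof. by move=> h h'; rewrite !rnZ h h'. Qed.

(** For unit vectors [a k], the squared modulus of [dot x (a k)], written as a norm to stay in
    [R]. *)
Definition coefs a x k := rn (dot x (a k) *: a k) ^+ 2.

(** The defect is the squared norm of the residue [x - psum a a x n]. *)
Lemma bessel a x n : onseq a -> \sum_(k < n) coefs a x k <= rn x ^+ 2.
Proof.
move=> oa; rewrite -subr_ge0.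
suff -> : rn x ^+ 2 - \sum_(k < n) coefs a x k = rn (x - psum a a x n) ^+ 2.
  exact: sqr_ge0.
elim: n => [|n IH]; first by rewrite /psum !big_ord0 !subr0.
rewrite big_ord_recr opprD addrA IH psumS opprD addrA.
set y := x - _; have yE : dot y (a n) = dot x (a n).
  by rewrite /y dotBl dot_psum_ge// subr0.
rewrite /coefs -yE; clearbody y; rewrite -(rdxx dot_norm (y - _)).
rewrite rdBl !rdBr (rdxx dot_norm y) (rdC dot (_ *: a n) y) rn_coef ?oa.1//.
by rewrite (rdxx dot_norm) subrr subr0.
Qed.

(** The right side is independent of [b], so Bessel's inequality for [a] makes the partial sums
    Cauchy whatever the target sequence. *)
Lemma psum_diff a b x n k : onseq a -> onseq b ->
  rn (psum a b x (n + k)%N - psum a b x n) ^+ 2 =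
  \sum_(i < n + k) coefs a x i - \sum_(i < n) coefs a x i.
Proof.
move=> oa ob; elim: k => [|k IH].
  by rewrite addn0 !subrr rn0 expr0n.
rewrite addnS psumS big_ord_recr addrAC -[in RHS]addrA [coefs _ _ _ + _]addrC.
rewrite [in RHS]addrA -IH.
set y := psum _ _ _ _ - _; set z := dot x _ *: _.
have yz : rd y z = 0.
  by apply: rd_orth; rewrite /y dotBl !dot_psum_ge ?subrr// leq_addr.
have zE : coefs a x (n + k)%N = rn z ^+ 2.
  by rewrite /coefs /z (@rn_coef_indep _ _ _ (b (n + k)%N)) ?oa.1 ?ob.1.
rewrite zE; clearbody y z; rewrite -[in LHS](rdxx dot_norm) rdDl !rdDr.
by rewrite (rdC dot z y) yz addr0 add0r !(rdxx dot_norm).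
Qed.

Lemma rank1_exists y z : exists T : bounded_op H, forall x, T x = dot x y *: z.
Proof.
apply: (@mk_op _ _ _ (2 * rn y * rn z)) => [t u v|x].
  by rewrite dotDl dotZl scalerDl scalerA.
rewrite rnZ mulrAC ler_wpM2r ?rn_ge0//.
rewrite -lecR RRe_real ?ger0_real// dotE.
have -> : rd x y +i* rd x ('i *: y) = (rd x y)%:C + (rd x ('i *: y))%:C * 'i.
  by apply/eqP; rewrite eq_complex/= !(mulr0, mul0r, mulr1, subr0, addr0, add0r) !eqxx.
apply: (le_trans (ler_normD _ _)); rewrite normrM !normcR.
have -> : `|'i| = 1 :> R[i] by rewrite normc_def/= expr0n expr1n add0r sqrtr1.
rewrite mulr1 -rmorphD lecR -mulrA mulr_natl mulr2n [rn y * _]mulrC.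
have iy : rn ('i *: y) = rn y.
  by apply/eqP; rewrite -(@eqrXn2 _ 2)// ?rn_ge0// -!(rdxx dot_norm) rd_i.
by apply: lerD; [exact: CS|rewrite -iy; exact: CS].
Qed.

Lemma transfer_exists a b : onseq a -> onseq b ->
  exists T, forall x, cvs (psum a b x) (T x).
Proof.
move=> oa ob.
have /choice[r rE] : forall k, exists T : bounded_op H, forall x, T x = dot x (a k) *: b k.
  by move=> k; exact: rank1_exists.
pose F n := \sum_(k < n) r k.
have FE n x : F n x = psum a b x n.
  elim: n => [|n IH]; first by rewrite /F /psum !big_ord0.
  by rewrite psumS /F big_ord_recr opD -/(F n) IH rE.
have mono x n k : \sum_(i < n) coefs a x i <= \sum_(i < n + k) coefs a x i.
  by rewrite -subr_ge0 -(psum_diff _ _ _ oa ob) sqr_ge0.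
have [||T FT] := @strong_limit _ _ F 1 ler01.
- move=> n x; rewrite mul1r FE -(@ler_pXn2r _ 2)// ?nnegrE ?rn_ge0//.
  have := psum_diff x 0 n oa ob; rewrite add0n /psum !big_ord0 !subr0 => ->.
  exact: bessel.
- move=> x e e0.
  pose f n := \sum_(i < n) coefs a x i.
  have hs : has_sup (range f).
    split; first by exists (f 0%N), 0%N.
    by exists (rn x ^+ 2) => _ [n _ <-]; exact: bessel.
  have e20 : 0 < e ^+ 2 by rewrite exprn_gt0.
  have [_ [N _ <-] hN] := sup_adherent e20 hs.
  have key n m : (N <= n)%N -> (n <= m)%N -> rn (F n x - F m x) < e.
    move=> Nn nm; rewrite -(@ltr_pXn2r _ 2)// ?nnegrE ?rn_ge0 ?(ltW e0)//.
    rewrite !FE rnBC -(subnKC nm) psum_diff// subnKC//.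
    have h1 : f N <= f n by rewrite -(subnKC Nn); exact: mono.
    have h2 : f m <= sup (range f) by apply: ub_le_sup; [case: hs|exists m].
    by rewrite -/(f n) -/(f m); move: (f N) (f n) (f m) h1 h2 hN => *; lra.
  exists N => n m Nn Nm; case: (leqP n m) => nm; first exact: key.
  by rewrite rnBC key// ltnW.
exists T => x; have -> // : psum a b x = fun n => F n x.
by apply/funext => n; rewrite FE.
Qed.

(** The partial isometry that sends [a k] to [b k] and kills the orthogonal complement of the [a k];
    for [b = a], the projection on the closed span. *)
Definition transfer a b : bounded_op H :=
  xget 0 [set T : bounded_op H | forall x, cvs (psum a b x) (T x)].

Lemma transferP a b x : onseq a -> onseq b -> cvs (psum a b x) (transfer a b x).
Proof.
by move=> oa ob; have := xgetPex 0 (transfer_exists oa ob); exact.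
Qed.

Lemma cvs_rd_eq (u : nat -> H) l y (r : R) N : cvs u l ->
  (forall n, (N <= n)%N -> rd (u n) y = r) -> rd l y = r.
Proof.
move=> ul ur; have := cvs_shift N ul => ul'.
apply/eqP; rewrite eq_le; apply/andP; split.
  by apply: (cvs_rd dot_norm ul') => n; rewrite ur// leq_addl.
by apply: (cvs_rd_ge dot_norm ul') => n; rewrite ur// leq_addl.
Qed.

Lemma cvs_dot_eq (u : nat -> H) l y (r : R[i]) N : cvs u l ->
  (forall n, (N <= n)%N -> dot (u n) y = r) -> dot l y = r.
Proof.
move=> ul ur; rewrite dotE; case: r ur => r1 r2 ur.
have h n : (N <= n)%N -> rd (u n) y = r1 /\ rd (u n) ('i *: y) = r2.
  by move=> /ur; rewrite dotE => -[].
by congr (_ +i* _); apply: (cvs_rd_eq ul) => n /h[].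
Qed.

Lemma transfer_coef a b x k : onseq a -> onseq b ->
  dot (transfer a b x) (b k) = dot x (a k).
Proof.
move=> oa ob; apply: (cvs_dot_eq (N := k.+1) (transferP x oa ob)) => n.
elim: n => [//|n IH]; rewrite ltnS leq_eqVlt psumS dotDl dotZl.
case/predU1P => [->|kn].
  by rewrite dot_psum_ge// add0r (dot1 dot_norm (ob.1 n)) mulr1.
by rewrite IH// ob.2 ?mulr0 ?addr0// neq_ltn kn orbT.
Qed.

Lemma transfer_orth a b x y : onseq a -> onseq b -> (forall k, dot (b k) y = 0) ->
  dot (transfer a b x) y = 0.
Proof.
move=> oa ob yb; apply: (cvs_dot_eq (N := 0) (transferP x oa ob)) => n _.
by rewrite dot_psum big1// => i _; rewrite yb mulr0.
Qed.

Lemma transfer_eq a b c x y : onseq a -> onseq b -> onseq c ->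
  (forall k, dot x (a k) = dot y (c k)) -> transfer a b x = transfer c b y.
Proof.
move=> oa ob oc xy; apply: (cvs_unique (transferP x oa ob)).
have -> : psum a b x = psum c b y; last exact: transferP.
by apply/funext => n; apply: eq_bigr => i _; rewrite xy.
Qed.

Lemma transfer_eq0 a b x : onseq a -> onseq b -> (forall k, dot x (a k) = 0) ->
  transfer a b x = 0.
Proof.
move=> oa ob xa; rewrite -(opx0 (transfer a b)); apply: transfer_eq => // k.
by rewrite xa linear0l.
Qed.

Lemma adj_transfer a b : onseq a -> onseq b -> adj (transfer a b) (transfer b a).
Proof.
move=> oa ob x y; have hab := transferP x oa ob; have hba := transferP y ob oa.
have E n : rd (psum a b x n) y = rd x (psum b a y n).
  elim: n => [|n IH]; first by rewrite /psum !big_ord0 rd0l rd0r.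
  rewrite !psumS rdDl rdDr IH; congr (_ + _).
  rewrite [RHS]rdC /re_dot !dotZl (hermC dot y (b n)) (hermC dot x (a n)).
  rewrite !expr0 !mul1r.
  have reC (p q : R[i]) :
      complex.Re (Num.conj p * q) = complex.Re (Num.conj q * p).
    by case: p q => p p' [q q'] /=; ring.
  exact: reC.
have h1 := @cvs_rd_cvg _ _ _ dot_norm _ _ y hab.
have h2 := @cvs_rd_cvg _ _ _ dot_norm _ _ x hba.
have EE : (fun n => rd (psum a b x n) y) = (fun n => rd (psum b a y n) x).
  by apply/funext => n; rewrite E rdC.
rewrite EE in h1; rewrite [RHS]rdC.
exact: (cvg_unique _ h1 h2).
Qed.

Lemma transferM a b c : onseq a -> onseq b -> onseq c ->
  transfer b c * transfer a b = transfer a c.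
Proof.
move=> oa ob oc; apply: bounded_opP => x; rewrite opM.
by apply: transfer_eq => // k; rewrite transfer_coef.
Qed.

Lemma transferM0 a b c d : onseq a -> onseq b -> onseq c -> onseq d ->
  (forall i j, dot (b i) (c j) = 0) -> transfer c d * transfer a b = 0.
Proof.
move=> oa ob oc od bc; apply: bounded_opP => x; rewrite opM.
by apply: transfer_eq0 => // k; apply: transfer_orth.
Qed.

Lemma transfer_id0 a : onseq a -> transfer a a (a 0%N) = a 0%N.
Proof.
move=> oa; apply: (vec_eq dot_norm) => y.
apply: (cvs_rd_eq (N := 1) (transferP _ oa oa)) => -[//|n _]; congr rd.
rewrite /psum big_ord_recl (dot1 dot_norm (oa.1 _)) scale1r big1 ?addr0// => i _.
by rewrite oa.2 ?scale0r.
Qed.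

End Transfer.

(** * Paths of corner operators *)

Section Paths.
Context {R : realType} {H : completeNormedModType R[i]}.
Variable dot : {dot H for (@Num.conj R[i])}.
Hypothesis dot_norm : forall x : H, dot x x = `|x| ^+ 2.
Implicit Types (x y z u v w : H) (a b : nat -> H) (A B N P S T W X Y : bounded_op H).
Local Notation rd := (re_dot dot).
Local Notation adj := (adj dot).
Local Notation isproj := (isproj dot).
Local Notation onseq := (onseq dot).
Local Notation transfer := (transfer dot).

Lemma segment_component (V : set (bounded_op H)) X Y :
  (forall t : R, 0 <= t <= 1 -> V (X + t%:C *: (Y - X))) ->
  connected_component V X Y.
Proof.
move=> XYV; pose f (t : R) : bounded_op H := X + t%:C *: (Y - X).
have f0 : f 0 = X by rewrite /f scale0r addr0.
have f1 : f 1 = Y by rewrite /f scale1r addrC subrK.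
exists (f @` `[0, 1]); last by exists 1 => //=; rewrite in_itv/= lexx ler01.
split; first by exists 0 => //=; rewrite in_itv/= lexx ler01.
  by move=> _ [t /= + <-]; rewrite in_itv; exact: XYV.
apply: connected_continuous_connected; first exact: segment_connected.
apply: continuous_subspaceT => t; apply/cvgrPdist_lt => e e0.
have e0' : 0 < complex.Re e by rewrite -ltcR RRe_real ?gtr0_real.
have K1 : 0 < rn (Y - X) + 1 by rewrite ltr_wpDl ?rn_ge0.
have d0 : 0 < complex.Re e / (rn (Y - X) + 1) by rewrite divr_gt0.
near=> s; rewrite rnE -(RRe_real (gtr0_real e0)) ltcR /f opprD addrACA subrr add0r.
rewrite -scalerBl -rmorphB rnZr.
have : `|t - s| < complex.Re e / (rn (Y - X) + 1).
  by near: s; apply: cvgr_dist_lt.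
rewrite ltr_pdivlMr//; apply: le_lt_trans.
by rewrite ler_wpM2l// lerDl.
Unshelve. all: by end_near. Qed.

(** Dropping the nonnegative cross term leaves [((1 - t) ^+ 2 + t ^+ 2) * rn u ^+ 2], at least half
    of [rn u ^+ 2]. *)
Lemma segment_coercive u v (t : R) : rn u = rn v -> 0 <= rd u v -> 0 <= t <= 1 ->
  2^-1 * rn u <= rn (u + t%:C *: (v - u)).
Proof.
move=> uv uv0 /andP[t0 t1].
rewrite -(@ler_pXn2r _ 2)// ?nnegrE ?rn_ge0 ?mulr_ge0 ?invr_ge0 ?rn_ge0//.
have -> : rn (u + t%:C *: (v - u)) ^+ 2 =
    (1 - t) ^+ 2 * rn u ^+ 2 + t ^+ 2 * rn v ^+ 2 + 2 * t * (1 - t) * rd u v.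
  rewrite -!(rdxx dot_norm).
  rewrite !(rdDl, rdDr, rdZl, rdZr, rdNl, rdNr) (rdC dot v u).
  move: (rd u u) (rd u v) (rd v v) => *; ring.
rewrite -uv exprMn; have := rn_ge0 u; move: (rn u) (rd u v) uv0 => r s s0 r0.
have := sqr_ge0 r; move: (r ^+ 2) => q q0.
have h1 : 0 <= 2 * t * (1 - t) * s by rewrite !mulr_ge0// subr_ge0.
have h2 : 0 <= (2 * t - 1) ^+ 2 * q by rewrite mulr_ge0// sqr_ge0.
nra.
Qed.

Lemma adj_mul0 S S' T x y : adj S S' -> S' * T = 0 -> rd (S x) (T y) = 0.
Proof. by move=> h ST; rewrite h -opM ST op0 rd0r. Qed.

Lemma transfer_isproj a : onseq a -> isproj (transfer a a).
Proof.
by move=> oa; split; [exact: adj_transfer|exact: transferM].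
Qed.

(* Two self-adjoint involutions whose real inner product is nonnegative at every
   vector, so that the segment joining them consists of invertible operators. *)
Definition reflection a N : bounded_op H :=
  1 - (transfer a a + N + (transfer a a + N)).

Definition exchange a b N : bounded_op H :=
  1 - (transfer a a + transfer b b) + (transfer a b + transfer b a) - (N + N).

(** On the plane of [a k] and [b k] the two are a diagonal reflection and the coordinate swap, whose
    images of any vector are orthogonal for the real inner product; off these planes they agree. So
    the inner product is the squared norm of [x - (p + q)]. *)
Lemma reflection_exchange a b N x : onseq a -> onseq b ->
  (forall i j, dot (a i) (b j) = 0) -> isproj N ->
  transfer a a * N = 0 -> transfer b b * N = 0 ->
  [/\ rn (reflection a N x) = rn x, rn (exchange a b N x) = rn x &
      0 <= rd (reflection a N x) (exchange a b N x)].
Proof.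
move=> oa ob ab [sN NN] aN bN.
have ba i j : dot (b i) (a j) = 0 by rewrite dot0C.
have saa := adj_transfer dot_norm oa oa; have sbb := adj_transfer dot_norm ob ob.
have sab := adj_transfer dot_norm oa ob; have sba := adj_transfer dot_norm ob oa.
have M c d g (oc : onseq c) (od : onseq d) (og : onseq g) :
  transfer d g * transfer c d = transfer c g := transferM dot_norm oc od og.
have M0 c d g h (oc : onseq c) (od : onseq d) (og : onseq g) (oh : onseq h) :
  (forall i j, dot (d i) (g j) = 0) -> transfer g h * transfer c d = 0 :=
  @transferM0 _ _ _ dot_norm c d g h oc od og oh.
have abN : transfer a b * N = 0.
  by rewrite -(M a a b) // -mulrA aN mulr0.
have baN : transfer b a * N = 0.
  by rewrite -(M b b a) // -mulrA bN mulr0.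
set p := transfer a a x; set q := transfer b b x; set n := N x.
set u := transfer a b x; set v := transfer b a x.
have pp : rd p p = rd p x by rewrite /p [LHS]saa -opM M// -saa.
have qq : rd q q = rd q x by rewrite /q [LHS]sbb -opM M// -sbb.
have nn : rd n n = rd n x by rewrite /n [LHS]sN -opM NN -sN.
have vx : rd v x = rd u x by rewrite /v sba rdC.
have uu : rd u u = rd p x by rewrite /u sab -opM M// -saa.
have vv : rd v v = rd q x by rewrite /v sba -opM M// -sbb.
have pq : rd p q = 0 by apply: (adj_mul0 _ _ saa); apply: M0.
have pn : rd p n = 0 by apply: (adj_mul0 _ _ saa).
have qn : rd q n = 0 by apply: (adj_mul0 _ _ sbb).
have uv : rd u v = 0 by apply: (adj_mul0 _ _ sab); apply: M0.
have pu : rd p u = 0 by apply: (adj_mul0 _ _ saa); apply: M0.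
have pv : rd p v = rd u x by rewrite /p saa -opM M// -sab.
have qu : rd q u = rd u x by rewrite /q sbb -opM M// rdC.
have qv : rd q v = 0 by apply: (adj_mul0 _ _ sbb); apply: M0.
have un : rd u n = 0 by apply: (adj_mul0 _ _ sab).
have vn : rd v n = 0 by apply: (adj_mul0 _ _ sba).
have rE : reflection a N x = x - (p + n + (p + n)) by [].
have eE : exchange a b N x = x - (p + q) + (u + v) - (n + n) by [].
have pq0 : 0 <= rd (x - (p + q)) (x - (p + q)) by rewrite rd_ge0.
rewrite rE eE; clearbody p q n u v.
have C := rdC dot.
split.
- apply/eqP; rewrite -(@eqrXn2 _ 2)// ?rn_ge0// -!(rdxx dot_norm); apply/eqP.
  rewrite !(rdDl, rdDr, rdNl, rdNr) !(C x) (C n p) pp nn pn.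
  by move: (rd x x) (rd p x) (rd n x) => *; ring.
- apply/eqP; rewrite -(@eqrXn2 _ 2)// ?rn_ge0// -!(rdxx dot_norm); apply/eqP.
  rewrite !(rdDl, rdDr, rdNl, rdNr) !(C x) (C n p) (C q p) (C u p) (C v p) (C n q).
  rewrite (C u q) (C v q) (C n u) (C n v) (C v u).
  rewrite pp qq nn vx uu vv pq pn qn uv pu pv qu qv un vn.
  by move: (rd x x) (rd p x) (rd n x) (rd q x) (rd u x) => *; ring.
- move: pq0; rewrite !(rdDl, rdDr, rdNl, rdNr) !(C x) (C n p) (C q p) (C n q).
  rewrite (C n u) (C n v).
  rewrite pp qq nn vx pq pn qn pu pv un vn.
  by move: (rd x x) (rd p x) (rd n x) (rd q x) (rd u x) => *; lra.
Qed.

Lemma adj_reflection a N : onseq a -> adj N N -> adj (reflection a N) (reflection a N).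
Proof.
move=> oa sN; have saa := adj_transfer dot_norm oa oa.
by apply: adjointB; [exact: adjoint1|do 2!apply: adjointD].
Qed.

Lemma adj_exchange a b N : onseq a -> onseq b -> adj N N ->
  adj (exchange a b N) (exchange a b N).
Proof.
move=> oa ob sN; have saa := adj_transfer dot_norm oa oa.
have sbb := adj_transfer dot_norm ob ob.
have sab := adj_transfer dot_norm oa ob; have sba := adj_transfer dot_norm ob oa.
apply: adjointB; last exact: adjointD.
apply: adjointD; first by apply: adjointB; [exact: adjoint1|exact: adjointD].
by rewrite {2}[transfer a b + _]addrC; exact: adjointD.
Qed.

Lemma exchangeC a b N : exchange a b N = exchange b a N.
Proof. by rewrite /exchange [X in 1 - X]addrC [X in _ + X - _]addrC. Qed.

Lemma segment_invertible S T :
  adj S S -> adj T T ->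
  (forall x, [/\ rn (S x) = rn x, rn (T x) = rn x & 0 <= rd (S x) (T x)]) ->
  forall t : R, 0 <= t <= 1 -> invertible (S + t%:C *: (T - S)).
Proof.
move=> sS sT h t t01; apply: (coercive_invertible dot_norm (c := 2^-1)).
- by apply: adjointD => //; apply: adjointZ; exact: adjointB.
- by rewrite invr_gt0.
- move=> x; have [S1 T1 ST] := h x.
  by rewrite opD opZ opB -{1}S1; apply: segment_coercive => //; rewrite S1 T1.
Qed.

Lemma invertibleM S T : invertible S -> invertible T -> invertible (S * T).
Proof.
move=> [S' [S'S SS']] [T' [T'T TT']]; exists (T' * S'); split.
  by rewrite mulrA -[_ * _ * S]mulrA S'S mulr1.
by rewrite mulrA -[_ * _ * T']mulrA TT' mulr1.
Qed.

Section Corner.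
Variables A P C W : bounded_op H.
Hypotheses (sA : adj A A) (hP : isproj P) (CE : C = P * A * P + (1 - P))
  (sW : adj W W) (WC : W * C = 1) (CW : C * W = 1).

Lemma mul_compl0 : P * (1 - P) = 0.
Proof. by rewrite mulrBr mulr1 hP.2 subrr. Qed.

Lemma corner_inverse_compl : W * (1 - P) = 1 - P.
Proof.
have CP : C * (1 - P) = 1 - P; last by rewrite -{1}CP mulrA WC mul1r.
rewrite CE mulrDl -mulrA mul_compl0 mulr0 add0r mulrBr mulr1.
by rewrite mulrBl mul1r hP.2 subrr subr0.
Qed.

Lemma supported X : adj X X -> X * (1 - P) = 0 -> X * P = X /\ P * X = X.
Proof.
move=> sX; rewrite mulrBr mulr1 => /eqP; rewrite subr_eq0 => /eqP XP.
split=> //; apply: bounded_opP => x; apply: (vec_eq dot_norm) => y.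
by rewrite opM hP.1 sX -opM -XP -sX.
Qed.

Lemma corner_supported S : S * (1 - P) = 1 - P -> (S - W) * (1 - P) = 0.
Proof. by move=> SP; rewrite mulrBl SP corner_inverse_compl subrr. Qed.

Lemma corner_mul X : adj X X -> X * (1 - P) = 0 -> X * A * P = X * C.
Proof.
move=> sX XP; have [h _] := supported sX XP.
by rewrite CE mulrDr XP addr0 !mulrA h.
Qed.

(** [(S - W) * A * P + 1] is the product [S * C] of invertible operators; [inverse_swap] moves [P]
    to the left, where [P * (S - W) = S - W] absorbs it. *)
Lemma corner_Vdom S : adj S S -> S * (1 - P) = 1 - P -> invertible S ->
  Vdom dot A (S - W).
Proof.
move=> sS SP iS; have sX : adj (S - W) (S - W) by exact: adjointB.
have XP := corner_supported SP; split; first exact/saP.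
have E : (S - W) * A * P + 1 = S * C by rewrite corner_mul// mulrBl WC subrK.
have [G [h1 h2]] : invertible (S * C) by apply: invertibleM => //; exists W.
rewrite -E in h1 h2; have [l1 l2] := inverse_swap h1 h2.
rewrite (mulrA P (S - W) A) (supported sX XP).2 in l1 l2.
by eexists; split; [exact: l1|exact: l2].
Qed.

Lemma corner_path S T : connected_component (Vdom dot A) 0 (S - W) ->
  adj S S -> adj T T -> S * (1 - P) = 1 - P -> T * (1 - P) = 1 - P ->
  (forall t : R, 0 <= t <= 1 -> invertible (S + t%:C *: (T - S))) ->
  connected_component (Vdom dot A) 0 (T - W).
Proof.
move=> cS sS sT SP TP iST; apply: (connected_component_trans cS).
apply: segment_component => t t01.
have -> : S - W + t%:C *: (T - W - (S - W)) = S + t%:C *: (T - S) - W.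
  by rewrite opprB [T - W + _]addrA subrK addrAC.
apply: corner_Vdom; last exact: iST.
  by apply: adjointD => //; apply: adjointZ; exact: adjointB.
have Z : (T - S) * (1 - P) = 0 by rewrite mulrBl TP SP subrr.
rewrite mulrDl SP -[RHS]addr0; congr (_ + _); apply: bounded_opP => x.
by rewrite opM opZ -opM Z op0 scaler0.
Qed.

(* [W z] is the value at [z] of the inverse of [P A P] in the corner. *)
Lemma corner_solve X z : adj X X -> X * (1 - P) = 0 -> P z = z ->
  X (A (W z)) = X z.
Proof.
move=> sX XP Pz.
have PWz : P (W z) = W z.
  have h := corner_inverse_compl.
  have PW : (1 - P) * W = 1 - P.
    apply: bounded_opP => x; apply: (vec_eq dot_norm) => y.
    have sQ : adj (1 - P) (1 - P) by apply: adjointB; [exact: adjoint1|exact: hP.1].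
    by rewrite opM sQ sW -opM h -sQ.
  have : ((1 - P) * W) z = 0 by rewrite PW opB op1 Pz subrr.
  by rewrite opM opB op1 => /eqP; rewrite subr_eq0 => /eqP.
have -> : X (A (W z)) = (X * A * P * W) z by rewrite !opM PWz.
by rewrite corner_mul// -mulrA CW mulr1.
Qed.

End Corner.
End Paths.

(** * Failure of monotonicity when both spectral sides are infinite *)

Section NotMonotone.
Context {R : realType} {H : completeNormedModType R[i]}.
Variable dot : {dot H for (@Num.conj R[i])}.
Hypothesis dot_norm : forall x : H, dot x x = `|x| ^+ 2.
Implicit Types (x y z u v w : H) (a b : nat -> H) (A B N P Q S T W X Y : bounded_op H).
Local Notation rd := (re_dot dot).
Local Notation adj := (adj dot).
Local Notation isproj := (isproj dot).
Local Notation onseq := (onseq dot).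
Local Notation transfer := (transfer dot).
Local Notation reflection := (reflection dot).
Local Notation exchange := (exchange dot).

Lemma form_invertible S (c : R) : adj S S -> 0 < c ->
  (forall x, c * rn x ^+ 2 <= rd (S x) x) -> invertible S.
Proof.
move=> sS c0 h; apply: (coercive_invertible dot_norm sS c0) => x.
have [/rn_eq0 ->|x0] := eqVneq (rn x) 0; first by rewrite opx0 rn0 mulr0.
have xp : 0 < rn x by rewrite lt_neqAle eq_sym x0 rn_ge0.
rewrite -(ler_pM2r xp) -mulrA -expr2.
exact: le_trans (h x) (CSle dot_norm _ _).
Qed.

Lemma transfer_range a Q : onseq a -> isproj Q -> (forall n, Q (a n) = a n) ->
  transfer a a * Q = transfer a a /\ Q * transfer a a = transfer a a.
Proof.
move=> oa [sQ QQ] Qa; have saa := adj_transfer dot_norm oa oa.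
have E : transfer a a * Q = transfer a a.
  apply: bounded_opP => x; rewrite opM; apply: (transfer_eq dot_norm) => // k.
  by rewrite ((saP dot Q).2 sQ) Qa.
split=> //; apply: bounded_opP => x; apply: (vec_eq dot_norm) => y.
by rewrite opM sQ saa -opM E -saa.
Qed.

Lemma onseq_tail a : onseq a -> onseq (a \o succn).
Proof. by move=> [a1 ao]; split=> [n|i j ij]; [exact: a1|exact: ao]. Qed.

Lemma transfer_tail a x : onseq a ->
  transfer (a \o succn) (a \o succn) x = transfer a a x - dot x (a 0%N) *: a 0%N.
Proof.
move=> oa; have ot := onseq_tail oa.
apply: (cvs_unique (transferP dot_norm x ot ot)).
have := cvsD (cvs_shift 1 (transferP dot_norm x oa oa)) (cvsN (cvs_cst (dot x (a 0%N) *: a 0%N))).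
congr cvs; apply/funext => n; rewrite addn1 /psum big_ord_recl addrAC subrr add0r.
by apply: eq_bigr.
Qed.

Section CornerExchange.
Variables A P C W : bounded_op H.
Hypotheses (sA : adj A A) (hP : isproj P) (CE : C = P * A * P + (1 - P))
  (sW : adj W W) (WC : W * C = 1) (CW : C * W = 1).

(** The exchange operator is symmetric in [a] and [b], so segments join it to both reflections. *)
Lemma corner_exchange a b N : onseq a -> onseq b ->
  (forall i j, dot (a i) (b j) = 0) -> isproj N ->
  transfer a a * N = 0 -> transfer b b * N = 0 ->
  transfer a a * (1 - P) = 0 -> transfer b b * (1 - P) = 0 -> N * (1 - P) = 0 ->
  connected_component (Vdom dot A) 0 (reflection a N - W) ->
  connected_component (Vdom dot A) 0 (reflection b N - W).
Proof.
move=> oa ob ab hN aN bN aP bP NP cR.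
have ba i j : dot (b i) (a j) = 0 by rewrite dot0C.
have abP : transfer a b * (1 - P) = 0.
  by rewrite -(transferM dot_norm oa oa ob) -mulrA aP mulr0.
have baP : transfer b a * (1 - P) = 0.
  by rewrite -(transferM dot_norm ob ob oa) -mulrA bP mulr0.
have rP c : transfer c c * (1 - P) = 0 -> reflection c N * (1 - P) = 1 - P.
  by move=> cP; rewrite /reflection mulrBl !mulrDl cP NP mul1r !addr0 subr0.
have eP : exchange a b N * (1 - P) = 1 - P.
  rewrite /exchange mulrBl mulrDl mulrBl !mulrDl aP bP abP baP NP mul1r.
  by rewrite !addr0 !subr0.
have sra := adj_reflection dot_norm oa hN.1.
have srb := adj_reflection dot_norm ob hN.1.
have sex := adj_exchange dot_norm oa ob hN.1.
have step1 : connected_component (Vdom dot A) 0 (exchange a b N - W).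
  apply: (corner_path dot_norm hP CE sW WC CW cR sra sex (rP _ aP) eP).
  apply: (segment_invertible dot_norm sra sex) => x.
  exact: reflection_exchange.
apply: (corner_path dot_norm hP CE sW WC CW step1 sex srb eP (rP _ bP)).
apply: (segment_invertible dot_norm sex srb) => x; rewrite exchangeC rdC.
by have [] := reflection_exchange dot_norm x ob oa ba hN bN aN.
Qed.

End CornerExchange.

Lemma not_monotone A Q Q' (d : R) (e f : nat -> H) :
  adj A A -> isproj Q -> isproj Q' -> Q * A = A * Q -> Q' * A = A * Q' ->
  Q * Q' = 0 -> Q' * Q = 0 -> 0 < d ->
  (forall x, Q x = x -> rd (A x) x <= - d * rn x ^+ 2) ->
  (forall x, Q' x = x -> d * rn x ^+ 2 <= rd (A x) x) ->
  onseq f -> onseq e -> (forall n, Q (f n) = f n) -> (forall n, Q' (e n) = e n) ->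
  ~ Phi_monotone dot A.
Proof.
move=> sA hQ hQ' QA QA' QQ' Q'Q d0 negQ posQ of_ oe Qf Qe.
have fe i j : dot (f i) (e j) = 0.
  by rewrite -Qf -Qe ((saP dot Q).2 hQ.1) -opM QQ' op0 linear0r.
have ef i j : dot (e i) (f j) = 0 by rewrite dot0C.
set E := transfer e e; set F := transfer f f.
have [FQ QF] : F * Q = F /\ Q * F = F by exact: transfer_range.
have [EQ QE] : E * Q' = E /\ Q' * E = E by exact: transfer_range.
have hE : isproj E by exact: transfer_isproj.
have hF : isproj F by exact: transfer_isproj.
have EF : E * F = 0 by exact: transferM0.
have FE : F * E = 0 by exact: transferM0.
have EAF : E * A * F = 0.
  by rewrite -EQ -QF -(mulrA E) QA' !mulrA -(mulrA (E * A)) Q'Q mulr0 mul0r.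
have FAE : F * A * E = 0.
  by rewrite -FQ -QE -(mulrA F) QA !mulrA -(mulrA (F * A)) QQ' mulr0 mul0r.
set P := E + F; have hP : isproj P by exact: projD.
have EP : E * (1 - P) = 0 by rewrite mulrBr mulrDr hE.2 EF mulr1 addr0 subrr.
have FP : F * (1 - P) = 0 by rewrite mulrBr mulrDr hF.2 FE mulr1 add0r subrr.
set C := P * A * P + (1 - P).
(* [C] with the sign of its negative block reversed: [M] is positive definite, and [J * M = C]. *)
pose M := E * A * E - F * A * F + (1 - P).
have CE : C = E * A * E + F * A * F + (1 - P).
  by rewrite /C mulrDr !mulrDl EAF FAE add0r addr0.
have sQ : adj (1 - P) (1 - P) := (proj_compl hP).1.
have sEAE S : adj S S -> adj (S * A * S) (S * A * S).
  by move=> sS; rewrite -{2}mulrA; apply: adjointM => //; exact: adjointM.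
have sM : adj M M by apply: adjointD sQ; apply: adjointB; apply: sEAE; [exact: hE.1|exact: hF.1].
have sC : adj C C.
  by rewrite CE; apply: adjointD sQ; apply: adjointD; apply: sEAE; [exact: hE.1|exact: hF.1].
have FM : F * M = - (F * A * F).
  by rewrite mulrDr mulrBr !mulrA FE !mul0r hF.2 FP add0r addr0.
have F0 : F * (E * A * E) = 0 by rewrite !mulrA FE !mul0r.
pose J := reflection f 0.
have JE : J = 1 - (F + F) by rewrite /J /reflection !addr0.
have FJ : F * J = - F by rewrite JE mulrBr mulr1 mulrDr hF.2 opprD addrA subrr add0r.
have JJ : J * J = 1 by rewrite {1}JE mulrBl mul1r mulrDl FJ -opprD opprK JE subrK.
have JM : J * M = C.
  by rewrite JE mulrBl mul1r mulrDl FM opprD !opprK CE /M addrAC [_ - _ + (_ + _)]addrA subrK.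
have MJ : M * J = C.
  have sJ : adj J J by apply: adj_reflection => //; exact: adjoint0.
  apply: bounded_opP => x; apply: (vec_eq dot_norm) => y.
  by rewrite opM sM sJ -opM JM -sC.
(* [d] bounds the form of [M] on the two spans, and [1] on the complement. *)
pose c := Num.min d 1.
have c0 : 0 < c by rewrite lt_min d0 ltr01.
have c1 : c <= 1 by rewrite ge_min lexx orbT.
have cd : c <= d by rewrite ge_min lexx.
have formM x : c * rn x ^+ 2 <= rd (M x) x.
  have -> : rd (M x) x = rd (A (E x)) (E x) - rd (A (F x)) (F x) + rd ((1 - P) x) x.
    by rewrite /M opD opB !opM rdDl rdBl hE.1 hF.1.
  have h1 := posQ (E x); rewrite -opM QE in h1; have {}h1 := h1 erefl.
  have h2 := negQ (F x); rewrite -opM QF in h2; have {}h2 := h2 erefl.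
  have h3 : 0 <= rd ((1 - P) x) x by apply: (proj_psd dot_norm (proj_compl hP)).2.
  have : rd ((1 - P) x) x = rn x ^+ 2 - rn (E x) ^+ 2 - rn (F x) ^+ 2.
    rewrite opB op1 opD rdBl rdDl !(rdxx dot_norm) (proj_rd dot_norm _ hE).
    by rewrite (proj_rd dot_norm _ hF) opprD addrA.
  move=> h4; rewrite h4 in h3 *; move: h1 h2 h3.
  have := sqr_ge0 (rn (E x)); have := sqr_ge0 (rn (F x)).
  move: (rn x ^+ 2) (rn (E x) ^+ 2) (rn (F x) ^+ 2) (rd _ _) (rd _ _).
  clear -c1 cd c0; clearbody c; move=> q r s t v *; nra.
have [M' [M'M MM']] : invertible M by exact: form_invertible formM.
pose W := M' * J.
have WC : W * C = 1 by rewrite /W -JM mulrA -(mulrA M') JJ mulr1.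
have CW : C * W = 1 by rewrite /W -JM mulrA -(mulrA J) MM' mulr1.
have sW : adj W W.
  move=> x y; have yE : y = C (W y) by rewrite -opM CW.
  have xE : C (W x) = x by rewrite -opM CW.
  by rewrite {1}yE -sC xE.
have MW : M * W = J by rewrite /W mulrA MM' mul1r.
have WP := corner_inverse_compl hP (erefl C) WC.
have sJ : adj J J by apply: adj_reflection => //; exact: adjoint0.
have JP : J * (1 - P) = 1 - P by rewrite JE mulrBl mulrDl FP !addr0 mul1r subr0.
have iW : invertible W by exists C.
have c_J : connected_component (Vdom dot A) 0 (J - W).
  apply: (corner_path dot_norm hP (erefl C) sW WC CW _ sW sJ WP JP).
    rewrite subrr; apply: connected_component_refl; split; first by apply/saP; exact: adjoint0.
    by rewrite mul0r add0r; exists 1; rewrite mulr1.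
  move=> t /andP[t0 t1].
  (* [J = M * W] turns the segment from [W] to [J] into the segment from [1] to [M], made of
     positive definite operators, times [W]. *)
  have -> : W + t%:C *: (J - W) = (1 + t%:C *: (M - 1)) * W.
    apply: bounded_opP => x.
    by rewrite -MW opM !opD op1 !opZ !opB op1 opM.
  apply: invertibleM iW; apply: (@form_invertible _ c) => [||x]; last 2 first.
  - exact: c0.
  - rewrite opD op1 opZ opB op1 rdDl rdZl rdBl (rdxx dot_norm).
    have := formM x; have := sqr_ge0 (rn x).
    move: (rn x ^+ 2) (rd (M x) x); clear -c1 t0 t1; clearbody c => q r q0 qr.
    have h1 : 0 <= (1 - t) * ((1 - c) * q) by rewrite !mulr_ge0// subr_ge0.
    have h2 : 0 <= t * (r - c * q) by rewrite mulr_ge0// subr_ge0.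
    by move: h1 h2; nra.
  - apply: adjointD; first exact: adjoint1.
    by apply: adjointZ; apply: adjointB => //; exact: adjoint1.
have z0 : isproj (0 : bounded_op H) by split; [exact: adjoint0|rewrite mulr0].
have c_E : connected_component (Vdom dot A) 0 (reflection e 0 - W).
  by apply: (corner_exchange hP (erefl C) sW WC CW of_ oe fe z0) => //; rewrite ?mulr0 ?mul0r.
(* Exchanging [f] with the tail of [e] leaves the rank one reflection behind. *)
pose e' := e \o succn; have oe' : onseq e' := onseq_tail oe.
have fe' i j : dot (e' i) (f j) = 0 by rewrite ef.
set E1 := transfer e' e'; pose N := E - E1.
have NE x : N x = dot x (e 0%N) *: e 0%N.
  by rewrite /N opB /E1 transfer_tail// opprB addrC subrK.
have sE1 : adj E1 E1 by exact: adj_transfer.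
have e01 : dot (e 0%N) (e 0%N) = 1 := dot1 dot_norm (oe.1 0%N).
have hN : isproj N.
  split; first exact: adjointB hE.1 sE1.
  by apply: bounded_opP => x; rewrite opM !NE dotZl e01 mulr1.
have E1N : E1 * N = 0.
  apply: bounded_opP => x; rewrite opM NE opxZ (transfer_eq0 dot_norm) ?scaler0// => k.
  by rewrite oe.2.
have FN : F * N = 0.
  apply: bounded_opP => x; rewrite opM NE opxZ (transfer_eq0 dot_norm) ?scaler0// => k.
have NF : N * F = 0.
  apply: bounded_opP => x; apply: (vec_eq dot_norm) => y.
  by rewrite opM hN.1 hF.1 -opM FN op0 rd0l rd0r.
have EN : E * N = N.
  apply: bounded_opP => x; rewrite opM NE opxZ; congr (_ *: _).
  exact: transfer_id0.
have NEq : N * E = N.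
  apply: bounded_opP => x; apply: (vec_eq dot_norm) => y.
  by rewrite opM hN.1 hE.1 -opM EN -hN.1.
have NP : N * (1 - P) = 0 by rewrite mulrBr mulrDr NEq NF mulr1 addr0 subrr.
have E1P : E1 * (1 - P) = 0.
  have -> : E1 = E - N by rewrite /N opprB addrC subrK.
  by rewrite mulrBl EP NP subrr.
have c_X : connected_component (Vdom dot A) 0 (reflection f N - W).
  apply: (corner_exchange hP (erefl C) sW WC CW oe' of_ fe' hN) => //.
  (* As [E = E1 + N], the reflection of [e] is also that of its tail together with [N], and the
     exchange leaves [N] in place. *)
  have <- // : reflection e 0 = reflection e' N.
  by rewrite /reflection addr0 -/E -/E1 /N (addrC E1) subrK.
clearbody N; set X := reflection f N - W in c_X; set Y := J - W in c_J.
have srX : adj (reflection f N) (reflection f N) by apply: adj_reflection => //; exact: hN.1.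
have YX : Y - X = N + N.
  rewrite /Y /X opprB [J - W + _]addrA subrK JE /reflection -/F opprB.
  by rewrite addrC addrA subrK addrACA addrC addKr.
have UX : Udom dot A X by [].
have UY : Udom dot A Y by [].
have [GX [sX GX1 GX2 PX]] := Vdom_inv (Udom_Vdom UX).
have [GY [sY GY1 GY2 PY]] := Vdom_inv (Udom_Vdom UY).
have leXY : le_op dot X Y.
  apply/(le_opP sX sY) => x; rewrite -subr_ge0 -rdBl -opB YX opD rdDl.
  by rewrite addr_ge0// (proj_psd dot_norm hN).2.
move=> /(_ X Y UX UY leXY)/(le_opP (Phi_sa sA UX) (Phi_sa sA UY)).
have [l1 l2] := inverse_swap GY1 GY2.
(* [w] is chosen so that the right factor in [Phi_sub] takes it back to [e0], where [Y - X] acts as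
   multiplication by [2]. *)
pose e0 := e 0%N; pose w := (A * Y + 1) e0.
have Ee0 : E e0 = e0 by exact: transfer_id0.
have Fe0 : F e0 = 0 := transfer_eq0 dot_norm of_ of_ (ef 0%N).
have Ne0 : N e0 = e0 by rewrite NE e01 scale1r.
have Pe0 : P e0 = e0 by rewrite /P opD Ee0 Fe0 addr0.
have rP : reflection f N * (1 - P) = 1 - P.
  by rewrite /reflection mulrBl !mulrDl FP NP mul1r !addr0 subr0.
have XP : X * (1 - P) = 0 by exact: (corner_supported hP (erefl C) WC rP).
have YP : Y * (1 - P) = 0 by exact: (corner_supported hP (erefl C) WC JP).
have XW : X (A (W e0)) = X e0 := corner_solve dot_norm hP (erefl C) sW WC CW sX XP Pe0.
have YW : Y (A (W e0)) = Y e0 := corner_solve dot_norm hP (erefl C) sW WC CW sY YP Pe0.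
(* The reflection sends [e0] to [- e0], so [X e0 = - e0 - W e0]. Hence [GX] sends [e0] to
   [- W e0]. *)
have XWe : (X * A + 1) (W e0) = - e0.
  rewrite opD !opM op1 XW /X opB subrK /reflection opB op1 !opD Fe0 Ne0 add0r.
  by rewrite opprD addrA subrr add0r.
have YWe : Y e0 + W e0 = e0 by rewrite /Y opB subrK JE opB op1 opD Fe0 addr0 subr0.
have vE : (Phi A Y - Phi A X) w = - (W e0 + W e0).
  have Lw : (1 - A * GY * Y) w = e0 by rewrite /w -opM l1 op1.
  rewrite PX PY (Phi_sub GX1 GY1 l2) YX opM Lw opM opD Ne0.
  have -> : e0 + e0 = (X * A + 1) (- (W e0 + W e0)).
    by rewrite opxN opxD XWe opprD !opprK.
  by rewrite -opM GX1 op1.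
move=> /(_ w); rewrite -subr_ge0 -rdBl -opB vE rdNl rdDl.
(* Moving [A] and [Y] to the left argument gives [rd (Y e0 + W e0) e0], and [Y e0 + W e0 = e0]. *)
have -> : rd (W e0) w = 1.
  rewrite /w opD op1 opM rdDr -sA -sY YW -rdDl YWe (rdxx dot_norm).
  by rewrite (oe.1 0%N) expr1n.
by rewrite oppr_ge0 => /le_gtF; rewrite addr_gt0.
Qed.

End NotMonotone.

(** * Compactness of the parts and monotonicity *)

Section Compactness.
Context {R : realType} {H : completeNormedModType R[i]}.
Variable dot : {dot H for (@Num.conj R[i])}.
Hypothesis dot_norm : forall x : H, dot x x = `|x| ^+ 2.
Implicit Types (A P Q T : bounded_op H).
Local Notation adj := (adj dot).

Lemma not_compact_below A P T : adj A A -> nonpos_split dot A P ->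
  T = A * P \/ T = - (A * P) -> ~ compact_op T ->
  exists (d : R) (Q : bounded_op H) (e : nat -> H),
    [/\ 0 < d, below dot A d Q, onseq dot e & forall n, Q (e n) = e n].
Proof.
move=> sA hP TE ncT; apply: contrapT => nex; apply: ncT.
apply: (finite_rank_compact dot_norm sA hP TE) => d d0.
have [Q bQ] := below_exists dot_norm d sA; exists Q => //.
apply: contrapT => nQ; apply: nex.
have [hQ _ _ _] := bQ.
have [e [Qe e1 eo]] := infinite_rank_seq dot_norm hQ nQ.
by exists d, Q, e; split.
Qed.

Lemma compact_finite_index A P T : adj A A -> nonpos_split dot A P ->
  T = A * P \/ T = - (A * P) -> compact_op T -> finite_index dot A.
Proof.
move=> sA hP TE cT d d0; have [Q bQ] := below_exists dot_norm d sA.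
apply: (finite_rank_neg_index dot_norm sA bQ).
exact: compact_finite_rank TE cT d0 bQ.
Qed.

Lemma Phi_monotone_of_compact A : adj A A ->
  compact_op (pos_part dot A) \/ compact_op (neg_part dot A) -> Phi_monotone dot A.
Proof.
move=> sA [cT|cT].
- have [P [hP PE]] := pos_partE dot_norm sA.
  have sNA : adj (- A) (- A) by exact: adjointN.
  rewrite -[A]opprK; apply: Phi_monotone_opp => //.
  apply: (Phi_monotone_of_finite_index dot_norm sNA).
  by apply: (compact_finite_index sNA hP _ cT); right; rewrite mulNr opprK.
- have [P [hP PE]] := neg_partE dot_norm sA.
  apply: (Phi_monotone_of_finite_index dot_norm sA).
  by apply: (compact_finite_index sA hP _ cT); right.
Qed.

Lemma compact_of_Phi_monotone A : adj A A -> Phi_monotone dot A ->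
  compact_op (pos_part dot A) \/ compact_op (neg_part dot A).
Proof.
move=> sA mono; apply: contrapT => /not_orP[nc1 nc2].
have sNA : adj (- A) (- A) by exact: adjointN.
have [P [hP PE]] := neg_partE dot_norm sA.
have [P' [hP' PE']] := pos_partE dot_norm sA.
have [|d [Q [f [d0 [hQ cQ negQ _] of_ Qf]]]] := not_compact_below sA hP _ nc2.
  by right.
have [|d' [Q' [e [d0' [hQ' cQ' posQ _] oe Qe]]]] := not_compact_below sNA hP' _ nc1.
  by right; rewrite mulNr opprK.
have QA : A * Q = Q * A by exact: cQ.
have QA' : A * Q' = Q' * A by apply: cQ'; rewrite mulrN mulNr.
have QNA : Q * - A = - A * Q by rewrite mulrN mulNr QA.
have QQ' : Q * Q' = Q' * Q by exact: cQ'.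
(* The projections commute, so a value [y] of the product lies in both ranges, where the form of [A]
   is at most [- d] and at least [d'] times [rn y ^+ 2]. *)
have Q0 : Q * Q' = 0.
  apply: bounded_opP => x; set y := (Q * Q') x.
  have Qy : Q y = y by rewrite /y -opM mulrA hQ.2.
  have Qy' : Q' y = y by rewrite /y QQ' -opM mulrA hQ'.2.
  have h1 := negQ _ Qy; have h2 := posQ _ Qy'; rewrite opN rdNl in h2.
  apply/rn_eq0/eqP; rewrite -sqrf_eq0; apply/eqP; have := sqr_ge0 (rn y).
  move: h1 h2; move: (rn y ^+ 2) (re_dot dot (A y) y) => q r; clear -d0 d0' => h1 h2 q0.
  nra.
pose c := Num.min d d'; have c0 : 0 < c by rewrite lt_min d0.
suff: ~ Phi_monotone dot A by exact.
apply: (@not_monotone _ _ _ dot_norm A Q Q' c e f) => //.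
- by rewrite -QQ'.
- move=> x /negQ; move/le_trans; apply; rewrite ler_wpM2r ?sqr_ge0// lerN2.
  by rewrite ge_min lexx.
- move=> x /posQ; rewrite opN rdNl mulNr lerN2; apply: le_trans.
  by rewrite ler_wpM2r ?sqr_ge0// ge_min lexx orbT.
Qed.

End Compactness.

Theorem theorem5p9 (R : realType) (H : completeNormedModType R[i])
    (dot : {dot H for (@Num.conj R[i])})
    (dot_norm : forall x : H, dot x x = `|x| ^+ 2)
    (dimH : dim_ge H 2)
    (A : bounded_op H) (hA : self_adjoint dot A) :
  (compact_op (pos_part dot A) \/ compact_op (neg_part dot A)) <->
  order_isomorphism dot (Udom dot A) (Udom dot (- A)) (Phi A).
Proof.
have sA := (saP dot A).1 hA; split=> [cA|[_ mono]].
  exact/(order_isomorphism_of_monotone sA)/Phi_monotone_of_compact.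
apply: (compact_of_Phi_monotone dot_norm sA) => X Y UX UY XY.
exact/(mono X Y UX UY).
Qed.
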